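(* Let $M$ be a matroid that admits a cycle system $\mathcal{C}$. Then $M$ is regular, i.e. representable over every field.
   Context: Matroids are on finite ground sets; $E(M)$ is the ground set and $r(M)$ the rank. A set is dependent if it is not independent. A cycle of $M$ is a subset of $E(M)$ that can be expressed as a union of circuits. The corank of $M$ is $g=|E(M)|-r(M)$. For subsets $A_1,\dots,A_k$ of a set $E$ and $S\subseteq[k]=\{1,\dots,k\}$, the unique union $\mathcal{A}_S=\ast\{A_i: i\in S\}$ is the set of elements of $E$ that belong to exactly one of the sets $A_i$, $i\in S$. A cycle system on a matroid $M$ of corank $g$ is a collection $\mathcal{C}=\{C_1,\dots,C_g\}$ of $g$ cycles of $M$ such that for every nonempty $S\subseteq[g]$ the unique union $\mathcal{C}_S=\ast\{C_i:i\in S\}$ is dependent in $M$. *)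

(* Defs.v *)
From mathcomp Require Import all_boot all_order all_algebra.

Set Implicit Arguments.
Unset Strict Implicit.
Unset Printing Implicit Defensive.

(* The ground set E(M) is the whole finite type T. *)
Record matroid (T : finType) := Matroid {
  indep : pred {set T};
  indep0 : indep set0;
  indepS : forall A B : {set T}, A \subset B -> indep B -> indep A;
  indep_aug : forall A B : {set T}, indep A -> indep B -> #|A| < #|B| ->
    exists2 x, x \in B :\: A & indep (x |: A)
}.

Definition dependent (T : finType) (M : matroid T) (A : {set T}) : bool :=
  ~~ indep M A.

Definition circuit (T : finType) (M : matroid T) (A : {set T}) : bool :=
  minset (dependent M) A.

Definition cycle_of (T : finType) (M : matroid T) (A : {set T}) : Prop :=
  exists2 P : {set {set T}}, (forall D, D \in P -> circuit M D) & A = cover P.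

Definition rank (T : finType) (M : matroid T) : nat :=
  \max_(A : {set T} | indep M A) #|A|.

(* The subtraction never truncates, since rank M <= #|T|. *)
Definition corank (T : finType) (M : matroid T) : nat := #|T| - rank M.

Definition unique_union (T I : finType) (A : I -> {set T}) (S : {set I}) :
    {set T} :=
  [set e | #|[set i in S | e \in A i]| == 1].

(* Injectivity of C need not be required: if C i = C j with i != j then
   unique_union C [set i; j] is empty, hence independent. *)
Definition cycle_system (T : finType) (M : matroid T)
    (C : 'I_(corank M) -> {set T}) : Prop :=
  (forall i, cycle_of M (C i)) /\
  (forall S : {set 'I_(corank M)}, S != set0 ->
     dependent M (unique_union C S)).

(* Linear independence is that of the family (v x) indexed by x \in A: free
   counts repeated vectors, so parallel elements are dependent. *)
Definition representable (T : finType) (F : fieldType) (M : matroid T) : Prop :=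
  exists (n : nat) (v : T -> 'cV[F]_n),
    forall A : {set T}, indep M A = free [seq v x | x <- enum A].

Definition regular (T : finType) (M : matroid T) : Prop :=
  forall F : fieldType, representable F M.

(* Main.v *)
(* The proof is by induction on the number of elements lying in circuits.  A cycle
   system survives the contraction of an element e (each C i becomes C i minus e),
   the deletion of an element lying in exactly one C i (drop C i) and, when M is
   binary, the deletion of an element lying in exactly two of the C i (merge these
   two).  So in a minimal counterexample all these minors are regular.

   If M is not binary, then since its contractions are, it has a four-point line Q.
   Every element lying in exactly one C i is then in Q, since its deletion is binary.
   If M is binary but not representable over F, then a restriction of M that is
   critical for F has seven elements and is the Fano plane or its dual Q, as in
   Tutte's theorem: one glues representations of minors, and the obstruction to
   gluing exhibits Q.  All elements outside Q are loops, coloops or parallel to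
   elements of Q, and an element lying in one or two of the C i must be in Q and
   parallel to no other element.

   The unique unions provide circuits K consisting of such deletable elements.  As the
   C i satisfy a Hall condition with respect to the bases of M, the elements of K lie
   in distinct C i, and so each of them is spanned by elements outside K.  Hence Q
   is spanned by the few elements of Q outside K, which is impossible. *)

Require Import Defs.
From mathcomp Require Import all_boot all_order all_algebra.
From mathcomp Require Import ring zify.
From Stdlib Require Import Classical.

Set Implicit Arguments.
Unset Strict Implicit.
Unset Printing Implicit Defensive.

Import GRing.Theory.
Local Open Scope ring_scope.

(** * Binary cycle spaces *)

Section SymDiff.
Variable T : finType.
Implicit Types A B C D Z : {set T}.

(** Gluing rests on uniqueness: over any field, two representations of a binary matroid differ only
    by a scaling of the elements ([code_unique]), so representations of two minors can be made to
    agree on a common minor. This is why a representation is kept as its space of linear relations: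
    contraction drops a coordinate, deletion selects relations and scaling acts coordinatewise;
    vectors return only in [frep_representable]. With a triangle {x, y, b}, a representation of the
    deletion of b is to be extended. The only unknown is the slope at {x, y} of the relation carried
    by the triangle, and two circuits that ask for different slopes produce the Fano plane. Without
    triangles, the contractions of x and y are glued; again only two slopes at {x, y} can clash, and
    the dual Fano plane appears. An excluded minor somewhere in M would not suffice: the final count
    concerns elements of M itself, so the seven points are located in a restriction of M. *)

Definition sdiff A B : {set T} := [set x | (x \in A) (+) (x \in B)].

Lemma in_sdiff x A B : (x \in sdiff A B) = (x \in A) (+) (x \in B).
Proof. by rewrite inE. Qed.

Lemma sdiff0 A : sdiff A set0 = A.
Proof. by apply/setP=> z; rewrite !inE addbF. Qed.

Lemma sdiff_eq0 A B : (sdiff A B == set0) = (A == B).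
Proof.
apply/eqP/eqP=> [/setP AB|->]; apply/setP=> z.
  by have := AB z; rewrite !inE; case: (z \in A); case: (z \in B).
by rewrite !inE addbb.
Qed.

Lemma sdiffC A B : sdiff A B = sdiff B A.
Proof. by apply/setP=> z; rewrite !inE addbC. Qed.

Lemma subset_imp A B : A \subset B -> forall z, (z \in A) ==> (z \in B).
Proof. by move=> /subsetP AB z; apply/implyP/AB. Qed.

Lemma imp_subset A B : (forall z, (z \in A) ==> (z \in B)) -> A \subset B.
Proof. by move=> AB; apply/subsetP=> z; apply/implyP. Qed.

Lemma imp_set_eq A B : (forall z, ~~ ((z \in A) (+) (z \in B))) -> A = B.
Proof.
by move=> AB; apply/setP=> z; have := AB z; case: (z \in A); case: (z \in B).
Qed.

End SymDiff.

(* Proves an inclusion or equality of sets pointwise; it consumes every inclusion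
   of the context. *)
Ltac sets_at z :=
  repeat match goal with
  | H : is_true (_ \subset _) |- _ => move: (subset_imp H z); clear H
  end;
  rewrite ?inE /=;
  repeat match goal with
  | |- context [ ?x \in ?A ] => let b := fresh "b" in set b := (x \in A); clearbody b
  end;
  repeat match goal with
  | |- context [ ?x == ?y ] => let b := fresh "b" in set b := (x == y); clearbody b
  end;
  repeat match goal with b : bool |- _ => destruct b end;
  try done.

Ltac sets :=
  first [ apply: imp_subset | apply: imp_set_eq ];
  let z := fresh "z" in move=> z; sets_at z.

Section Bspace.
Variable T : finType.
Implicit Types A B C D : {set T}.
Implicit Types W Y Z : {set T}.
Implicit Types ZZ : {set {set T}}.

(* The cycle space over F_2 of a binary matroid on T.  Minors keep the ground set T:
   an element that was removed lies in no cycle. *)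
Definition bspace ZZ :=
  set0 \in ZZ /\ forall Y Z, Y \in ZZ -> Z \in ZZ -> sdiff Y Z \in ZZ.

Definition dep ZZ A := [exists Z, [&& Z \in ZZ, Z != set0 & Z \subset A]].

Definition circ ZZ : pred {set T} := minset (dep ZZ).

Lemma depP ZZ A :
  reflect (exists Z, [/\ Z \in ZZ, Z != set0 & Z \subset A]) (dep ZZ A).
Proof. by apply: (iffP existsP) => -[Z /and3P H]; exists Z. Qed.

Lemma depS ZZ A B : A \subset B -> dep ZZ A -> dep ZZ B.
Proof.
move=> AB /depP[Z [Zi Z0 ZA]]; apply/depP; exists Z; split=> //.
exact: subset_trans ZA AB.
Qed.

Lemma circP ZZ C :
  reflect [/\ C \in ZZ, C != set0 &
     forall Z, Z \in ZZ -> Z != set0 -> Z \subset C -> Z = C] (circ ZZ C).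
Proof.
apply: (iffP minsetP) => [[/depP[Z [Zi Z0 ZC]] minC]|[Ci C0 minC]].
  have eqZ : Z = C by apply: minC => //; apply/depP; exists Z.
  rewrite eqZ in Zi Z0; split=> // Y Yi Y0 YC.
  by apply: minC => //; apply/depP; exists Y.
split; first by apply/depP; exists C.
move=> B /depP[Z [Zi Z0 ZB]] BC.
have eqZ := minC Z Zi Z0 (subset_trans ZB BC).
by apply/eqP; rewrite eqEsubset BC -{1}eqZ.
Qed.

Lemma circ_in ZZ C : circ ZZ C -> C \in ZZ.
Proof. by case/circP. Qed.

Lemma circ_neq0 ZZ C : circ ZZ C -> C != set0.
Proof. by case/circP. Qed.

Lemma circ_min ZZ C Z : circ ZZ C -> Z \in ZZ -> Z \subset C -> Z != set0 -> Z = C.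
Proof. by case/circP=> _ _ H Zi ZC Z0; apply: H. Qed.

Lemma circ_sub0 ZZ C Z x :
  circ ZZ C -> Z \in ZZ -> Z \subset C -> x \in C -> x \notin Z -> Z = set0.
Proof.
move=> Cc Zi ZC xC xZ; case: (eqVneq Z set0) => // /(circ_min Cc Zi ZC) eqZ.
by rewrite eqZ xC in xZ.
Qed.

Lemma dep_circ ZZ A : dep ZZ A -> exists2 C, circ ZZ C & C \subset A.
Proof. by move=> /minset_exists[C Cm CA]; exists C. Qed.

Lemma circ_thru ZZ Z x : bspace ZZ -> Z \in ZZ -> x \in Z ->
  exists C, [/\ circ ZZ C, x \in C & C \subset Z].
Proof.
move=> [Z0 ZD] Zi xZ.
pose P : pred {set T} := [pred Y : {set T} | (Y \in ZZ) && (x \in Y)].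
have P0 : P Z by apply/andP.
have [C /minsetP[/andP[Ci xC] minC] CZ] := minset_exists P0.
exists C; split=> //; apply/circP; split=> //; first by apply/set0Pn; exists x.
move=> Y Yi Y0 YC; case xY: (x \in Y); first by apply: minC => //; apply/andP.
have: sdiff C Y = C.
  apply: minC; last by sets.
  by apply/andP; split; [exact: ZD | rewrite in_sdiff xC xY].
move=> eqC; case/set0Pn: Y0 => y yY; move/setP/(_ y): eqC.
by rewrite in_sdiff yY (subsetP YC y yY).
Qed.

Definition con e ZZ : {set {set T}} := [set Z :\ e | Z in ZZ].
Definition del e ZZ : {set {set T}} := [set Z in ZZ | e \notin Z].
Definition restr A ZZ : {set {set T}} := [set Z in ZZ | Z \subset A].

Lemma conP e ZZ Y : reflect (exists2 Z, Z \in ZZ & Y = Z :\ e) (Y \in con e ZZ).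
Proof. exact: imsetP. Qed.

Lemma con_in e ZZ Z : Z \in ZZ -> Z :\ e \in con e ZZ.
Proof. exact: imset_f. Qed.

Lemma con_inN e ZZ Z : Z \in ZZ -> e \notin Z -> Z \in con e ZZ.
Proof.
move=> Zi eZ; have -> : Z = Z :\ e by apply/esym/setDidPl; rewrite disjoint_sym disjoints1.
exact: con_in.
Qed.

Lemma con_notin e ZZ Y : Y \in con e ZZ -> e \notin Y.
Proof. by case/conP=> Z _ ->; rewrite setD11. Qed.

Lemma bspace_con e ZZ : bspace ZZ -> bspace (con e ZZ).
Proof.
move=> [Z0 ZD]; split.
  by apply/conP; exists set0; rewrite ?set0D.
move=> _ _ /conP[Y Yi ->] /conP[Z Zi ->]; apply/conP; exists (sdiff Y Z); first exact: ZD.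
by sets.
Qed.

Lemma bspace_restr A ZZ : bspace ZZ -> bspace (restr A ZZ).
Proof.
move=> [Z0 ZD]; split; first by rewrite inE Z0 sub0set.
move=> Y Z; rewrite !inE => /andP[Yi YA] /andP[Zi ZA]; rewrite ZD //=.
by sets.
Qed.

Lemma del_restr e ZZ : del e ZZ = restr (~: [set e]) ZZ.
Proof. by apply/setP=> Z; rewrite !inE subsetC sub1set inE. Qed.

Lemma bspace_del e ZZ : bspace ZZ -> bspace (del e ZZ).
Proof. by rewrite del_restr; apply: bspace_restr. Qed.

Lemma conC e f ZZ : con e (con f ZZ) = con f (con e ZZ).
Proof.
rewrite /con -!imset_comp; apply: eq_imset => Z /=.
by rewrite !setDDl setUC.
Qed.

Lemma con_dep e ZZ A : [set e] \notin ZZ -> dep (con e ZZ) A = dep ZZ (e |: A) :> bool.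
Proof.
move=> e0; apply/depP/depP => [[_ [/conP[Z Zi ->] Z0 ZA]]|[Z [Zi Z0 ZA]]].
  exists Z; split=> //; last by rewrite -subDset.
  by apply: contraNneq Z0 => ->; rewrite set0D.
exists (Z :\ e); split; [exact: con_in | | by rewrite subDset].
apply: contraNneq e0 => /eqP; rewrite setD_eq0 subset1 (negPf Z0) orbF => /eqP <-.
exact: Zi.
Qed.

Lemma circ_restr A ZZ C : circ (restr A ZZ) C = circ ZZ C && (C \subset A).
Proof.
apply/circP/andP=> [[]|[/circP[Ci C0 Cm] CA]].
  rewrite inE => /andP[Ci CA] C0 Cm; split=> //; apply/circP; split=> // Z Zi Z0 ZC.
  by apply: Cm; rewrite // inE Zi (subset_trans ZC CA).
split=> //; first by rewrite inE Ci.
by move=> Z; rewrite inE => /andP[Zi _]; apply: Cm.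
Qed.

Lemma circ_del e ZZ C : circ (del e ZZ) C = circ ZZ C && (e \notin C).
Proof. by rewrite del_restr circ_restr subsetC sub1set inE. Qed.

Lemma circ_con_in e ZZ C : circ ZZ C -> e \in C -> C != [set e] -> circ (con e ZZ) (C :\ e).
Proof.
move=> Cc eC Ce; apply/circP; split; first exact/con_in/circ_in.
  by rewrite setD_eq0 subset1 (negPf Ce) (negPf (circ_neq0 Cc)).
move=> _ /conP[Z Zi ->] Z0 ZC; congr (_ :\ _); apply: circ_min Cc Zi _ _.
  by move: eC => eC; rewrite -(setD1K eC) -subDset.
by apply: contraNneq Z0 => ->; rewrite set0D.
Qed.

Lemma circ_con_out e ZZ C : circ ZZ C -> e \notin C ->
  (forall Z, Z \in ZZ -> e \in Z -> ~~ (Z \subset e |: C)) -> circ (con e ZZ) C.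
Proof.
move=> Cc eC Ce; apply/circP; split; first exact: con_inN (circ_in Cc) eC.
  exact: circ_neq0 Cc.
move=> _ /conP[Z Zi ->] Z0 ZC.
have ZeC : Z \subset e |: C by rewrite -subDset.
have eZ : e \notin Z by apply/negP=> /(Ce Z Zi); rewrite ZeC.
have eqZ : Z :\ e = Z by apply/setDidPl; rewrite disjoint_sym disjoints1.
by rewrite eqZ in Z0 ZC *; apply: circ_min Cc Zi ZC Z0.
Qed.

Lemma circ_of_con e ZZ C : [set e] \notin ZZ -> circ (con e ZZ) C ->
  exists2 D, circ ZZ D & C = D :\ e.
Proof.
move=> e0 Cc; case/conP: (circ_in Cc) => Z Zi eqC.
have Zn0 : Z != set0.
  by apply: contraNneq (circ_neq0 Cc) => Z0; rewrite eqC Z0 set0D.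
have /dep_circ[D Dc DZ] : dep ZZ Z by apply/depP; exists Z.
exists D => //; apply/esym; apply: circ_min Cc (con_in _ (circ_in Dc)) _ _.
  by rewrite eqC setSD.
apply: contraNneq e0 => /eqP; rewrite setD_eq0 subset1 (negPf (circ_neq0 Dc)) orbF.
by move/eqP=> <-; exact: circ_in.
Qed.

(** Induct on the size of [C1 :|: C2]. A circuit A through x inside C1 + C2 either contains y or can
    replace C1: it meets C2, being otherwise a proper part of C1, and its union with C2 is smaller,
    since otherwise C1 + C2 + A would be a proper part of C2 containing y. *)
Lemma circ_link ZZ C1 C2 x y : bspace ZZ -> circ ZZ C1 -> circ ZZ C2 ->
  x \in C1 -> y \in C2 -> C1 :&: C2 != set0 ->
  exists C, [/\ circ ZZ C, x \in C, y \in C & C \subset C1 :|: C2].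
Proof.
move=> bZ; have [n] := ubnP #|C1 :|: C2|.
elim: n C1 => // n IHn C1 ltn c1 c2 xC1 yC2 meet.
case yC1: (y \in C1); first by exists C1; rewrite subsetUl.
case xC2: (x \in C2); first by exists C2; rewrite subsetUr.
have ZD := bZ.2; have Si : sdiff C1 C2 \in ZZ by apply: ZD; apply: circ_in.
have xS : x \in sdiff C1 C2 by rewrite in_sdiff xC1 xC2.
have [A [Ac xA AS]] := circ_thru bZ Si xS.
case yA: (y \in A); first by exists A; split=> //; sets.
have AC2 : A :&: C2 != set0.
  apply: contraTneq meet => /eqP; rewrite setI_eq0 => dA.
  have AC1 : A \subset C1.
    apply/subsetP=> z zA; have := subsetP AS z zA; rewrite in_sdiff.
    by rewrite (disjointFr dA zA) addbF.
  have eqA := circ_min c1 (circ_in Ac) AC1 (circ_neq0 Ac).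
  by rewrite -eqA setI_eq0 dA.
have ltA : (#|A :|: C2| < n)%N.
  apply: leq_trans (_ : #|A :|: C2| < #|C1 :|: C2|)%N _ => //.
  apply: proper_card; rewrite properE; apply/andP; split; first by sets.
  apply/negP=> sub; have Yi : sdiff (sdiff C1 C2) A \in ZZ by apply: ZD => //; apply: circ_in.
  have YC2 : sdiff (sdiff C1 C2) A \subset C2 by sets.
  have yY : y \in sdiff (sdiff C1 C2) A by rewrite !in_sdiff yC1 yC2 yA.
  have Y0 : sdiff (sdiff C1 C2) A != set0 by apply/set0Pn; exists y.
  have eqY := circ_min c2 Yi YC2 Y0.
  case/set0Pn: meet => z; rewrite inE => /andP[z1 z2].
  move: (z2); rewrite -eqY !in_sdiff z1 z2 /= => zA.
  by have := subsetP AS z zA; rewrite in_sdiff z1 z2.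
have [C [Cc xC yC CA]] := IHn A ltA Ac c2 xA yC2 AC2.
by exists C; split=> //; sets.
Qed.

End Bspace.

(** * Representations as spaces of relations *)

Section Codes.
Variables (T : finType) (F : fieldType).
Implicit Types A B C D Y Z : {set T}.
Implicit Types ZZ : {set {set T}}.
Implicit Types c d s : {ffun T -> F}.

Definition supp c : {set T} := [set e | c e != 0].
Definition sc (t : F) c : {ffun T -> F} := [ffun e => t * c e].

(* R is the space of linear relations between the vectors of a representation of
   the matroid whose dependent sets are given by D. *)
Record code_for (R : {ffun T -> F} -> Prop) (D : pred {set T}) : Prop := CodeFor {
  code0 : R 0;
  codeD : forall c d, R c -> R d -> R (c + d);
  codeZ : forall t c, R c -> R (sc t c);
  code_circ : forall C, minset D C -> exists2 c, R c & supp c = C;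
  code_dep : forall c, R c -> supp c != set0 -> D (supp c)
}.

Definition frep (D : pred {set T}) := exists R, code_for R D.

Lemma in_supp c e : (e \in supp c) = (c e != 0).
Proof. by rewrite inE. Qed.

Lemma suppN c e : e \notin supp c -> c e = 0.
Proof. by rewrite inE negbK => /eqP. Qed.

Lemma supp_eq0 c : supp c = set0 -> c = 0.
Proof. by move=> c0; apply/ffunP=> e; rewrite ffunE suppN // c0 inE. Qed.

Lemma supp0 : supp 0 = set0.
Proof. by apply/setP=> e; rewrite !inE ffunE eqxx. Qed.

Lemma supp_sub c A : (forall e, e \notin A -> c e = 0) -> supp c \subset A.
Proof. by move=> cA; apply/subsetP=> e; rewrite inE; apply: contraR => /cA ->. Qed.

Lemma sub_supp c A e : supp c \subset A -> e \notin A -> c e = 0.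
Proof. by move=> cA eA; apply: suppN; apply: contra eA; apply: (subsetP cA). Qed.

Lemma scE t c e : sc t c e = t * c e.
Proof. by rewrite ffunE. Qed.

Lemma addE c d e : (c + d) e = c e + d e.
Proof. by rewrite ffunE. Qed.

Lemma supp_sc t c : t != 0 -> supp (sc t c) = supp c.
Proof. by move=> t0; apply/setP=> e; rewrite !inE scE mulf_eq0 (negPf t0). Qed.

Lemma supp_add_sc c d t A : supp c \subset A -> supp d \subset A -> supp (c + sc t d) \subset A.
Proof.
by move=> cA dA; apply: supp_sub => e eA; rewrite addE scE !(sub_supp _ eA) // mulr0 addr0.
Qed.

Lemma frep_ext (D1 D2 : pred {set T}) : D1 =1 D2 -> frep D1 -> frep D2.
Proof.
move=> eqD [R [r0 rD rZ rC rd]]; exists R; split=> // [C mC|c Rc c0].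
  by apply: rC; rewrite (minset_eq _ eqD).
by rewrite -eqD; apply: rd.
Qed.

Section OneCode.
Variables (R : {ffun T -> F} -> Prop) (ZZ : {set {set T}}).
Hypothesis rR : code_for R (dep ZZ).

Lemma code_comb c d t : R c -> R d -> R (c + sc t d).
Proof. by move=> Rc Rd; apply: (codeD rR) => //; apply: (codeZ rR). Qed.

Lemma code_indep c A : R c -> supp c \subset A -> ~~ dep ZZ A -> c = 0.
Proof.
move=> Rc cA iA; apply: supp_eq0; apply/eqP; apply: contraNT iA => c0.
exact: depS cA (code_dep rR Rc c0).
Qed.

Lemma code_circ_eq c d C : circ ZZ C -> R c -> R d -> supp c = C -> supp d \subset C ->
  exists t, d = sc t c.
Proof.
move=> Cc Rc Rd cC dC; have [e eC] := set0Pn _ (circ_neq0 Cc).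
have ce : c e != 0 by rewrite -in_supp cC.
exists (d e / c e); set t := d e / c e.
have Rx : R (d + sc (- t) c) by apply: code_comb.
have x0 : d + sc (- t) c = 0.
  apply: (code_indep Rx (A := C :\ e)).
    apply: supp_sub => f; rewrite !inE negb_and negbK addE scE => /orP[/eqP->|fC].
      by rewrite mulNr divfK // subrr.
    by rewrite (sub_supp dC fC) (@sub_supp c C) ?cC // mulr0 addr0.
  apply/depP=> -[Z [Zi Z0 ZC]].
  have := circ_sub0 Cc Zi _ eC; rewrite (subset_trans ZC (subsetDl _ _)) => /(_ isT) H.
  have eZ : e \notin Z by apply/negP=> /(subsetP ZC); rewrite !inE eqxx.
  by rewrite H ?eqxx in Z0.
apply/ffunP=> f; move/ffunP/(_ f): x0; rewrite addE !scE ffunE mulNr => /eqP.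
by rewrite subr_eq0 => /eqP.
Qed.

Lemma code_thru c e : R c -> e \in supp c ->
  exists C, [/\ circ ZZ C, e \in C & C \subset supp c].
Proof.
have [n] := ubnP #|supp c|; elim: n c => // n IHn c ltn Rc ec.
have c0 : supp c != set0 by apply/set0Pn; exists e.
have [C Cc CS] := dep_circ (code_dep rR Rc c0).
case eC: (e \in C); first by exists C.
have [d Rd dC] := code_circ rR Cc.
have [f fC] := set0Pn _ (circ_neq0 Cc).
have df : d f != 0 by rewrite -in_supp dC.
set c' := c + sc (- (c f / d f)) d.
have Rc' : R c' by apply: code_comb.
have c'S : supp c' \subset supp c :\ f.
  apply: supp_sub => g; rewrite in_setD1 negb_and negbK addE scE => /orP[/eqP->|gS].
    by rewrite mulNr divfK // subrr.
  have gC : g \notin supp d by apply: contra gS; rewrite dC; apply: (subsetP CS).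
  by rewrite (suppN gS) (suppN gC) mulr0 addr0.
have ec' : e \in supp c'.
  by rewrite in_supp addE scE (@suppN d e) ?mulr0 ?addr0 -?in_supp // dC eC.
have lt' : (#|supp c'| < n)%N.
  apply: leq_trans (_ : #|supp c'| < #|supp c|)%N _; last by rewrite -ltnS.
  rewrite (cardsD1 f (supp c)) (subsetP CS f fC) add1n ltnS.
  exact: subset_leq_card c'S.
have [C' [? ? C'S]] := IHn c' lt' Rc' ec'; exists C'; split=> //.
by apply: subset_trans C'S (subset_trans c'S (subsetDl _ _)).
Qed.

(** Chains on circuits span the code: a multiple of the chain of a circuit inside the support of c
    can be subtracted so as to shrink that support. *)
Lemma code_ind (P : {ffun T -> F} -> Prop) A : P 0 ->
    (forall c d, P c -> P d -> P (c + d)) ->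
    (forall c, R c -> circ ZZ (supp c) -> supp c \subset A -> P c) ->
  forall c, R c -> supp c \subset A -> P c.
Proof.
move=> P0 PD PC c; have [n] := ubnP #|supp c|; elim: n c => // n IHn c ltn Rc cA.
case: (eqVneq (supp c) set0) => [/supp_eq0->//|c0].
have [C Cc CS] := dep_circ (code_dep rR Rc c0).
have [d Rd dC] := code_circ rR Cc.
have [f fC] := set0Pn _ (circ_neq0 Cc).
have df : d f != 0 by rewrite -in_supp dC.
have cf : c f != 0 by rewrite -in_supp (subsetP CS).
have t0 : c f / d f != 0 by rewrite mulf_neq0 ?invr_eq0.
set c' := c + sc (- (c f / d f)) d.
have -> : c = c' + sc (c f / d f) d.
  by apply/ffunP=> g; rewrite !addE !scE mulNr subrK.
have Rc' : R c' by apply: code_comb.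
have c'S : supp c' \subset supp c :\ f.
  apply: supp_sub => g; rewrite in_setD1 negb_and negbK addE scE => /orP[/eqP->|gS].
    by rewrite mulNr divfK // subrr.
  have gC : g \notin supp d by apply: contra gS; rewrite dC; apply: (subsetP CS).
  by rewrite (suppN gS) (suppN gC) mulr0 addr0.
apply: PD.
  apply: IHn => //; last by apply: subset_trans c'S (subset_trans (subsetDl _ _) cA).
  apply: leq_trans (_ : #|supp c'| < #|supp c|)%N _; last by rewrite -ltnS.
  rewrite (cardsD1 f (supp c)) (subsetP CS f fC) add1n ltnS.
  exact: subset_leq_card c'S.
apply: PC; first exact: (codeZ rR).
  by rewrite supp_sc // dC.
by rewrite supp_sc // dC (subset_trans CS cA).
Qed.

End OneCode.

(** Both codes are spanned by their chains on circuits, and each circuit carries a single chain up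
    to a factor. *)
Lemma code_sub_eq R R' ZZ : code_for R (dep ZZ) -> code_for R' (dep ZZ) ->
  (forall c, R c -> R' c) -> forall c, R' c -> R c.
Proof.
move=> rR rR' sub c Rc.
apply: (code_ind rR' (P := R) (A := setT)) Rc (subsetT _) => [|d d'|d Rd dC _].
- exact: code0 rR.
- exact: (codeD rR).
have [c0 Rc0 c0C] := code_circ rR dC.
have [t ->] := code_circ_eq rR' dC (sub _ Rc0) Rd c0C (subxx _).
exact: (codeZ rR).
Qed.

Definition rescale (s : {ffun T -> F}) c : {ffun T -> F} := [ffun e => s e * c e].

Lemma rescaleE s c e : rescale s c e = s e * c e.
Proof. by rewrite ffunE. Qed.

Lemma supp_rescale s c : (forall e, s e != 0) -> supp (rescale s c) = supp c.
Proof. by move=> s0; apply/setP=> e; rewrite !inE rescaleE mulf_eq0 (negPf (s0 e)). Qed.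

Lemma code_rescale R (D : pred {set T}) s : (forall e, s e != 0) -> code_for R D ->
  code_for (fun c => R (rescale s c)) D.
Proof.
move=> s0 [r0 rD rZ rC rd]; split=> [|c d Rc Rd|t c Rc|C Cm|c Rc].
- suff -> : rescale s 0 = 0 by [].
  by apply/ffunP=> e; rewrite !ffunE mulr0.
- suff -> : rescale s (c + d) = rescale s c + rescale s d by apply: rD.
  by apply/ffunP=> e; rewrite !ffunE mulrDr.
- suff -> : rescale s (sc t c) = sc t (rescale s c) by apply: rZ.
  by apply/ffunP=> e; rewrite !ffunE mulrCA.
- have [c Rc cC] := rC C Cm; exists [ffun e => (s e)^-1 * c e].
    suff -> : rescale s [ffun e => (s e)^-1 * c e] = c by [].
    by apply/ffunP=> e; rewrite !ffunE mulVKf.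
  by apply/setP=> e; rewrite -cC !inE ffunE mulf_eq0 invr_eq0 (negPf (s0 e)).
- by have := rd _ Rc; rewrite supp_rescale.
Qed.

Definition zeroat (e : T) c : {ffun T -> F} := [ffun f => if f == e then 0 else c f].

Lemma zeroatE e c f : zeroat e c f = if f == e then 0 else c f.
Proof. by rewrite ffunE. Qed.

Lemma supp_zeroat e c : supp (zeroat e c) = supp c :\ e.
Proof. by apply/setP=> f; rewrite !inE zeroatE; case: (f == e); rewrite ?eqxx. Qed.

Lemma zeroatD e c d : zeroat e (c + d) = zeroat e c + zeroat e d.
Proof. by apply/ffunP=> f; rewrite !ffunE; case: (f == e); rewrite ?addr0. Qed.

Lemma zeroatZ e t c : zeroat e (sc t c) = sc t (zeroat e c).
Proof. by apply/ffunP=> f; rewrite !ffunE; case: (f == e); rewrite ?mulr0. Qed.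

Lemma zeroat0 e : zeroat e 0 = 0.
Proof. by apply/ffunP=> f; rewrite !ffunE if_same. Qed.

Lemma zeroat_id e c : c e = 0 -> zeroat e c = c.
Proof. by move=> c0; apply/ffunP=> f; rewrite zeroatE; case: eqP => // ->. Qed.

Lemma zeroatC e f c : zeroat e (zeroat f c) = zeroat f (zeroat e c).
Proof. by apply/ffunP=> g; rewrite !zeroatE; case: (g == e); case: (g == f). Qed.

(** Relations modulo the vector of e: this is contraction. Deletion keeps only the relations
    supported on the remaining elements ([code_restr]). *)
Definition punct e (R : {ffun T -> F} -> Prop) c := exists2 d, R d & c = zeroat e d.

Lemma code_con R ZZ e : bspace ZZ -> [set e] \notin ZZ ->
  code_for R (dep ZZ) -> code_for (punct e R) (dep (con e ZZ)).
Proof.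
move=> bZ e0 rR; split.
- by exists 0; rewrite ?zeroat0 //; apply: (code0 rR).
- move=> _ _ [c Rc ->] [d Rd ->]; exists (c + d); rewrite ?zeroatD //.
  exact: (codeD rR).
- move=> t _ [c Rc ->]; exists (sc t c); rewrite ?zeroatZ //.
  exact: (codeZ rR).
- move=> C /(circ_of_con e0)[D Dc ->]; have [c Rc cD] := code_circ rR Dc.
  by exists (zeroat e c); [exists c | rewrite supp_zeroat cD].
move=> _ [c Rc ->]; rewrite supp_zeroat con_dep // => /set0Pn[f].
rewrite inE => /andP[fe fc]; apply: depS (_ : dep ZZ (supp c)); first by sets.
by apply: (code_dep rR) => //; apply/set0Pn; exists f.
Qed.

Lemma code_restr R ZZ A : code_for R (dep ZZ) ->
  code_for (fun c => R c /\ supp c \subset A) (dep (restr A ZZ)).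
Proof.
move=> rR; split.
- by split; [apply: (code0 rR) | rewrite supp0 sub0set].
- move=> c d [Rc cA] [Rd dA]; split; first exact: (codeD rR).
  by apply: supp_sub => e eA; rewrite addE !(sub_supp _ eA) // addr0.
- move=> t c [Rc cA]; split; first exact: (codeZ rR).
  by apply: supp_sub => e eA; rewrite scE (sub_supp cA eA) mulr0.
- move=> C Cm; have := Cm; rewrite [minset _ _]circ_restr => /andP[Cc CA].
  by have [c Rc cC] := code_circ rR Cc; exists c; rewrite ?cC.
move=> c [Rc cA] c0; have /depP[Z [Zi Z0 Zc]] := code_dep rR Rc c0.
by apply/depP; exists Z; rewrite inE Zi (subset_trans Zc cA).
Qed.

Lemma frep_restr ZZ A : frep (dep ZZ) -> frep (dep (restr A ZZ)).
Proof. by move=> [R rR]; eexists; apply: code_restr rR. Qed.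

End Codes.

(** * Uniqueness of representations up to scaling *)

Section Unique.
Variables (T : finType) (F : fieldType) (ZZ : {set {set T}}).
Implicit Types A B C D Y Z : {set T}.
Implicit Types c s : {ffun T -> F}.
Implicit Type R : {ffun T -> F} -> Prop.
Hypothesis bZ : bspace ZZ.

Lemma card_setD_lt A B D x : A :\: D \subset B :\: D -> x \in B :\: D -> x \notin A ->
  (#|A :\: D| < #|B :\: D|)%N.
Proof.
move=> sAB xB xA; apply: proper_card; rewrite properE sAB /=.
apply/negP=> /subsetP/(_ x xB); rewrite inE (negPf xA) andbF //.
Qed.

(* When C and Cf are the only circuits of C :|: Cf through f and off f, the
   chains they carry are proportional on the intersection. *)
Lemma theta_chain R f C Cf c cf : code_for R (dep ZZ) ->
    circ ZZ C -> circ ZZ Cf -> f \in Cf -> f \notin C ->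
    (forall Y, circ ZZ Y -> Y \subset C :|: (Cf :\ f) -> Y = C) ->
    R c -> supp c = C -> R cf -> supp cf = Cf ->
  exists t, {in C :&: Cf, forall d, cf d = t * c d}.
Proof.
move=> rR Cc Cfc fCf fC only Rc cC Rcf cfC.
have Si : sdiff C Cf \in ZZ by apply: bZ.2; apply: circ_in.
have fS : f \in sdiff C Cf by rewrite in_sdiff fCf (negPf fC).
have [A [Ac fA AS]] := circ_thru bZ Si fS.
have [a Ra aA] := code_circ rR Ac.
have af : a f != 0 by rewrite -in_supp aA.
set x := cf + sc (- (cf f / a f)) a.
have Rx : R x by apply: (code_comb rR).
have xS : supp x \subset C :|: (Cf :\ f).
  apply: supp_sub => e; rewrite addE scE !inE => H.
  case: (eqVneq e f) H => [-> _|ef]; first by rewrite mulNr divfK // subrr.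
  rewrite negb_or /= => /andP[eC eCf].
  have eA : e \notin A by apply/negP=> /(subsetP AS); rewrite in_sdiff (negPf eC) (negPf eCf).
  by rewrite (@suppN _ _ cf e) ?cfC // (@suppN _ _ a e) ?aA // mulr0 addr0.
have xC : supp x \subset C.
  apply/subsetP=> e ex; have [Y [Yc eY YS]] := code_thru rR Rx ex.
  by rewrite -(only Y Yc (subset_trans YS xS)).
have [t xt] := code_circ_eq rR Cc Rc Rx cC xC.
exists t => d; rewrite inE => /andP[dC dCf].
move/ffunP/(_ d): xt; rewrite addE !scE (@suppN _ _ a d) ?mulr0 ?addr0 //.
by rewrite aA; apply/negP=> /(subsetP AS); rewrite in_sdiff dC dCf.
Qed.

(** The ratio of the two chains on [Cf] is constant on its intersection with each circuit of [A0],
    where the codes agree. For a counterexample C with fewest elements outside [Cf :\ f],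
    [theta_chain] applies in both codes and compares both chains with the same chain on C. *)
Lemma theta R R' f A0 Cf cf cf' C0 b b' : code_for R (dep ZZ) -> code_for R' (dep ZZ) ->
    f \notin A0 -> (forall c, R c -> supp c \subset A0 -> R' c) ->
    circ ZZ Cf -> f \in Cf -> Cf \subset f |: A0 ->
    R cf -> supp cf = Cf -> R' cf' -> supp cf' = Cf ->
    circ ZZ C0 -> C0 \subset A0 -> b \in C0 :&: Cf -> b' \in C0 :&: Cf ->
  cf' b / cf b = cf' b' / cf b'.
Proof.
move=> rR rR' fA0 sub Cfc fCf CfA Rcf cfC Rcf' cf'C C0c C0A bC b'C.
pose nu d := cf' d / cf d; apply/eqP; rewrite -[_ == _]/(nu b == nu b').
apply/negPn/negP=> nub; pose D := Cf :\ f.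
pose P C := [&& circ ZZ C, C \subset A0 &
  [exists d in C :&: Cf, exists d' in C :&: Cf, nu d != nu d']].
have PC0 : P C0.
  rewrite /P C0c C0A; apply/existsP; exists b; rewrite bC; apply/existsP.
  by exists b'; rewrite b'C.
pose m (C : {set T}) := #|C :\: D|.
case: (arg_minnP m PC0) => C /and3P[Cc CA /exists_inP[d dC /exists_inP[d' d'C nud]]] Cmin.
have fC : f \notin C by apply: contra fA0; apply: (subsetP CA).
have cst Y : circ ZZ Y -> Y \subset A0 -> (#|Y :\: D| < #|C :\: D|)%N ->
    {in Y :&: Cf &, forall g g', nu g = nu g'}.
  move=> Yc YA lt g g' gY g'Y; apply/eqP; apply: contraLR lt => nug.
  rewrite -leqNgt; apply: Cmin; rewrite /P Yc YA /=.
  by apply/exists_inP; exists g => //; apply/exists_inP; exists g'.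
have DA : D \subset A0.
  by apply/subsetP=> z; rewrite !inE => /andP[zf /(subsetP CfA)]; rewrite !inE (negPf zf).
have D_Cf : D \subset Cf by rewrite subsetDl.
(* A second circuit Z has fewer elements outside D, so the ratio is constant on it and differs from
   the ratio at some w of C. A circuit A of C + Z through w is smaller too, so it cannot also
   contain a point of Z off C; hence A is C itself, although it misses the common point y of C and
   Z. *)
have only Z : circ ZZ Z -> Z \subset C :|: D -> Z = C.
  move=> Zc ZCD; have ZA : Z \subset A0 by apply: subset_trans ZCD _; rewrite subUset CA.
  case: (eqVneq Z C) => // ZnC.
  have fZ : f \notin Z by apply: contra fA0; apply: (subsetP ZA).
  have ZC_D : Z :\: D \subset C :\: D by sets.
  have [z zC zZ] : exists2 z, z \in C :\: D & z \notin Z.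
    apply/subsetPn; apply: contra ZnC => CZ; rewrite -sdiff_eq0; apply/eqP.
    apply: (circ_sub0 Cfc _ _ fCf); first by apply: bZ.2; apply: circ_in.
      by apply: subset_trans D_Cf; sets.
    by rewrite in_sdiff (negPf fZ) (negPf fC).
  have ltZ : (#|Z :\: D| < #|C :\: D|)%N by apply: card_setD_lt ZC_D zC zZ.
  have cZ := cst Z Zc ZA ltZ.
  have [z0 z0Z] : exists z0, z0 \in Z :&: D.
    apply/set0Pn; apply: contra ZnC => /eqP ZD0; apply/eqP.
    apply: circ_min Cc (circ_in Zc) _ (circ_neq0 Zc).
    apply/subsetP=> y yZ; have := subsetP ZCD y yZ; rewrite inE => /orP[//|yD].
    by move/setP/(_ y): ZD0; rewrite !inE yZ -in_setD1 yD.
  have [w wC wn] : exists2 w, w \in C :&: Cf & nu w != nu z0.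
    case: (eqVneq (nu d) (nu z0)) => [e|]; last by exists d.
    by exists d' => //; rewrite -e eq_sym.
  have z0Cf : z0 \in Z :&: Cf.
    by move: z0Z; rewrite inE => /andP[z0Z /(subsetP D_Cf)]; rewrite inE z0Z.
  move: (wC); rewrite inE => /andP[wC1 wCf].
  have wZ : w \notin Z.
    by apply: contra wn => wZ; apply/eqP; apply: cZ z0Cf; rewrite inE wZ.
  have Si : sdiff C Z \in ZZ by apply: bZ.2; apply: circ_in.
  have wS : w \in sdiff C Z by rewrite in_sdiff wC1 (negPf wZ).
  have [A [Ac wA AS]] := circ_thru bZ Si wS.
  have AA : A \subset A0 by sets.
  have [y yZ yD] : exists2 y, y \in Z & y \notin D.
    apply/subsetPn; apply/negP=> ZD.
    have := circ_sub0 Cfc (circ_in Zc) (subset_trans ZD D_Cf) fCf fZ.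
    by apply/eqP/circ_neq0/Zc.
  have yC : y \in C by have := subsetP ZCD y yZ; rewrite inE (negPf yD) orbF.
  have ltA : (#|A :\: D| < #|C :\: D|)%N.
    apply: (card_setD_lt (x := y)); first by sets.
      by rewrite inE yD.
    by apply/negP=> /(subsetP AS); rewrite in_sdiff yC yZ.
  have cA := cst A Ac AA ltA.
  have AC : A \subset C.
    apply/subsetP=> g gA; have := subsetP AS g gA; rewrite in_sdiff.
    case gC: (g \in C) => //= gZ.
    have gD : g \in D by have := subsetP ZCD g gZ; rewrite inE gC.
    have gCf : g \in Cf := subsetP D_Cf g gD.
    have := cA g w; rewrite !inE gA gCf wA wCf => /(_ isT isT) e.
    by case/eqP: wn; rewrite -e; apply: cZ z0Cf; rewrite inE gZ.
  have eqA := circ_min Cc (circ_in Ac) AC (circ_neq0 Ac).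
  by have := subsetP AS y; rewrite eqA in_sdiff yC yZ => /(_ isT).
have [c Rc cC] := code_circ rR Cc.
have R'c : R' c by apply: sub; rewrite // cC.
have [t Ht] := theta_chain rR Cc Cfc fCf fC only Rc cC Rcf cfC.
have [t' Ht'] := theta_chain rR' Cc Cfc fCf fC only R'c cC Rcf' cf'C.
have nuE g : g \in C :&: Cf -> nu g = t' / t.
  move=> gC; rewrite /nu Ht // Ht' //.
  move: (gC); rewrite inE => /andP[g1 g2].
  have cg : c g != 0 by rewrite -in_supp cC.
  have : cf g != 0 by rewrite -in_supp cfC.
  rewrite Ht // mulf_eq0 negb_or => /andP[t0 _].
  by rewrite invfM mulrACA divff // mulr1.
by case/eqP: nud; rewrite !nuE.
Qed.

(** Add the elements one at a time. Once both chains on a circuit [Cf] through the new element f are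
    normalised, it remains to rescale [A0] without disturbing the agreement reached there, that is,
    by a factor constant on each component of [A0]; by [theta] the ratio of the two chains is such a
    factor. *)
Lemma code_unique R R' : code_for R (dep ZZ) -> code_for R' (dep ZZ) ->
  exists2 s : {ffun T -> F}, (forall e, s e != 0) & forall c, R c -> R' (rescale s c).
Proof.
move=> rR rR'.
suff H n A : #|A| = n -> exists2 s : {ffun T -> F}, (forall e, s e != 0) &
    forall c, R c -> supp c \subset A -> R' (rescale s c).
  have [s s0 Hs] := H _ setT (erefl _); exists s => // c Rc.
  by apply: Hs; rewrite ?subsetT.
elim: n A => [|n IHn] A cA.
  exists [ffun=> 1] => [e|c Rc]; first by rewrite ffunE oner_eq0.
  rewrite (cards0_eq cA) subset0 => /eqP/supp_eq0->.
  suff -> : rescale [ffun=> 1] 0 = 0 :> {ffun T -> F} by apply: (code0 rR').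
  by apply/ffunP=> e; rewrite !ffunE mulr0.
have [f fA] : exists f, f \in A by apply/set0Pn; rewrite -card_gt0 cA.
pose A0 := A :\ f; have fA0 : f \notin A0 by rewrite !inE eqxx.
have A_A0 : f |: A0 = A by apply: setD1K.
have [|s0 s0n0 Hs0] := IHn A0.
  by move: cA; rewrite (cardsD1 f) fA add1n => -[].
pose R1 c := R' (rescale s0 c).
have rR1 : code_for R1 (dep ZZ) := code_rescale s0n0 rR'.
suff [s sn0 Hs] : exists2 s : {ffun T -> F}, (forall e, s e != 0) &
    forall c, R c -> supp c \subset A -> R1 (rescale s c).
  exists [ffun e => s0 e * s e] => [e|c Rc cA']; first by rewrite ffunE mulf_neq0.
  suff -> : rescale [ffun e => s0 e * s e] c = rescale s0 (rescale s c) by apply: Hs.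
  by apply/ffunP=> e; rewrite !ffunE mulrA.
case: (boolP [exists Z in ZZ, (f \in Z) && (Z \subset A)]) => [|noZ]; last first.
  exists [ffun=> 1] => [e|c Rc cA']; first by rewrite ffunE oner_eq0.
  suff -> : rescale [ffun=> 1] c = c.
    apply: Hs0 => //; rewrite subsetD1 cA'; apply: contra noZ => fc.
    have [C [Cc fC CS]] := code_thru rR Rc fc.
    by apply/exists_inP; exists C; rewrite ?fC ?(circ_in Cc) ?(subset_trans CS cA').
  by apply/ffunP=> e; rewrite !ffunE mul1r.
case/exists_inP=> Z Zi /andP[fZ ZA].
have [Cf [Cfc fCf CfZ]] := circ_thru bZ Zi fZ.
have CfA : Cf \subset f |: A0 by rewrite A_A0 (subset_trans CfZ ZA).
have norm R2 : code_for R2 (dep ZZ) -> exists c, [/\ R2 c, supp c = Cf & c f = 1].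
  move=> rR2; have [c Rc cC] := code_circ rR2 Cfc.
  have cf : c f != 0 by rewrite -in_supp cC.
  exists (sc (c f)^-1 c); rewrite supp_sc ?invr_eq0 // scE mulVf //; split=> //.
  exact: (codeZ rR2).
have [cf [Rcf cfC cff]] := norm R rR.
have [cf' [Rcf' cf'C cf'f]] := norm R1 rR1.
have th := theta rR rR1 fA0 Hs0 Cfc fCf CfA Rcf cfC Rcf' cf'C.
pose D := Cf :\ f; pose nu d := cf' d / cf d.
(* [lk] is the relation of lying in the same component of [A0]. On each component s takes the ratio
   found at any element of D there, or 1 if there is none. *)
pose lk e b := (e == b) || [exists C, [&& circ ZZ C, C \subset A0, e \in C & b \in C]].
pose K e := [set b in D | lk e b].
pose s : {ffun T -> F} := [ffun e => if [pick b in K e] is Some b then nu b else 1].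
have Dn0 e : e \in D -> cf e != 0 /\ cf' e != 0.
  by rewrite !inE -!in_supp cfC cf'C => /andP[_ ->].
have sn0 e : s e != 0.
  rewrite ffunE; case: pickP => [b|_]; last exact: oner_neq0.
  by rewrite inE => /andP[/Dn0[b1 b2] _]; rewrite mulf_neq0 ?invr_eq0.
have sD e : e \in D -> s e = nu e.
  move=> eD; rewrite ffunE; case: pickP => [b|/(_ e)]; last first.
    by rewrite inE eD /lk eqxx.
  rewrite inE => /andP[bD /orP[/eqP->//|/existsP[C /and4P[Cc CA eC bC]]]].
  move: bD eD; rewrite !inE => /andP[_ bCf] /andP[_ eCf].
  by apply: (th C) => //; rewrite inE ?bC ?eC.
have sf : s f = 1.
  rewrite ffunE; case: pickP => // b; rewrite inE => /andP[bD /orP[/eqP fb|]].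
    by move: bD; rewrite -fb !inE eqxx.
  case/existsP=> C /and4P[_ CA fC _].
  by case/negP: fA0; apply: (subsetP CA).
have Ksub C e e' : circ ZZ C -> C \subset A0 -> e \in C -> e' \in C -> K e \subset K e'.
  move=> Cc CA eC e'C; apply/subsetP=> b; rewrite !inE => /andP[-> /=].
  case/orP=> [/eqP<-|/existsP[C1 /and4P[C1c C1A eC1 bC1]]]; apply/orP; right.
    by apply/existsP; exists C; apply/and4P.
  have meet : C :&: C1 != set0 by apply/set0Pn; exists e; rewrite inE eC.
  have [C2 [C2c e'C2 bC2 C2S]] := circ_link bZ Cc C1c e'C bC1 meet.
  apply/existsP; exists C2; apply/and4P; split=> //.
  by apply: subset_trans C2S _; rewrite subUset CA.
have Rs0 c : R c -> supp c \subset A0 -> R1 (rescale s c).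
  move: c; apply: (code_ind rR (P := fun c => R1 (rescale s c))) => [|c1 c2 h1 h2|c1 Rc1 Cc1 c1A].
  - suff -> : rescale s 0 = 0 by apply: (code0 rR1).
    by apply/ffunP=> e; rewrite !ffunE mulr0.
  - suff -> : rescale s (c1 + c2) = rescale s c1 + rescale s c2 by apply: (codeD rR1).
    by apply/ffunP=> e; rewrite !rescaleE !addE !rescaleE mulrDr.
  have [g gc] := set0Pn _ (circ_neq0 Cc1).
  suff -> : rescale s c1 = sc (s g) c1 by apply: (codeZ rR1); apply: Hs0.
  apply/ffunP=> e; rewrite rescaleE scE; case ec: (e \in supp c1); last first.
    by rewrite (@suppN _ _ c1 e) ?ec // !mulr0.
  suff eqK : K e = K g by congr (_ * _); rewrite !ffunE eqK.
  by apply/eqP; rewrite eqEsubset !(Ksub _ _ _ Cc1 c1A).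
have Rscf : R1 (rescale s cf).
  suff -> : rescale s cf = cf' by [].
  apply/ffunP=> e; rewrite rescaleE; case: (eqVneq e f) => [->|ef].
    by rewrite sf cff cf'f mulr1.
  case eC: (e \in Cf).
    2: by rewrite (@suppN _ _ cf e) ?cfC ?eC // (@suppN _ _ cf' e) ?cf'C ?eC // mulr0.
  have eD : e \in D by rewrite !inE ef.
  by rewrite sD // divfK //; case: (Dn0 e eD).
exists s => // c Rc cA'.
have -> : rescale s c = rescale s (c + sc (- c f) cf) + sc (c f) (rescale s cf).
  by apply/ffunP=> e; rewrite !(rescaleE, addE, scE); ring.
apply: (code_comb rR1) => //; apply: Rs0; first exact: (code_comb rR).
rewrite subsetD1; apply/andP; split.
  by apply: supp_add_sc => //; rewrite cfC -A_A0.
by rewrite in_supp addE scE cff mulr1 subrr eqxx.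
Qed.

End Unique.

(** * Critical binary matroids *)

Section Reductions.
Variables (T : finType) (F : fieldType).
Implicit Types A B C D E Y Z : {set T}.
Implicit Types ZZ : {set {set T}}.
Implicit Types c : {ffun T -> F}.

Lemma frep_loop ZZ e : [set e] \in ZZ ->
  frep F (dep (del e ZZ)) -> frep F (dep ZZ).
Proof.
move=> ei [R rR]; exists (fun c => R (zeroat e c)); split.
- by rewrite zeroat0; apply: (code0 rR).
- by move=> c d Rc Rd; rewrite zeroatD; apply: (codeD rR).
- by move=> t c Rc; rewrite zeroatZ; apply: (codeZ rR).
- move=> C Cc; case eC: (e \in C).
    have -> : C = [set e].
      by apply/esym/(circ_min Cc ei); rewrite ?sub1set // -card_gt0 cards1.
    pose c : {ffun T -> F} := [ffun f => (f == e)%:R].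
    exists c.
      suff -> : zeroat e c = 0 by apply: (code0 rR).
      by apply/ffunP=> f; rewrite zeroatE !ffunE; case: (f == e).
    by apply/setP=> f; rewrite !inE ffunE; case: (f == e); rewrite ?oner_eq0 ?eqxx.
  have Cd : circ (del e ZZ) C by rewrite circ_del eC andbT; exact: Cc.
  have [c Rc cC] := code_circ rR Cd; exists c => //.
  by rewrite zeroat_id // suppN // cC eC.
move=> c Rc c0; case: (eqVneq (supp (zeroat e c)) set0) => [z0|z0].
  apply/depP; exists [set e]; split=> //; first by rewrite -card_gt0 cards1.
  move/eqP: z0; rewrite supp_zeroat setD_eq0 subset1 (negPf c0) orbF => /eqP->.
  exact: subxx.
have /depP[Z [Zi Z0 Zc]] := code_dep rR Rc z0.
move: Zi; rewrite inE => /andP[Zi _]; apply/depP; exists Z; split=> //.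
by apply: subset_trans Zc _; rewrite supp_zeroat subsetDl.
Qed.

(** Let e have the vector of f. A relation then becomes one of the deletion by adding the
    coefficient of e to that of f, which is what [mv] does. *)
Lemma frep_parallel ZZ e f : bspace ZZ -> e != f -> circ ZZ [set e; f] ->
  frep F (dep (del e ZZ)) -> frep F (dep ZZ).
Proof.
move=> bZ ef efc [R rR].
pose mv c : {ffun T -> F} :=
  [ffun g => if g == e then 0 else if g == f then c f + c e else c g].
have fe : f == e = false by rewrite eq_sym (negPf ef).
exists (fun c => R (mv c)); split.
- suff -> : mv 0 = 0 by apply: (code0 rR).
  by apply/ffunP=> g; rewrite !ffunE addr0 !if_same.
- move=> c d Rc Rd; suff -> : mv (c + d) = mv c + mv d by apply: (codeD rR).
  apply/ffunP=> g; rewrite !ffunE; case: (g == e); first by rewrite addr0.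
  by case: (g == f); rewrite // addrACA.
- move=> t c Rc; suff -> : mv (sc t c) = sc t (mv c) by apply: (codeZ rR).
  apply/ffunP=> g; rewrite !ffunE; case: (g == e); first by rewrite mulr0.
  by case: (g == f); rewrite // mulrDr.
- move=> C Cc; case eC: (e \in C); last first.
    have Cd : circ (del e ZZ) C by rewrite circ_del eC andbT; exact: Cc.
    have [c Rc cC] := code_circ rR Cd; exists c => //.
    suff -> : mv c = c by [].
    have ce : c e = 0 by rewrite suppN // cC eC.
    by apply/ffunP=> g; rewrite ffunE; case: eqP => [->//|_]; case: eqP => [->|//]; rewrite ce addr0.
  case fC: (f \in C).
    have <- : [set e; f] = C.
      apply: circ_min Cc (circ_in efc) _ (circ_neq0 efc).
      by rewrite subUset !sub1set eC.
    pose c : {ffun T -> F} := [ffun g => if g == e then 1 else if g == f then -1 else 0].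
    exists c.
      suff -> : mv c = 0 by apply: (code0 rR).
      apply/ffunP=> g; rewrite !ffunE !eqxx fe addNr.
      by case: (g == e) => //; case: (g == f).
    apply/setP=> g; rewrite !inE ffunE; case: (g == e); first by rewrite oner_eq0.
    by case: (g == f); rewrite ?oppr_eq0 ?oner_eq0 ?eqxx.
  have Dd : circ (del e ZZ) (sdiff C [set e; f]).
    apply/circP; split.
    - by rewrite inE !inE eC eqxx /= andbT; apply: bZ.2; apply: circ_in.
    - by apply/set0Pn; exists f; rewrite !inE fC eqxx orbT.
    move=> Y; rewrite inE => /andP[Yi eY] Y0 YD.
    have fY : f \in Y.
      apply: contraNT Y0 => fY; apply/eqP; apply: (circ_sub0 Cc Yi _ eC eY).
      apply/subsetP=> g gY; have := subsetP YD g gY; rewrite !inE.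
      have -> : g == e = false by apply: contraNF eY => /eqP<-.
      have -> : g == f = false by apply: contraNF fY => /eqP<-.
      by rewrite addbF.
    have Si : sdiff Y [set e; f] \in ZZ by apply: bZ.2 => //; apply: circ_in.
    have eqC : sdiff Y [set e; f] = C.
      apply: circ_min Cc Si _ _.
        apply/subsetP=> g; rewrite !inE; case: (eqVneq g e) => [->//|ge].
        case: (eqVneq g f) => [->|gf]; first by rewrite fY.
        by rewrite addbF => /(subsetP YD); rewrite !inE (negPf ge) (negPf gf) addbF.
      by apply/set0Pn; exists e; rewrite !inE (negPf eY) eqxx.
    by rewrite -eqC; apply: imp_set_eq => g; rewrite !inE addbK addbb.
  have [d Rd dD] := code_circ rR Dd.
  exists [ffun g => if g == e then d f else if g == f then 0 else d g].
    suff -> : mv [ffun g => if g == e then d f else if g == f then 0 else d g] = d by [].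
    apply/ffunP=> g; rewrite !ffunE !eqxx fe add0r.
    case: (eqVneq g e) => [->|_]; first by rewrite suppN // dD !inE eC eqxx.
    by case: (eqVneq g f) => [->|].
  apply/setP=> g; rewrite !inE ffunE.
  case: (eqVneq g e) => [->|ge]; first by rewrite eC -in_supp dD !inE fC eqxx orbT.
  case: (eqVneq g f) => [->|gf]; first by rewrite fC eqxx.
  by rewrite -in_supp dD !inE (negPf ge) (negPf gf) addbF.
move=> c Rc c0; case: (eqVneq (supp (mv c)) set0) => [z0|z0].
  have H g : mv c g = 0 by rewrite suppN // z0 inE.
  have cfe : c f + c e = 0 by have := H f; rewrite ffunE fe eqxx.
  have ce : c e != 0.
    apply: contraNneq c0 => ce; apply/eqP/setP=> g; rewrite !inE; apply/negbTE; rewrite negbK.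
    case: (eqVneq g e) => [->|ge]; first by rewrite ce.
    case: (eqVneq g f) => [->|gf]; first by move: cfe; rewrite ce addr0 => ->.
    by have := H g; rewrite ffunE (negPf ge) (negPf gf) => ->.
  apply/depP; exists [set e; f]; split; [exact: circ_in|exact: circ_neq0 efc|].
  rewrite subUset !sub1set !in_supp ce /=; apply: contraNneq ce => cf.
  by move: cfe; rewrite cf add0r => ->.
have /depP[Z [Zi Z0 Zc]] := code_dep rR Rc z0.
move: Zi; rewrite inE => /andP[Zi eZ].
have Zsub g : g \in Z -> g != f -> g \in supp c.
  move=> gZ gf; have := subsetP Zc g gZ; rewrite !in_supp ffunE (negPf gf).
  by case: (g == e) => //; rewrite eqxx.
case fc: (f \in supp c).
  apply/depP; exists Z; split=> //; apply/subsetP=> g gZ.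
  by case: (eqVneq g f) => [->//|]; apply: Zsub.
case fZ: (f \in Z); last first.
  apply/depP; exists Z; split=> //; apply/subsetP=> g gZ.
  by case: (eqVneq g f) gZ => [->|gf gZ]; rewrite ?fZ //; apply: Zsub.
have cf : c f = 0 by rewrite suppN // fc.
have ec : e \in supp c.
  by have := subsetP Zc f fZ; rewrite !in_supp ffunE fe eqxx cf add0r.
apply/depP; exists (sdiff Z [set e; f]); split.
- by apply: bZ.2 => //; apply: circ_in.
- by apply/set0Pn; exists e; rewrite !inE (negPf eZ) eqxx.
apply/subsetP=> g; rewrite !inE; case: (eqVneq g e) => [-> _|ge]; first by rewrite -in_supp.
case: (eqVneq g f) => [->|gf]; first by rewrite fZ.
by rewrite addbF -in_supp => /Zsub; apply.
Qed.

Lemma frep_sum ZZ E :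
    (forall C, circ ZZ C -> (C \subset E) || (C \subset ~: E)) ->
    frep F (dep (restr E ZZ)) -> frep F (dep (restr (~: E) ZZ)) -> frep F (dep ZZ).
Proof.
move=> sepE [R1 r1] [R2 r2].
pose on D c : {ffun T -> F} := [ffun g => if g \in D then c g else 0].
have onD D c d : on D (c + d) = on D c + on D d.
  by apply/ffunP=> g; rewrite !ffunE; case: ifP; rewrite ?addr0.
have onZ D t c : on D (sc t c) = sc t (on D c).
  by apply/ffunP=> g; rewrite !ffunE; case: ifP; rewrite ?mulr0.
have on0 D : on D 0 = 0 by apply/ffunP=> g; rewrite !ffunE if_same.
have on_id D c : supp c \subset D -> on D c = c.
  by move=> cD; apply/ffunP=> g; rewrite ffunE; case: ifPn => // gD; rewrite (sub_supp cD).
have on_0 D c : supp c \subset D -> on (~: D) c = 0.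
  by move=> cD; apply/ffunP=> g; rewrite !ffunE inE; case: ifPn => // gD; rewrite (sub_supp cD).
have supp_on D c : supp (on D c) \subset supp c.
  by apply: supp_sub => g gc; rewrite ffunE suppN ?if_same.
have dep_on D c : dep (restr D ZZ) (supp (on D c)) -> dep ZZ (supp c).
  case/depP=> Z [Zi Z0 Zc]; move: Zi; rewrite inE => /andP[Zi _]; apply/depP; exists Z.
  by rewrite (subset_trans Zc).
exists (fun c => R1 (on E c) /\ R2 (on (~: E) c)); split.
- by rewrite !on0; split; [apply: (code0 r1) | apply: (code0 r2)].
- by move=> c d [? ?] [? ?]; rewrite !onD; split; [apply: (codeD r1) | apply: (codeD r2)].
- by move=> t c [? ?]; rewrite !onZ; split; [apply: (codeZ r1) | apply: (codeZ r2)].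
- move=> C Cc; have /orP[CE|CE] := sepE C Cc.
    have C1 : circ (restr E ZZ) C by rewrite circ_restr CE andbT; exact: Cc.
    have [c Rc cC] := code_circ r1 C1; exists c => //.
    by rewrite on_id ?on_0 ?cC //; split=> //; apply: (code0 r2).
  have C1 : circ (restr (~: E) ZZ) C by rewrite circ_restr CE andbT; exact: Cc.
  have [c Rc cC] := code_circ r2 C1; exists c => //.
  rewrite -{1}(setCK E) on_0 ?on_id ?cC //; split=> //; exact: (code0 r1).
move=> c [Rc1 Rc2] /set0Pn[g gc]; case gE: (g \in E).
  apply: (@dep_on E); apply: (code_dep r1) => //; apply/set0Pn; exists g.
  by rewrite in_supp ffunE gE -in_supp.
apply: (@dep_on (~: E)); apply: (code_dep r2) => //; apply/set0Pn; exists g.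
by rewrite in_supp ffunE inE gE -in_supp.
Qed.

(* A minor-minimal binary matroid on A that is not representable over F. *)
Record critical A ZZ : Prop := Critical {
  crit_bspace : bspace ZZ;
  crit_sub : forall Z, Z \in ZZ -> Z \subset A;
  crit_nrep : ~ frep F (dep ZZ);
  crit_del : forall B, B \proper A -> frep F (dep (restr B ZZ));
  crit_con : forall e, e \in A -> [set e] \notin ZZ -> frep F (dep (con e ZZ))
}.

Lemma restr_restr A B ZZ : B \subset A -> restr B (restr A ZZ) = restr B ZZ.
Proof.
move=> BA; apply/setP=> Z; rewrite !inE -andbA; congr (_ && _).
by apply: andb_idl => ZB; apply: subset_trans ZB BA.
Qed.

Lemma con_restr A e ZZ : e \in A -> con e (restr A ZZ) = restr A (con e ZZ).
Proof.
move=> eA; apply/setP=> Y; rewrite inE; apply/conP/andP=> [[Z]|[/conP[Z Zi ->] ZA]].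
  by rewrite inE => /andP[Zi ZA] ->; rewrite con_in // (subset_trans (subsetDl _ _)).
exists Z => //; rewrite inE Zi; apply/subsetP=> f fZ.
by case: (eqVneq f e) => [->//|fe]; apply: (subsetP ZA); rewrite !inE fe.
Qed.

Lemma exists_critical ZZ : bspace ZZ -> ~ frep F (dep ZZ) ->
    (forall e Z, [set e] \notin ZZ -> Z \in ZZ -> e \in Z -> frep F (dep (con e ZZ))) ->
  exists A, critical A (restr A ZZ).
Proof.
move=> bZ nrep rcon.
suff H n A : (#|A| <= n)%N -> ~ frep F (dep (restr A ZZ)) ->
    exists B, ~ frep F (dep (restr B ZZ)) /\
      forall D, D \proper B -> frep F (dep (restr D ZZ)).
  have [||A [nA pA]] := H #|T| setT; first by rewrite cardsT.
    suff -> : restr setT ZZ = ZZ by [].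
    by apply/setP=> Z; rewrite inE subsetT andbT.
  exists A; split=> //; first exact: bspace_restr.
  - by move=> Z; rewrite inE => /andP[].
  - by move=> B BA; rewrite restr_restr ?(proper_sub BA) //; apply: pA.
  move=> e eA e0; rewrite con_restr //; apply: frep_restr.
  have e0' : [set e] \notin ZZ by apply: contra e0 => ei; rewrite inE ei sub1set.
  case: (boolP [exists Z in ZZ, (e \in Z) && (Z \subset A)]).
    by case/exists_inP=> Z Zi /andP[eZ _]; apply: rcon eZ.
  (* No cycle of the restriction contains e, so removing e from A changes nothing, against the
     minimality of A. *)
  move=> noZ; case: nA; suff -> : restr A ZZ = restr (A :\ e) ZZ by apply: pA; rewrite properD1.
  apply/setP=> Z; rewrite !inE subsetD1; apply/andP/and3P=> [[Zi ZA]|[Zi ZA _]] //.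
  split=> //; apply: contra noZ => eZ; apply/exists_inP; exists Z => //.
  by rewrite eZ.
elim: n A => [|n IHn] A cA nA.
  exists A; split=> // D /proper_card; move: cA; rewrite leqn0 => /eqP-> //.
case: (classic (exists D, D \proper A /\ ~ frep F (dep (restr D ZZ)))) => [[D [DA nD]]|noD].
  by apply: (IHn D) => //; have := leq_trans (proper_card DA) cA; rewrite ltnS.
exists A; split=> // D DA; apply: NNPP => nD; apply: noD; by exists D.
Qed.

Section Critical.
Variables (A : {set T}) (ZZ : {set {set T}}).
Hypothesis crA : critical A ZZ.
Let bZ := crit_bspace crA.

(** With a loop, a parallel pair ([crit_nonparallel]) or a separation ([crit_linked]),
    representations of proper restrictions would extend or combine to one of the whole: critical
    matroids are simple and connected. *)
Lemma crit_nonloop e : [set e] \notin ZZ.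
Proof.
apply/negP=> ei; apply: (crit_nrep crA); apply: (frep_loop ei).
suff -> : del e ZZ = restr (A :\ e) ZZ.
  apply: (crit_del crA); apply: properD1.
  by have := crit_sub crA ei; rewrite sub1set.
apply/setP=> Z; rewrite !inE subsetD1.
case Zi: (Z \in ZZ) => //=; by rewrite (crit_sub crA Zi).
Qed.

Lemma crit_nonparallel e f : e != f -> [set e; f] \notin ZZ.
Proof.
move=> ef; apply/negP=> efi; apply: (crit_nrep crA).
apply: (frep_parallel bZ ef).
  apply/circP; split=> //; first by apply/set0Pn; exists e; rewrite !inE eqxx.
  move=> Z Zi Z0 Zef; apply/eqP; rewrite eqEsubset Zef subUset !sub1set /=.
  apply/andP; split; apply: contraTT Zi => nZ.
    suff -> : Z = [set f] by apply: crit_nonloop.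
    apply/eqP; rewrite eqEcard cards1 card_gt0 Z0 andbT; apply/subsetP=> g gZ.
    by have := subsetP Zef g gZ; rewrite !inE => /orP[/eqP ge|//]; rewrite -ge gZ in nZ.
  suff -> : Z = [set e] by apply: crit_nonloop.
  apply/eqP; rewrite eqEcard cards1 card_gt0 Z0 andbT; apply/subsetP=> g gZ.
  by have := subsetP Zef g gZ; rewrite !inE => /orP[//|/eqP ge]; rewrite -ge gZ in nZ.
suff -> : del e ZZ = restr (A :\ e) ZZ.
  apply: (crit_del crA); apply: properD1.
  by have := crit_sub crA efi; rewrite subUset !sub1set => /andP[].
apply/setP=> Z; rewrite !inE subsetD1.
case Zi: (Z \in ZZ) => //=; by rewrite (crit_sub crA Zi).
Qed.

Lemma crit_cover e : e \in A -> exists2 C, circ ZZ C & e \in C.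
Proof.
move=> eA; case: (boolP [exists Z in ZZ, e \in Z]) => [/exists_inP[Z Zi eZ]|noZ].
  by have [C [Cc eC _]] := circ_thru bZ Zi eZ; exists C.
case: (crit_nrep crA); suff -> : ZZ = restr (A :\ e) ZZ by apply: (crit_del crA); apply: properD1.
apply/setP=> Z; rewrite !inE subsetD1.
case Zi: (Z \in ZZ) => //=; rewrite (crit_sub crA Zi) /=.
by apply/esym; apply: contra noZ => eZ; apply/exists_inP; exists Z.
Qed.

Lemma crit_linked e f : e \in A -> f \in A -> exists C, [/\ circ ZZ C, e \in C & f \in C].
Proof.
move=> eA fA; pose E := [set g | [exists C, [&& circ ZZ C, e \in C & g \in C]]].
case fE: (f \in E).
  by move: fE; rewrite inE => /existsP[C /and3P[]]; exists C.
case: (crit_nrep crA).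
have [C0 C0c eC0] := crit_cover eA.
have eE : e \in E by rewrite inE; apply/existsP; exists C0; rewrite C0c eC0.
have EA : E \subset A.
  apply/subsetP=> g; rewrite inE => /existsP[C /and3P[Cc _ gC]].
  by apply: (subsetP (crit_sub crA (circ_in Cc))).
apply: (@frep_sum _ E) => [C Cc||].
- case: (boolP (C :&: E == set0)) => [|/set0Pn[g]].
    by rewrite setI_eq0 disjoints_subset => ->; rewrite orbT.
  rewrite inE => /andP[gC]; rewrite inE => /existsP[D /and3P[Dc eD gD]].
  apply/orP; left; apply/subsetP=> h hC; rewrite inE; apply/existsP.
  have meet : D :&: C != set0 by apply/set0Pn; exists g; rewrite inE gD.
  have [K [Kc eK hK _]] := circ_link bZ Dc Cc eD hC meet.
  by exists K; rewrite Kc eK.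
- apply: (crit_del crA); rewrite properE EA; apply/subsetPn; exists f => //.
  by rewrite fE.
suff -> : restr (~: E) ZZ = restr (A :\: E) ZZ.
  apply: (crit_del crA); rewrite properE subsetDl; apply/subsetPn; exists e => //.
  by rewrite inE eE.
apply/setP=> Z; rewrite !inE subsetD -disjoints_subset.
case Zi: (Z \in ZZ) => //=; by rewrite (crit_sub crA Zi).
Qed.

End Critical.
End Reductions.

(** * A triangle yields the Fano plane *)

Ltac neqs :=
  repeat match goal with
  | H : is_true (?a != ?b) |- context [?a == ?b] => rewrite (negPf H)
  | H : is_true (?a != ?b) |- context [?b == ?a] => rewrite [b == a]eq_sym (negPf H)
  | H : is_true (?a \notin ?b) |- context [?a \in ?b] => rewrite (negPf H)
  | H : is_true (?a \in ?b) |- context [?a \in ?b] => rewrite H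
  end; rewrite ?eqxx /=.

Section Triangle.
Variables (T : finType) (F : fieldType) (A : {set T}) (ZZ : {set {set T}}).
Implicit Types B C D Y Z : {set T}.
Implicit Types c h : {ffun T -> F}.
Hypothesis crA : critical F A ZZ.
Variables x y b : T.
Hypotheses (xy : x != y) (xb : x != b) (yb : y != b).
Hypothesis tri : [set x; y; b] \in ZZ.
Let bZ := crit_bspace crA.
Let ZD := bZ.2.

Definition thru C := [&& circ ZZ C, x \in C, y \in C & b \notin C].
(* e is not spanned by C. *)
Definition out e C := [forall Z in ZZ, (e \in Z) ==> ~~ (Z \subset e |: C)].

Lemma outP e C : reflect (forall Z, Z \in ZZ -> e \in Z -> ~~ (Z \subset e |: C)) (out e C).
Proof.
apply: (iffP forall_inP) => [H Z Zi eZ|H Z Zi]; first by have := H Z Zi; rewrite eZ.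
by apply/implyP; apply: H.
Qed.

Lemma no_third e : e != b -> e != x -> e != y -> [set x; y; e] \notin ZZ.
Proof.
move=> eb ex ey; apply/negP=> ei.
have := crit_nonparallel crA eb; rewrite -[[set e; b]]/[set e; b].
suff <- : sdiff [set x; y; e] [set x; y; b] = [set e; b] by rewrite ZD.
apply/setP=> g; rewrite !inE.
case: (eqVneq g x) => [->|]; neqs => //.
case: (eqVneq g y) => [->|]; neqs => //.
by case: (eqVneq g e) => [->|]; neqs.
Qed.

Lemma off_line e Z : Z \in ZZ -> e \in Z -> Z \subset [set x; y; b; e] -> e != b ->
  e != x -> e != y -> exists Z', [/\ Z' \in ZZ, e \in Z' & Z' \subset [set x; y; e]].
Proof.
move=> Zi eZ ZS eb ex ey; case bZ': (b \in Z).
  exists (sdiff Z [set x; y; b]); split; first exact: ZD.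
    by rewrite !inE eZ; neqs.
  apply/subsetP=> g; rewrite !inE; case: (eqVneq g b) => [->|gb]; first by rewrite bZ' orbT.
  case: (eqVneq g x) => //= gx; case: (eqVneq g y) => //= gy; rewrite addbF => /(subsetP ZS).
  by rewrite !inE (negPf gb) (negPf gx) (negPf gy).
exists Z; split=> //; apply/subsetP=> g gZ; have := subsetP ZS g gZ; rewrite !inE.
by case: (eqVneq g b) => [gb|gb]; rewrite ?orbF //; rewrite gb bZ' in gZ.
Qed.

Lemma tri_circ : circ ZZ [set x; y; b].
Proof.
have [C [Cc xC CS]] : exists C, [/\ circ ZZ C, x \in C & C \subset [set x; y; b]].
  by apply: circ_thru; rewrite // !inE eqxx.
suff <- : C = [set x; y; b] by [].
apply/eqP; rewrite eqEsubset CS; apply/subsetP=> g; rewrite !inE.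
have Ci := circ_in Cc.
case yC: (y \in C); case bC: (b \in C).
- by case/orP=> [/orP[]|] /eqP->.
- suff Cxy : C = [set x; y] by have := crit_nonparallel crA xy; rewrite -Cxy Ci.
  apply/setP=> h; rewrite !inE; apply/idP/orP => [hC|[]/eqP->] //.
  have := subsetP CS h hC; rewrite !inE => /orP[/orP[]|/eqP hb]; auto.
  by rewrite hb bC in hC.
- suff Cxb : C = [set x; b] by have := crit_nonparallel crA xb; rewrite -Cxb Ci.
  apply/setP=> h; rewrite !inE; apply/idP/orP => [hC|[]/eqP->] //.
  have := subsetP CS h hC; rewrite !inE => /orP[/orP[|/eqP hy]|]; auto.
  by rewrite hy yC in hC.
- suff Cx : C = [set x] by have := crit_nonloop crA x; rewrite -Cx Ci.
  apply/setP=> h; rewrite !inE; apply/idP/eqP => [hC|->] //.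
  have := subsetP CS h hC; rewrite !inE => /orP[/orP[/eqP|/eqP hy]|/eqP hb] //.
    by rewrite hy yC in hC.
  by rewrite hb bC in hC.
Qed.

(** Here e is a chord of C. A proper nonempty part of Z in [ZZ] yields, alone or added to Z, a
    nonempty cycle inside C, hence C itself; then C lies in Z, and Z + C is the loop e. *)
Lemma circ_ext C e Z : circ ZZ C -> e \notin C -> Z \in ZZ -> e \in Z ->
  Z \subset e |: C -> circ ZZ Z.
Proof.
move=> Cc eC Zi eZ ZS; apply/circP; split=> //; first by apply/set0Pn; exists e.
have CnZ : ~~ (C \subset Z).
  apply/negP=> CZ; have := crit_nonloop crA e.
  suff <- : sdiff Z C = [set e] by rewrite ZD ?(circ_in Cc).
  apply/setP=> g; rewrite !inE; case: (eqVneq g e) => [->|ge]; first by neqs.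
  have := subset_imp CZ g; have := subset_imp ZS g; rewrite !inE (negPf ge).
  by case: (g \in Z); case: (g \in C).
move=> Y Yi Y0 YZ; case eY: (e \in Y); last first.
  have YC : Y \subset C.
    apply/subsetP=> g gY; have := subsetP ZS g (subsetP YZ g gY); rewrite !inE.
    by case: eqP => // ge; rewrite -ge gY in eY.
  by have := circ_min Cc Yi YC Y0 => eqY; rewrite -eqY YZ in CnZ.
apply/eqP; rewrite -sdiff_eq0; apply: contraNT CnZ => S0.
have Si : sdiff Y Z \in ZZ by apply: ZD.
have SC : sdiff Y Z \subset C.
  apply/subsetP=> g; rewrite inE => gS.
  have := subset_imp YZ g; have := subset_imp ZS g; rewrite !inE; move: gS.
  by case: (eqVneq g e) => [->|ge]; rewrite ?eY ?eZ //; case: (g \in Y); case: (g \in Z).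
by rewrite -(circ_min Cc Si SC S0); sets.
Qed.

Section Chains.
Variable R : {ffun T -> F} -> Prop.
Hypothesis rR : code_for R (dep (del b ZZ)).

(* The chains on C1 and C2 have the same slope c x / c y.  A slope common to all
   circuits through x and y extends the representation of ZZ \ b to ZZ. *)
Definition eqlam C1 C2 := forall c1 c2, R c1 -> R c2 -> supp c1 = C1 -> supp c2 = C2 ->
  c1 x * c2 y = c2 x * c1 y.

Lemma thru_chain C : thru C -> exists c, [/\ R c, supp c = C, c x != 0 & c y != 0].
Proof.
case/and4P=> Cc xC yC bC.
have Cd : circ (del b ZZ) C by rewrite circ_del Cc.
by have [c Rc cC] := code_circ rR Cd; exists c; rewrite -!in_supp cC.
Qed.

Lemma eqlam_sym C1 C2 : eqlam C1 C2 -> eqlam C2 C1.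
Proof. by move=> H c1 c2 R1 R2 s1 s2; rewrite -(H c2 c1). Qed.

Lemma eqlam_trans C1 C3 C2 : thru C3 -> eqlam C1 C3 -> eqlam C3 C2 -> eqlam C1 C2.
Proof.
move=> /thru_chain[c3 [R3 s3 x3 y3]] H1 H2 c1 c2 R1 R2 s1 s2.
have e1 := H1 c1 c3 R1 R3 s1 s3; have e2 := H2 c3 c2 R3 R2 s3 s2.
apply: (mulfI y3); apply: (mulfI x3).
have -> : c3 x * (c3 y * (c1 x * c2 y)) = (c1 x * c3 y) * (c3 x * c2 y) by ring.
by rewrite e1 e2; ring.
Qed.

(** In the contraction of e the line {x, y, b} survives, and by uniqueness the given chains become,
    after scaling, relations of a representation [Re]. There every circuit D through x and y but not
    b has the slope of the line: a combination of the two chains that vanishes at x but not at y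
    would give, possibly after adding the line, a cycle inside D containing exactly one of x and
    y. *)
Lemma lam_con e D1 D2 d1 d2 : e \in A -> e != b -> e != x -> e != y ->
    (forall Z, Z \in ZZ -> e \in Z -> ~~ (Z \subset [set x; y; b; e])) ->
    circ (con e ZZ) D1 -> circ (con e ZZ) D2 ->
    x \in D1 -> x \in D2 -> y \in D1 -> y \in D2 -> b \notin D1 -> b \notin D2 ->
    punct e R d1 -> punct e R d2 -> supp d1 = D1 -> supp d2 = D2 ->
  d1 x * d2 y = d2 x * d1 y.
Proof.
move=> eA eb ex ey offe c1 c2 x1 x2 y1 y2 b1 b2 R1 R2 s1 s2.
have [Re rRe] := crit_con crA eA (crit_nonloop crA e).
have bZe : bspace (con e ZZ) by apply: bspace_con.
have e0d : [set e] \notin del b ZZ by rewrite inE (negPf (crit_nonloop crA e)).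
have eqZ : con e (del b ZZ) = restr (~: [set b]) (con e ZZ).
  by rewrite del_restr con_restr // !inE.
have rP : code_for (punct e R) (dep (restr (~: [set b]) (con e ZZ))).
  by rewrite -eqZ; apply: code_con => //; apply: bspace_del.
have rRb := code_restr (~: [set b]) rRe.
have [s s0 Hs] := code_unique (bspace_restr _ bZe) rP rRb.
have tc : circ (con e ZZ) [set x; y; b].
  apply: circ_con_out tri_circ _ _; first by rewrite !inE; neqs.
  by move=> Z Zi eZ; have := offe Z Zi eZ; rewrite setUC.
have [h Rh hC] := code_circ rRe tc.
have hx : h x != 0 by rewrite -in_supp hC !inE eqxx.
have hy : h y != 0 by rewrite -in_supp hC !inE eqxx orbT.
have key D d : circ (con e ZZ) D -> x \in D -> y \in D -> b \notin D -> punct e R d ->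
    supp d = D -> s x * d x * h y = h x * (s y * d y).
  move=> Dc xD yD bD Rd dD; apply/eqP; rewrite -subr_eq0; apply/negPn/negP=> w0.
  have [Rs _] := Hs d Rd.
  pose w := sc (h x) (rescale s d) + sc (- (s x * d x)) h.
  have Rw : Re w by apply: (code_comb rRe) => //; apply: (codeZ rRe).
  have yw : y \in supp w.
    rewrite in_supp /w addE !scE rescaleE; apply: contraNneq w0 => w1.
    by rewrite -oppr_eq0 opprB; apply/eqP; rewrite -[RHS]w1; ring.
  have wS : supp w \subset b |: (D :\ x).
    apply: supp_sub => g; rewrite in_setU1 in_setD1 /w addE !scE rescaleE negb_or.
    case/andP=> gb; rewrite negb_and negbK => /orP[/eqP->|gD]; first by ring.
    rewrite (@suppN _ _ d g) ?dD // (@suppN _ _ h g) ?hC; first by ring.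
    by rewrite !inE (negPf gb) orbF; apply/norP; split; apply: contraNneq gD => ->.
  have [Z [Zc yZ ZS]] := code_thru rRe Rw yw.
  have ZS' := subset_trans ZS wS.
  have Zi := circ_in Zc.
  have xZ : x \notin Z.
    by apply/negP=> /(subsetP ZS'); rewrite !inE eqxx /= orbF (negPf xb).
  case bZ': (b \in Z).
    have Si : sdiff Z [set x; y; b] \in con e ZZ by apply: bZe.2 => //; apply: circ_in.
    have SD : sdiff Z [set x; y; b] \subset D.
      apply/subsetP=> g; rewrite !inE; case: (eqVneq g b) => [->|gb]; first by rewrite bZ' orbT.
      case: (eqVneq g x) => [->//|gx]; case: (eqVneq g y) => [->//|gy]; rewrite addbF.
      by move/(subsetP ZS'); rewrite !inE (negPf gb) (negPf gx).
    have yS : y \notin sdiff Z [set x; y; b] by rewrite !inE yZ eqxx orbT.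
    have := circ_sub0 Dc Si SD yD yS => /setP/(_ x).
    by rewrite !inE (negPf xZ) eqxx.
  have ZD' : Z \subset D.
    apply/subsetP=> g gZ; have := subsetP ZS' g gZ; rewrite !inE => /orP[/eqP gb|/andP[]//].
    by rewrite -gb gZ in bZ'.
  have := circ_sub0 Dc Zi ZD' xD xZ => Z0.
  by rewrite Z0 inE in yZ.
have k1 := key D1 d1 c1 x1 y1 b1 R1 s1; have k2 := key D2 d2 c2 x2 y2 b2 R2 s2.
apply: (mulfI hx); apply: (mulfI hy); apply: (mulfI (s0 x)); apply: (mulfI (s0 y)).
have -> : s y * (s x * (h y * (h x * (d1 x * d2 y)))) = (s x * d1 x * h y) * (h x * (s y * d2 y)) by ring.
by rewrite k1 -k2; ring.
Qed.

(** If e lies in C or is not spanned by C, then C without e is a circuit of the contraction, with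
    the same slope; so [lam_con] applies. *)
Lemma lam_eq C1 C2 e : thru C1 -> thru C2 -> e \in A -> e != x -> e != y ->
  (e \in C1) || out e C1 -> (e \in C2) || out e C2 -> eqlam C1 C2.
Proof.
move=> t1 t2 eA ex ey h1 h2.
have tb C : thru C -> (e \in C) || out e C -> e != b.
  case/and4P=> Cc xC yC bC /orP[eC|/outP eo]; first by apply: contraNneq bC => <-.
  apply/eqP=> eb; have := eo _ tri; rewrite eb !inE eqxx orbT => /(_ isT)/negP; apply.
  by apply/subsetP=> g; rewrite !inE => /orP[/orP[]|] /eqP->; rewrite ?xC ?yC ?orbT ?eqxx.
have eb := tb C1 t1 h1.
have offe Z : Z \in ZZ -> e \in Z -> ~~ (Z \subset [set x; y; b; e]).
  move=> Zi eZ; apply/negP=> ZS; have [Z' [Zi' eZ' ZS']] := off_line Zi eZ ZS eb ex ey.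
  case/and4P: t1 h1 => Cc xC yC bC /orP[eC|/outP/(_ Z' Zi' eZ')/negP]; last first.
    apply; apply: subset_trans ZS' _; apply/subsetP=> g; rewrite !inE.
    by case/orP=> [/orP[]|] /eqP->; rewrite ?xC ?yC ?orbT ?eqxx.
  have ZC : Z' \subset C1.
    by apply: subset_trans ZS' _; apply/subsetP=> g; rewrite !inE => /orP[/orP[]|] /eqP->.
  have eqZ : Z' = C1 by apply: circ_min Cc Zi' ZC _; apply/set0Pn; exists e.
  have := no_third eb ex ey; suff <- : C1 = [set x; y; e] by rewrite -eqZ Zi'.
  apply/eqP; rewrite eqEsubset -{1}eqZ ZS'; apply/subsetP=> g.
  by rewrite !inE => /orP[/orP[]|] /eqP->.
have step C c : thru C -> (e \in C) || out e C -> R c -> supp c = C ->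
    exists D, [/\ circ (con e ZZ) D, x \in D, y \in D, b \notin D &
      supp (zeroat e c) = D].
  case/and4P=> Cc xC yC bC eoC Rc cC; case/orP: eoC => [eC|/outP eo].
    exists (C :\ e); rewrite supp_zeroat cC !inE xC yC (negPf bC) andbF; split; neqs => //.
    apply: circ_con_in => //; apply: contraTneq (crit_nonloop crA e) => <-.
    by rewrite negbK (circ_in Cc).
  case eC: (e \in C).
    have /negP[] := eo C (circ_in Cc) eC; exact: subsetUr.
  exists C; rewrite supp_zeroat cC; split=> //.
    by apply: circ_con_out; rewrite ?eC.
  by apply/setDidPl; rewrite disjoint_sym disjoints1 eC.
move=> c1 c2 R1 R2 s1 s2.
have [D1 [Dc1 xD1 yD1 bD1 sD1]] := step C1 c1 t1 h1 R1 s1.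
have [D2 [Dc2 xD2 yD2 bD2 sD2]] := step C2 c2 t2 h2 R2 s2.
have := @lam_con e D1 D2 (zeroat e c1) (zeroat e c2) eA eb ex ey offe Dc1 Dc2.
move=> /(_ xD1 xD2 yD1 yD2 bD1 bD2).
have P c : R c -> punct e R (zeroat e c) by exists c.
move=> /(_ (P _ R1) (P _ R2) sD1 sD2).
by rewrite !zeroatE; neqs.
Qed.

Lemma code_b c : R c -> c b = 0.
Proof.
move=> Rc; apply: suppN; apply/negP=> bc.
have [C [Cc bC _]] := code_thru rR Rc bc.
by move: Cc; rewrite circ_del bC andbF.
Qed.

Lemma code_of_circ C : circ ZZ C -> b \notin C -> exists2 c, R c & supp c = C.
Proof. by move=> Cc bC; apply: (code_circ rR); rewrite [minset _ _]circ_del Cc. Qed.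

Section Constant.
Hypothesis lam : forall C1 C2, thru C1 -> thru C2 -> eqlam C1 C2.

Lemma line_chain : exists h : {ffun T -> F}, [/\ supp h = [set x; y; b], h b = 1 &
  forall C c, thru C -> R c -> supp c = C -> h x * c y = c x * h y].
Proof.
have [u [v [u0 v0 uv]]] : exists u v : F, [/\ u != 0, v != 0 &
    forall C c, thru C -> R c -> supp c = C -> u * c y = c x * v].
  case: (pickP thru) => [C0 t0|no].
    have [c0 [R0 s0 x0 y0]] := thru_chain t0.
    exists (c0 x), (c0 y); split=> // C c tC Rc cC.
    exact: (lam t0 tC R0 Rc s0 cC).
  (* Without circuits in [thru] the slope of the line is arbitrary. *)
  by exists 1, 1; rewrite oner_neq0; split=> // C c; rewrite no.
exists [ffun g => if g == x then u else if g == y then v else (g == b)%:R]; split.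
- apply/setP=> g; rewrite !inE ffunE; case: (g == x); first by rewrite u0.
  by case: (g == y); rewrite ?v0 //; case: (g == b); rewrite ?oner_neq0 ?eqxx.
- by rewrite ffunE; neqs.
by move=> C c tC Rc cC; rewrite !ffunE; neqs; apply: uv cC.
Qed.

Lemma circ_swap v C : circ ZZ C -> b \in C -> v \notin C -> v \in [set x; y; b] ->
  (forall u, u \in [set x; y; b] -> u != v -> u \in C) ->
  circ ZZ (sdiff C [set x; y; b]).
Proof.
move=> Cc bC vC vL uC; set W := sdiff C _.
have Wi : W \in ZZ by apply: ZD => //; apply: circ_in.
have sub Y : Y \subset W -> v \notin Y -> Y \subset C.
  move=> YW vY; apply/subsetP=> g gY; have := subsetP YW g gY; rewrite in_sdiff.
  by case gL: (g \in [set x; y; b]); rewrite ?addbF // uC //; apply: contraNneq vY => <-.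
have bW : b \notin W by rewrite !inE bC eqxx orbT.
have vW : v \in W by rewrite in_sdiff vL (negPf vC).
apply/circP; split=> //; first by apply/set0Pn; exists v.
move=> Y Yi Y0 YW; case vY: (v \in Y); last first.
  case/eqP: Y0; apply: (circ_sub0 Cc Yi _ bC); first by apply: sub; rewrite ?vY.
  by apply: contra bW; apply: (subsetP YW).
have Si : sdiff W Y \in ZZ by apply: ZD.
have SW : sdiff W Y \subset W by sets.
have S0 : sdiff W Y = set0.
  apply: (circ_sub0 Cc Si _ bC); first by apply: sub; rewrite // in_sdiff vW vY.
  by rewrite in_sdiff (negPf bW) addFb; apply: contra bW; apply: (subsetP YW).
by apply/esym/eqP; rewrite -sdiff_eq0 S0.
Qed.

(** The code is R enlarged by one chain h on the line with the common slope. A circuit through b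
    gets its chain from h by cancelling, with chains of R, the points of the line that it should
    miss. *)
Lemma const_frep : frep F (dep ZZ).
Proof.
have [h [hL hb hc]] := line_chain.
have hx : h x != 0 by rewrite -in_supp hL !inE eqxx.
have hy : h y != 0 by rewrite -in_supp hL !inE eqxx orbT.
have h0 g : g != x -> g != y -> g != b -> h g = 0.
  by move=> gx gy gb; rewrite suppN // hL !inE; neqs.
exists (fun c => exists t c0, R c0 /\ c = c0 + sc t h); split.
- exists 0, 0; split; first exact: (code0 rR).
  by apply/ffunP=> g; rewrite addE scE mul0r !ffunE addr0.
- move=> _ _ [t [c [Rc ->]]] [u [d [Rd ->]]]; exists (t + u), (c + d); split.
    exact: (codeD rR).
  by apply/ffunP=> g; rewrite !(addE, scE); ring.
- move=> u _ [t [c [Rc ->]]]; exists (u * t), (sc u c); split; first exact: (codeZ rR).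
  by apply/ffunP=> g; rewrite !(addE, scE); ring.
- move=> C Cc; case bC: (b \in C); last first.
    have [c Rc cC] := code_of_circ Cc (negbT bC); exists c => //.
    by exists 0, c; split=> //; apply/ffunP=> g; rewrite addE scE mul0r addr0.
  suff [c0 [Rc0 cx cy cg]] : exists c0, [/\ R c0, (x \in C) = (c0 x + h x != 0),
      (y \in C) = (c0 y + h y != 0) &
      forall g, g != x -> g != y -> g != b -> (g \in C) = (c0 g != 0)].
    exists (c0 + sc 1 h); first by exists 1, c0.
    apply/setP=> g; rewrite in_supp addE scE mul1r.
    case: (eqVneq g x) => [->|gx]; first by rewrite cx.
    case: (eqVneq g y) => [->|gy]; first by rewrite cy.
    case: (eqVneq g b) => [->|gb]; first by rewrite code_b // hb add0r oner_neq0 bC.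
    by rewrite h0 // addr0 cg.
  case xC: (x \in C); case yC: (y \in C).
  + exists 0; split; rewrite ?ffunE ?add0r ?hx ?hy //; first exact: (code0 rR).
    have <- : [set x; y; b] = C.
      apply: circ_min Cc tri _ _; last by apply/set0Pn; exists x; rewrite !inE eqxx.
      by apply/subsetP=> g; rewrite !inE => /orP[/orP[]|] /eqP->.
    by move=> g gx gy gb; rewrite !inE ffunE eqxx; neqs.
  + have Wc : circ ZZ (sdiff C [set x; y; b]).
      apply: (circ_swap (v := y)); rewrite ?yC ?inE ?eqxx ?orbT // => u.
      by rewrite !inE => /orP[/orP[]|] /eqP-> //; rewrite eqxx.
    have bW : b \notin sdiff C [set x; y; b] by rewrite !inE bC eqxx orbT.
    have [c Rc cW] := code_of_circ Wc bW.
    have inW g : (g \in sdiff C [set x; y; b]) = (c g != 0) by rewrite -cW in_supp.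
    have cy : c y != 0 by rewrite -inW !inE yC eqxx orbT.
    have cx : c x = 0 by apply/eqP; rewrite -[_ == _]negbK -inW !inE xC eqxx.
    have t0 : - (h y / c y) != 0 by rewrite oppr_eq0 mulf_neq0 ?invr_eq0.
    exists (sc (- (h y / c y)) c); rewrite !scE cx mulr0 add0r hx mulNr divfK //.
    rewrite addNr eqxx; split=> //; first exact: (codeZ rR).
    move=> g gx gy gb; rewrite scE mulf_eq0 (negPf t0) -inW !inE; neqs.
    by rewrite addbF.
  + have Wc : circ ZZ (sdiff C [set x; y; b]).
      apply: (circ_swap (v := x)); rewrite ?xC ?inE ?eqxx ?orbT // => u.
      by rewrite !inE => /orP[/orP[]|] /eqP-> //; rewrite eqxx.
    have bW : b \notin sdiff C [set x; y; b] by rewrite !inE bC eqxx orbT.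
    have [c Rc cW] := code_of_circ Wc bW.
    have inW g : (g \in sdiff C [set x; y; b]) = (c g != 0) by rewrite -cW in_supp.
    have cx : c x != 0 by rewrite -inW !inE xC eqxx.
    have cy : c y = 0 by apply/eqP; rewrite -[_ == _]negbK -inW !inE yC eqxx orbT.
    have t0 : - (h x / c x) != 0 by rewrite oppr_eq0 mulf_neq0 ?invr_eq0.
    exists (sc (- (h x / c x)) c); rewrite !scE cy mulr0 add0r hy mulNr divfK //.
    rewrite addNr eqxx; split=> //; first exact: (codeZ rR).
    move=> g gx gy gb; rewrite scE mulf_eq0 (negPf t0) -inW !inE; neqs.
    by rewrite addbF.
  (* C meets the line in b alone, so x and y must both be cancelled. If W is a circuit, the common
     slope lets one multiple of its chain cancel both; otherwise W splits into a circuit through x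
     and one through y. *)
  pose W := sdiff C [set x; y; b].
  have Wi : W \in ZZ by apply: ZD => //; apply: circ_in.
  have xW : x \in W by rewrite !inE xC eqxx.
  have yW : y \in W by rewrite !inE yC eqxx orbT.
  have bW : b \notin W by rewrite !inE bC eqxx orbT.
  have nil Y : Y \in ZZ -> Y \subset W -> x \notin Y -> y \notin Y -> Y = set0.
    move=> Yi YW xY yY; apply: (circ_sub0 Cc Yi _ bC).
      apply/subsetP=> g gY; have := subsetP YW g gY; rewrite !inE.
      case: (eqVneq g x) gY => [->|gx gY]; first by neqs.
      case: (eqVneq g y) gY => [->|gy gY]; first by neqs.
      by case: (eqVneq g b) => [->|gb]; rewrite ?bC ?addbF.
    by apply: contra bW; apply: (subsetP YW).
  have inWC g : g != x -> g != y -> g != b -> (g \in W) = (g \in C).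
    by move=> gx gy gb; rewrite !inE; neqs; rewrite addbF.
  have [Y [Yc xY YW]] := circ_thru bZ Wi xW.
  have bY : b \notin Y by apply: contra bW; apply: (subsetP YW).
  have [c Rc cY] := code_of_circ Yc bY.
  have cx : c x != 0 by rewrite -in_supp cY.
  have Si : sdiff W Y \in ZZ by apply: ZD => //; apply: circ_in.
  have SW : sdiff W Y \subset W by sets.
  have xS : x \notin sdiff W Y by rewrite in_sdiff xW xY.
  case yY: (y \in Y).
    have eqW : W = Y.
      apply/eqP; rewrite -sdiff_eq0; apply/eqP; apply: nil => //.
      by rewrite in_sdiff yW yY.
    have tY : thru Y by rewrite /thru xY yY bY Yc.
    have cxy := hc Y c tY Rc cY.
    have t0 : - (h x / c x) != 0 by rewrite oppr_eq0 mulf_neq0 ?invr_eq0.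
    exists (sc (- (h x / c x)) c); rewrite !scE mulNr divfK // addNr eqxx.
    split=> //; first exact: (codeZ rR).
      rewrite mulNr mulrAC cxy mulrAC divff // mul1r addNr eqxx //.
    by move=> g gx gy gb; rewrite scE mulf_eq0 (negPf t0) -in_supp cY -eqW inWC.
  have yS : y \in sdiff W Y by rewrite in_sdiff yW yY.
  have Sc : circ ZZ (sdiff W Y).
    apply/circP; split=> //; first by apply/set0Pn; exists y.
    move=> Y' Yi' Y'0 Y'S; have Y'W := subset_trans Y'S SW.
    have xY' : x \notin Y' by apply: contra xS; apply: (subsetP Y'S).
    case yY': (y \in Y'); last by rewrite (nil Y') ?yY' // eqxx in Y'0.
    apply/eqP; rewrite -sdiff_eq0; apply/eqP; apply: nil; first exact: ZD.
    - by sets.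
    - by rewrite in_sdiff (negPf xY') (negPf xS).
    - by rewrite in_sdiff yY' yS.
  have bS : b \notin sdiff W Y by apply: contra bW; apply: (subsetP SW).
  have [d Rd dS] := code_of_circ Sc bS.
  have dy : d y != 0 by rewrite -in_supp dS.
  have dx : d x = 0 by rewrite suppN // dS.
  have cy : c y = 0 by rewrite suppN // cY yY.
  have t0 : - (h x / c x) != 0 by rewrite oppr_eq0 mulf_neq0 ?invr_eq0.
  have u0 : - (h y / d y) != 0 by rewrite oppr_eq0 mulf_neq0 ?invr_eq0.
  exists (sc (- (h x / c x)) c + sc (- (h y / d y)) d).
  rewrite !(addE, scE) dx cy !mulr0 addr0 add0r !mulNr !divfK // !addNr eqxx.
  split=> //; first by apply: (codeD rR); apply: (codeZ rR).
  move=> g gx gy gb; rewrite addE !scE -inWC //.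
  case gY: (g \in Y).
    rewrite (subsetP YW) // (@suppN _ _ d g) ?mulr0 ?addr0.
      by rewrite mulf_eq0 (negPf t0) -in_supp cY gY.
    by rewrite dS in_sdiff gY (subsetP YW).
  rewrite (@suppN _ _ c g) ?cY ?gY // mulr0 add0r mulf_eq0 (negPf u0) -in_supp dS.
  by rewrite in_sdiff gY addbF.
move=> _ [t [c [Rc ->]]]; set e := c + sc t h => e0.
have eb : e b = t by rewrite addE scE hb code_b // mulr1 add0r.
case: (eqVneq t 0) => t0.
  have ec : e = c by apply/ffunP=> g; rewrite addE scE t0 mul0r addr0.
  rewrite ec in e0 *; have /depP[Z [Zi Z0 Zc]] := code_dep rR Rc e0.
  by apply/depP; exists Z; split=> //; move: Zi; rewrite inE => /andP[].
have be : b \in supp e by rewrite in_supp eb.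
have inE_ g : g != x -> g != y -> g \in supp c -> g \in supp e.
  move=> gx gy; rewrite !in_supp addE scE; case: (eqVneq g b) => [->|gb].
    by rewrite code_b // eqxx.
  by rewrite h0 // mulr0 addr0.
have cyc g : g \in supp c -> exists Z, [/\ Z \in ZZ, g \in Z, b \notin Z & Z \subset supp c].
  move=> gc; have [C [Cc gC CS]] := code_thru rR Rc gc.
  by move: Cc; rewrite circ_del => /andP[Cc bC]; exists C; rewrite (circ_in Cc).
(* The line added to a cycle Z inside the support of c lies in the support of e as soon as Z
   contains each of x and y at which e vanishes. Such a Z is assembled below from cycles through x
   and through y. *)
have addL Z : Z \in ZZ -> b \notin Z -> Z \subset supp c ->
    (x \in Z) || (x \in supp e) -> (y \in Z) || (y \in supp e) ->
    dep ZZ (supp e).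
  move=> Zi bZ' Zc xx yy; apply/depP; exists (sdiff Z [set x; y; b]); split.
  - exact: ZD.
  - by apply/set0Pn; exists b; rewrite !inE eqxx orbT (negPf bZ').
  apply/subsetP=> g; rewrite in_sdiff.
  case: (eqVneq g x) => [->|gx].
    by rewrite !inE eqxx /= addbT => xZ; move: xx; rewrite (negPf xZ) inE.
  case: (eqVneq g y) => [->|gy].
    by rewrite !inE eqxx orbT addbT => yZ; move: yy; rewrite (negPf yZ) inE.
  case: (eqVneq g b) => [->//|gb]; rewrite !inE; neqs; rewrite addbF => gZ.
  by have := inE_ g gx gy (subsetP Zc g gZ); rewrite inE.
have cx : x \notin supp e -> x \in supp c.
  rewrite !in_supp negbK addE scE addr_eq0 => /eqP->.
  by rewrite oppr_eq0 mulf_neq0.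
have cy : y \notin supp e -> y \in supp c.
  rewrite !in_supp negbK addE scE addr_eq0 => /eqP->.
  by rewrite oppr_eq0 mulf_neq0.
case xe: (x \in supp e); case ye: (y \in supp e).
- by apply: (addL set0 bZ.1); rewrite ?xe ?ye ?orbT ?sub0set // in_set0.
- have [Z [Zi yZ bZ' Zc]] := cyc y (cy (negbT ye)).
  by apply: (addL Z) => //; rewrite ?xe ?yZ ?orbT.
- have [Z [Zi xZ bZ' Zc]] := cyc x (cx (negbT xe)).
  by apply: (addL Z) => //; rewrite ?ye ?xZ ?orbT.
have [Z [Zi xZ bZ' Zc]] := cyc x (cx (negbT xe)).
case yZ: (y \in Z); first by apply: (addL Z) => //; rewrite ?yZ ?xZ.
have [Z' [Zi' yZ' bZ'' Zc']] := cyc y (cy (negbT ye)).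
case xZ': (x \in Z'); first by apply: (addL Z') => //; rewrite ?yZ' ?xZ'.
apply: (addL (sdiff Z Z')); first exact: ZD.
- by rewrite in_sdiff (negPf bZ') (negPf bZ'').
- by sets.
- by rewrite in_sdiff xZ xZ'.
by rewrite in_sdiff yZ yZ'.
Qed.

End Constant.

Lemma outPn e C : ~~ out e C -> exists Z, [/\ Z \in ZZ, e \in Z & Z \subset e |: C].
Proof.
by case/forall_inPn=> Z Zi; rewrite negb_imply negbK => /andP[eZ ZS]; exists Z.
Qed.

Lemma in_crit C e : circ ZZ C -> e \in C -> e \in A.
Proof. by move=> /circ_in/(crit_sub crA)/subsetP H /H. Qed.

Section Conflict.
Variables C1 C2 : {set T}.
Hypotheses (t1 : thru C1) (t2 : thru C2) (bad : ~ eqlam C1 C2).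

(** A circuit of [thru] that meets both C1 and C2 off {x, y} would have the slope of C1, by
    contracting e, and that of C2, by contracting f. *)
Lemma conflict_chain C3 e f : thru C3 -> e \in C1 -> e \in C3 -> f \in C3 -> f \in C2 ->
  e != x -> e != y -> f != x -> f != y -> False.
Proof.
move=> t3 e1 e3 f3 f2 ex ey fx fy; apply: bad; apply: (eqlam_trans t3).
  by apply: (lam_eq (e := e)); rewrite ?e1 ?e3 //; apply: in_crit e1; case/and4P: t1.
by apply: (lam_eq (e := f)); rewrite ?f2 ?f3 //; apply: in_crit f2; case/and4P: t2.
Qed.

Lemma conflict_disjoint e : e \in C1 -> e != x -> e != y -> e \notin C2.
Proof. by move=> e1 ex ey; apply/negP=> e2; apply: (conflict_chain t1 e1 e1 e1 e2). Qed.

(** C2 spans e, as otherwise contracting e would equate the slopes. The chord e cuts C2 in two, and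
    x and y fall on different sides: a side with both would be a circuit of [thru] that meets C1 in
    e and C2 off {x, y}. *)
Lemma conflict_sep e : e \in C1 -> e != x -> e != y ->
  exists Z, [/\ Z \in ZZ, e \in Z, Z \subset e |: C2, x \in Z & y \notin Z].
Proof.
move=> e1 ex ey; have e2 := conflict_disjoint e1 ex ey.
have [Cc1 xC1 yC1 bC1] := and4P t1; have [Cc2 xC2 yC2 bC2] := and4P t2.
have eb : e != b by apply: contraNneq bC1 => <-.
have [Z [Zi eZ ZS xZ]] : exists Z, [/\ Z \in ZZ, e \in Z, Z \subset e |: C2 & x \in Z].
  case: (boolP (out e C2)) => [eo|/outPn[Z [Zi eZ ZS]]].
    case: bad; apply: (lam_eq (e := e)); rewrite ?e1 ?eo ?orbT //.
    exact: in_crit Cc1 e1.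
  case xZ: (x \in Z); first by exists Z.
  exists (sdiff Z C2); split.
  - by apply: ZD => //; apply: circ_in.
  - by rewrite in_sdiff eZ (negPf e2).
  - by sets.
  - by rewrite in_sdiff xZ xC2.
exists Z; split=> //; apply/negP=> yZ.
have Zc := circ_ext Cc2 e2 Zi eZ ZS.
have bZ' : b \notin Z.
  by apply/negP=> /(subsetP ZS); rewrite !inE (negPf bC2) orbF eq_sym (negPf eb).
have tZ : thru Z by rewrite /thru Zc xZ yZ bZ'.
have [f fZ fn] : exists2 f, f \in Z & f \notin [set x; y; e].
  apply/subsetPn; apply: contra (no_third eb ex ey) => ZS3.
  suff -> : [set x; y; e] = Z by [].
  apply/eqP; rewrite eqEsubset ZS3 andbT; apply/subsetP=> g.
  by rewrite !inE => /orP[/orP[]|] /eqP->.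
move: fn; rewrite !inE !negb_or => /andP[/andP[fx fy] fe].
have f2 : f \in C2 by have := subsetP ZS f fZ; rewrite !inE (negPf fe).
exact: (conflict_chain tZ e1 eZ fZ f2).
Qed.

(** W = Z + Z' + C2 contains x, y, e and e'. A circuit Y of W through x is determined by which of e
    and e' it contains: it is W, Z, Z' or C2. If it is W, [conflict_chain] keeps W off the rest of
    C2, so the two parts are complementary; in the other cases Y inside W gives an inclusion. *)
Lemma conflict_nested e e' Z Z' : e \in C1 -> e' \in C1 -> e != e' ->
    e != x -> e != y -> e' != x -> e' != y ->
    Z \in ZZ -> e \in Z -> Z \subset e |: C2 -> x \in Z -> y \notin Z ->
    Z' \in ZZ -> e' \in Z' -> Z' \subset e' |: C2 -> x \in Z' -> y \notin Z' ->
  [\/ Z :&: C2 \subset Z', Z' :&: C2 \subset Z |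
      forall g, g \in C2 -> g != x -> g != y -> (g \in Z) = (g \notin Z')].
Proof.
move=> e1 e1' ee ex ey ex' ey' Zi eZ ZS xZ yZ Zi' eZ' ZS' xZ' yZ'.
have [Cc1 xC1 yC1 bC1] := and4P t1; have [Cc2 xC2 yC2 bC2] := and4P t2.
have e2 := conflict_disjoint e1 ex ey; have e2' := conflict_disjoint e1' ex' ey'.
have eb : e != b by apply: contraNneq bC1 => <-.
have eb' : e' != b by apply: contraNneq bC1 => <-.
case: (boolP (Z :&: C2 \subset Z')) => [|n1]; first by constructor 1.
case: (boolP (Z' :&: C2 \subset Z)) => [|n2]; first by constructor 2.
constructor 3 => g g2 gx gy.
pose W := sdiff (sdiff Z Z') C2.
have Wi : W \in ZZ by apply: ZD; [exact: ZD | exact: circ_in].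
have eZ'F : e \notin Z' by apply/negP=> /(subsetP ZS'); rewrite !inE (negPf ee) (negPf e2).
have eZF' : e' \notin Z.
  by apply/negP=> /(subsetP ZS); rewrite !inE eq_sym (negPf ee) (negPf e2').
have xW : x \in W by rewrite !in_sdiff xZ xZ' xC2.
have yW : y \in W by rewrite !in_sdiff (negPf yZ) (negPf yZ') yC2.
have eW : e \in W by rewrite !in_sdiff eZ (negPf eZ'F) (negPf e2).
have eW' : e' \in W by rewrite !in_sdiff eZ' (negPf eZF') (negPf e2').
have WS : W \subset [set e; e'] :|: C2.
  apply/subsetP=> h; rewrite !in_sdiff => hW; rewrite !inE.
  have := subset_imp ZS h; have := subset_imp ZS' h; rewrite !inE; move: hW.
  by case: (h == e); case: (h == e'); case: (h \in Z); case: (h \in Z'); case: (h \in C2).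
have [Y [Yc xY YW]] := circ_thru bZ Wi xW.
have Yi := circ_in Yc.
have in2 (S : {set T}) : S \subset [set e; e'] :|: C2 -> e \notin S -> e' \notin S -> S \subset C2.
  move=> SS eS eS'; apply/subsetP=> h hS; have := subsetP SS h hS; rewrite !inE.
  case: (eqVneq h e) hS => [->|_ hS]; first by rewrite (negPf eS).
  by case: (eqVneq h e') hS => [->|//]; rewrite (negPf eS').
have Z2 : Z \subset [set e; e'] :|: C2 by apply: subset_trans ZS _; sets.
have Z2' : Z' \subset [set e; e'] :|: C2 by apply: subset_trans ZS' _; sets.
have Y2 := subset_trans YW WS.
have sd2 (S S' : {set T}) : S \subset [set e; e'] :|: C2 -> S' \subset [set e; e'] :|: C2 ->
  sdiff S S' \subset [set e; e'] :|: C2 by move=> ? ?; sets.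
have eqY (S : {set T}) : S \in ZZ -> S \subset [set e; e'] :|: C2 -> x \in S ->
    (e \in Y) = (e \in S) -> (e' \in Y) = (e' \in S) -> Y = S.
  move=> Si SS xS eYS eYS'; apply/eqP; rewrite -sdiff_eq0; apply/eqP.
  apply: (circ_sub0 Cc2 _ _ xC2); first exact: ZD.
    by apply: in2; rewrite ?sd2 // in_sdiff ?eYS ?eYS' addbb.
  by rewrite in_sdiff xY xS.
case eY: (e \in Y); case eY': (e' \in Y).
- have YeqW : Y = W by apply: eqY; rewrite ?eY ?eY' ?eW ?eW'.
  have bW : b \notin W.
    by apply/negP=> /(subsetP WS); rewrite !inE (negPf bC2) orbF ![b == _]eq_sym (negPf eb) (negPf eb').
  have tW : thru W by rewrite /thru xW yW bW -YeqW Yc.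
  case gZ: (g \in Z); case gZ': (g \in Z') => //.
    by case: (conflict_chain tW e1 eW (f := g)) => //; rewrite !in_sdiff g2 gZ gZ'.
  by case: (conflict_chain tW e1 eW (f := g)) => //; rewrite !in_sdiff g2 gZ gZ'.
- have YZ : Y = Z by apply: eqY; rewrite ?eY ?eY' ?eZ ?(negPf eZF').
  case/negP: n1; apply/subsetP=> h; rewrite inE => /andP[hZ h2].
  have := subsetP YW h; rewrite YZ hZ => /(_ isT); rewrite !in_sdiff hZ h2.
  by case: (h \in Z').
- have YZ' : Y = Z' by apply: eqY; rewrite ?eY ?eY' ?eZ' ?(negPf eZ'F).
  case/negP: n2; apply/subsetP=> h; rewrite inE => /andP[hZ h2].
  have := subsetP YW h; rewrite YZ' hZ => /(_ isT); rewrite !in_sdiff hZ h2.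
  by case: (h \in Z).
have YC : Y \subset C2 by apply: in2; rewrite ?eY ?eY'.
have Y0 : Y != set0 by apply/set0Pn; exists x.
have eqYC := circ_min Cc2 Yi YC Y0.
case/negP: n1; apply/subsetP=> h; rewrite inE => /andP[hZ h2].
have := subsetP YW h; rewrite eqYC h2 => /(_ isT); rewrite !in_sdiff hZ h2.
by case: (h \in Z').
Qed.

Definition core C := C :\: [set x; y].

Lemma in_core C e : (e \in core C) = [&& e != x, e != y & e \in C].
Proof. by rewrite !inE negb_or andbA. Qed.

(* Each e \in core C1 cuts core C2 in two parts; these bipartitions are distinct
   and pairwise nested. *)
Lemma conflict_lt : (2 < #|core C1|)%N -> (#|core C1| < #|core C2|)%N.
Proof.
move=> big.
have [Cc1 xC1 yC1 bC1] := and4P t1; have [Cc2 xC2 yC2 bC2] := and4P t2.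
have /fin_all_exists[Zf HZ] : forall e, exists Z, e \in core C1 ->
    [/\ Z \in ZZ, e \in Z, Z \subset e |: C2, x \in Z & y \notin Z].
  move=> e; case eC: (e \in core C1); last by exists set0.
  move: eC; rewrite in_core => /and3P[ex ey e1].
  by have [Z HZ] := conflict_sep e1 ex ey; exists Z.
pose t e := Zf e :&: core C2.
have in_t e g : (g \in t e) = (g \in Zf e) && (g \in core C2) by rewrite inE.
have zE e g : e \in core C1 -> (g \in Zf e) = [|| g == e, g == x | g \in t e].
  move=> eC; have [Zi eZ ZS xZ yZ] := HZ e eC; rewrite in_t in_core.
  case: (eqVneq g e) => [->|ge]; first by rewrite eZ.
  case: (eqVneq g x) => [->|gx]; first by rewrite xZ.
  case: (eqVneq g y) => [->|gy]; first by rewrite (negPf yZ).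
  by have := subset_imp ZS g; rewrite !inE (negPf ge) /=; case: (g \in Zf e); case: (g \in C2).
have t0 e : e \in core C1 -> t e != set0.
  move=> eC; apply/eqP=> te; have [Zi _ _ _ _] := HZ e eC.
  move: (eC); rewrite in_core => /and3P[ex _ _].
  have := crit_nonparallel crA ex; suff <- : Zf e = [set e; x] by rewrite Zi.
  by apply/setP=> g; rewrite zE // te !inE orbF.
have tT e : e \in core C1 -> t e != core C2.
  move=> eC; apply/eqP=> te; have [Zi eZ _ xZ yZ] := HZ e eC.
  move: (eC); rewrite in_core => /and3P[ex ey e1].
  have e2 := conflict_disjoint e1 ex ey.
  have := crit_nonparallel crA ey; suff <- : sdiff (Zf e) C2 = [set e; y].
    by rewrite ZD ?(circ_in Cc2).
  apply/setP=> g; rewrite in_sdiff zE // te in_core !inE.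
  case: (eqVneq g e) => [->|ge]; first by rewrite (negPf e2).
  case: (eqVneq g x) => [->|gx]; first by neqs.
  case: (eqVneq g y) => [->|gy]; first by rewrite yC2.
  by rewrite addbb.
have tinj e e' : e \in core C1 -> e' \in core C1 -> t e = t e' -> e = e'.
  move=> eC eC' te; apply/eqP/negPn/negP=> ee.
  have [Zi _ _ _ _] := HZ e eC; have [Zi' _ _ _ _] := HZ e' eC'.
  have := crit_nonparallel crA ee; suff <- : sdiff (Zf e) (Zf e') = [set e; e'].
    by rewrite ZD.
  have [ex ey e1] := and3P (etrans (esym (in_core _ _)) eC).
  have [ex' ey' e1'] := and3P (etrans (esym (in_core _ _)) eC').
  apply/setP=> g; rewrite in_sdiff !zE // te !inE.
  case: (eqVneq g e) => [->|ge] /=.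
    rewrite (negPf ee) (negPf ex) (negPf (conflict_disjoint e1 ex ey)) !andbF //.
  case: (eqVneq g e') => [->|ge'] /=; last by rewrite addbb.
  by rewrite (negPf ex') (negPf (conflict_disjoint e1' ex' ey')) !andbF.
have alt e e' : e \in core C1 -> e' \in core C1 -> e != e' ->
    [\/ t e \subset t e', t e' \subset t e | t e' = core C2 :\: t e].
  move=> eC eC' ee.
  have [Zi eZ ZS xZ yZ] := HZ e eC; have [Zi' eZ' ZS' xZ' yZ'] := HZ e' eC'.
  have [ex ey e1] := and3P (etrans (esym (in_core _ _)) eC).
  have [ex' ey' e1'] := and3P (etrans (esym (in_core _ _)) eC').
  case: (conflict_nested e1 e1' ee ex ey ex' ey' Zi eZ ZS xZ yZ Zi' eZ' ZS' xZ' yZ') => H.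
  - constructor 1; apply/subsetP=> g; rewrite !in_t in_core => /andP[gZ /and3P[-> -> g2]].
    by rewrite g2 (subsetP H) // inE gZ.
  - constructor 2; apply/subsetP=> g; rewrite !in_t in_core => /andP[gZ /and3P[-> -> g2]].
    by rewrite g2 (subsetP H) // inE gZ.
  constructor 3; apply/setP=> g; rewrite !in_t !inE negb_or.
  case: (eqVneq g x) => gx; rewrite ?andbF //=; case: (eqVneq g y) => gy; rewrite ?andbF //=.
  by case g2: (g \in C2); rewrite ?andbF //= !andbT H // negbK.
have tsub e : t e \subset core C2 by apply: subsetIr.
(* Complementary parts are impossible: by [big] there is a third element g of [core C1], and
   comparing its part with both of them always leads to an empty, full or repeated part. *)
have nest e e' : e \in core C1 -> e' \in core C1 -> (t e \subset t e') || (t e' \subset t e).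
  move=> eC eC'; case: (eqVneq e e') => [->|ee]; first by rewrite subxx.
  case: (alt e e' eC eC' ee) => [->|->|cmp]; rewrite ?orbT //.
  have [g gC] : exists g, g \in core C1 :\ e :\ e'.
    apply/set0Pn; rewrite -card_gt0; move: big.
    by rewrite (cardsD1 e) eC (cardsD1 e' (core C1 :\ e)) in_setD1 eC' eq_sym ee.
  move: gC; rewrite 2!in_setD1 => /and3P[ge' ge gC].
  have te0 := t0 e eC; have te0' := t0 e' eC'; have teT := tT g gC; have tg0 := t0 g gC.
  have eg : e != g by rewrite eq_sym.
  have e'g : e' != g by rewrite eq_sym.
  have sg := tsub g; have se := tsub e; have se' := tsub e'.
  have c2 : core C2 :\: t e' = t e.
    by rewrite cmp setDDr setDv set0U; apply/setIidPr.
  have [a ae] := set0Pn _ te0; have [a' ae'] := set0Pn _ te0'; have [a'' ag] := set0Pn _ tg0.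
  have dis z : z \in t e -> z \in t e' -> False by rewrite cmp in_setD => ->.
  case: (alt e g eC gC eg) => [H1|H1|H1]; case: (alt e' g eC' gC e'g) => [H2|H2|H2].
  - case/eqP: teT; apply/eqP; rewrite eqEsubset sg; apply/subsetP=> z zC.
    case ze: (z \in t e); first exact: (subsetP H1).
    by apply: (subsetP H2); rewrite cmp in_setD ze.
  - by case: (dis a ae); apply: (subsetP H2); apply: (subsetP H1).
  - by case/eqP: eg; apply: tinj; rewrite // H2 c2.
  - by case: (dis a' _ ae'); apply: (subsetP H1); apply: (subsetP H2).
  - by case: (dis a'' (subsetP H1 _ ag) (subsetP H2 _ ag)).
  - by case/eqP: eg; apply: tinj; rewrite // H2 c2.
  - by case/eqP: e'g; apply: tinj; rewrite // H1 cmp.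
  - by case/eqP: e'g; apply: tinj; rewrite // H1 cmp.
  by case/eqP: e'g; apply: tinj; rewrite // H1 cmp.
(* The parts form a chain of sets strictly between the empty set and [core C2], so their sizes are
   distinct and range from 1 to n - 1. *)
pose n := #|core C2|.
have lt_n e : e \in core C1 -> (#|t e| < n)%N.
  by move=> eC; apply: proper_card; rewrite properEneq tT ?tsub.
pose fn e : 'I_n.+1 := inord #|t e|.
have fnE e : e \in core C1 -> fn e = #|t e| :> nat.
  by move=> eC; rewrite inordK // ltnW // ltnS lt_n.
have inj : {in core C1 &, injective fn}.
  move=> e e' eC eC' /(congr1 val); rewrite /= !fnE // => card_eq.
  apply: tinj => //; apply/eqP; case/orP: (nest e e' eC eC') => H.
    by rewrite eqEcard H card_eq leqnn.
  by rewrite eq_sym eqEcard H card_eq leqnn.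
rewrite -(card_in_imset inj).
have : fn @: core C1 \subset [set i : 'I_n.+1 | (i != ord0) && (i != ord_max)].
  apply/subsetP=> _ /imsetP[e eC ->]; rewrite inE -!val_eqE /= fnE // -lt0n card_gt0 t0 //.
  by rewrite neq_ltn lt_n.
move/subset_leq_card/leq_ltn_trans; apply.
have [e eC] : exists e, e \in core C1.
  by apply/set0Pn; rewrite -card_gt0; apply: leq_trans big.
have max0 : (ord_max : 'I_n.+1) != ord0.
  by rewrite -val_eqE /= -lt0n; apply: leq_ltn_trans (lt_n e eC).
have cT : #|[set: 'I_n.+1] :\ ord0| = n.
  by have := cardsT 'I_n.+1; rewrite card_ord [#|setT|](cardsD1 ord0) inE add1n => -[].
rewrite -[X in (_ < X)%N]cT [X in (_ < X)%N](cardsD1 ord_max) !inE max0 add1n ltnS.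
by apply/subset_leq_card/subsetP=> i; rewrite !inE andbT => /andP[-> ->].
Qed.

End Conflict.

Lemma core_gt1 C : thru C -> (1 < #|core C|)%N.
Proof.
case/and4P=> Cc xC yC bC; rewrite ltnNge; apply/negP=> small.
have inC g : (g \in C) = [|| g == x, g == y | g \in core C].
  rewrite in_core; case: (eqVneq g x) => [->//|_]; by case: (eqVneq g y) => [->|].
case: (eqVneq (core C) set0) => [c0|/set0Pn[e eC]].
  have := crit_nonparallel crA xy; suff <- : C = [set x; y] by rewrite (circ_in Cc).
  by apply/setP=> g; rewrite inC c0 !inE orbF.
have eqc : core C = [set e].
  by apply/esym/eqP; rewrite eqEcard sub1set eC cards1.
have [ex ey e1] := and3P (etrans (esym (in_core _ _)) eC).
have eb : e != b by apply: contraNneq bC => <-.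
have := no_third eb ex ey; suff <- : C = [set x; y; e] by rewrite (circ_in Cc).
by apply/setP=> g; rewrite inC eqc !inE orbA.
Qed.

(** A core with more than two elements would be smaller than the other core, which would in turn be
    smaller than it. *)
Lemma conflict_card C1 C2 : thru C1 -> thru C2 -> ~ eqlam C1 C2 -> #|core C1| = 2.
Proof.
move=> t1 t2 bad; apply/eqP; rewrite eqn_leq core_gt1 // andbT leqNgt; apply/negP=> big.
have lt12 := conflict_lt t1 t2 bad big.
have bad' : ~ eqlam C2 C1 by move/eqlam_sym.
have := conflict_lt t2 t1 bad' (ltn_trans big lt12).
by rewrite ltnNge ltnW.
Qed.

(** By [conflict_sep] each of p and p' forms a cycle with x and a part of {q, q'}. Simplicity makes
    this part a single point, and a different one for p and p', which would otherwise be
    parallel. *)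
Lemma conflict_config C1 C2 : thru C1 -> thru C2 -> ~ eqlam C1 C2 -> exists q p p' q',
  [/\ [/\ C1 = [set x; y; p; p'], C2 = [set x; y; q; q'] & [/\ q != q', q != x & q != y]],
      [/\ q' != x, q' != y, p \notin C2 & p' \notin C2],
      [set x; q; p] \in ZZ & [set x; q'; p'] \in ZZ].
Proof.
move=> t1 t2 bad.
have [Cc1 xC1 yC1 bC1] := and4P t1; have [Cc2 xC2 yC2 bC2] := and4P t2.
have bad' : ~ eqlam C2 C1 by move/eqlam_sym.
have /eqP/cards2P[p [p' [pp eq1]]] := conflict_card t1 t2 bad.
have /eqP/cards2P[q [q' [qq eq2]]] := conflict_card t2 t1 bad'.
have inC C g : x \in C -> y \in C -> (g \in C) = [|| g == x, g == y | g \in core C].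
  move=> xC yC; rewrite in_core; case: (eqVneq g x) => [->//|_]; by case: (eqVneq g y) => [->|].
have [qx qy q2] : [/\ q != x, q != y & q \in C2].
  by apply/and3P; rewrite -in_core eq2 !inE eqxx.
have [qx' qy' q2'] : [/\ q' != x, q' != y & q' \in C2].
  by apply/and3P; rewrite -in_core eq2 !inE eqxx orbT.
have C1E : C1 = [set x; y; p; p'].
  by apply/setP=> g; rewrite inC // eq1 !inE !orbA.
have C2E : C2 = [set x; y; q; q'].
  by apply/setP=> g; rewrite inC // eq2 !inE !orbA.
have tr e : e \in core C1 ->
    [/\ e \notin C2 & [set x; q; e] \in ZZ \/ [set x; q'; e] \in ZZ].
  rewrite in_core => /and3P[ex ey e1].
  have e2 := conflict_disjoint t1 t2 bad e1 ex ey.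
  have [Z [Zi eZ ZS xZ yZ]] := conflict_sep t1 t2 bad e1 ex ey.
  have eq : e != q by apply: contraNneq e2 => ->.
  have eq' : e != q' by apply: contraNneq e2 => ->.
  have ZE : Z = [set g | [|| g == x, g == e, (g == q) && (q \in Z) | (g == q') && (q' \in Z)]].
    apply/setP=> g; rewrite inE.
    case: (eqVneq g x) => [->//|gx]; case: (eqVneq g e) => [->//|ge].
    case: (eqVneq g q) => [->|gq] /=; first by rewrite (negPf qq) /= orbF.
    case: (eqVneq g q') => [->//|gq'] /=; apply/negP=> gZ.
    have := subsetP ZS g gZ; rewrite C2E !inE (negPf gx) (negPf ge) (negPf gq) (negPf gq') !orbF /=.
    by move/eqP=> gy; rewrite -gy gZ in yZ.
  split=> //; case qZ: (q \in Z); case qZ': (q' \in Z).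
  - have := crit_nonparallel crA ey; suff <- : sdiff Z C2 = [set e; y].
      by rewrite ZD ?(circ_in Cc2).
    apply/setP=> g; rewrite in_sdiff ZE inE qZ qZ' C2E !inE !andbT.
    case: (eqVneq g x) => [->|gx]; first by neqs.
    case: (eqVneq g e) => [->|ge]; first by neqs.
    case: (eqVneq g y) => [->|gy]; first by neqs.
    by rewrite /= addbb.
  - left; suff <- : Z = [set x; q; e] by [].
    apply/setP=> g; rewrite ZE inE qZ qZ' !inE andbT andbF orbF.
    by case: (g == x); case: (g == e); case: (g == q).
  - right; suff <- : Z = [set x; q'; e] by [].
    apply/setP=> g; rewrite ZE inE qZ qZ' !inE andbT andbF.
    by case: (g == x); case: (g == e); case: (g == q').
  have := crit_nonparallel crA ex; suff <- : Z = [set e; x] by rewrite Zi.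
  apply/setP=> g; rewrite ZE inE qZ qZ' !inE !andbF !orbF.
  by case: (g == x); case: (g == e).
have pC : p \in core C1 by rewrite eq1 !inE eqxx.
have pC' : p' \in core C1 by rewrite eq1 !inE eqxx orbT.
have [p2 tp] := tr p pC; have [p2' tp'] := tr p' pC'.
have notboth r : [set x; r; p] \in ZZ -> [set x; r; p'] \in ZZ -> r \in C2 -> False.
  move=> h h' rC; have := crit_nonparallel crA pp.
  have pr : p != r by apply: contraNneq p2 => ->.
  have pr' : p' != r by apply: contraNneq p2' => ->.
  have px : p != x by apply: contraNneq p2 => ->.
  have px' : p' != x by apply: contraNneq p2' => ->.
  suff <- : sdiff [set x; r; p] [set x; r; p'] = [set p; p'] by rewrite ZD.
  apply/setP=> g; rewrite !inE.
  case: (eqVneq g x) => [->|gx]; first by neqs.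
  case: (eqVneq g r) => [->|gr]; first by neqs.
  by case: (eqVneq g p) => [->|gp]; neqs.
case: tp => tp; case: tp' => tp'.
- by case: (notboth q).
- by exists q, p, p', q'.
- exists q', p, p', q; split=> //; split=> //; last by rewrite eq_sym.
  by rewrite C2E; apply/setP=> g; rewrite !inE -!orbA [(g == q) || _]orbC.
by case: (notboth q').
Qed.

End Chains.

Lemma triangle_config : exists q p p' q',
  [/\ [/\ ~~ dep ZZ [set x; y; q], q != x & q != y],
      [/\ p != x, p != q & [set x; q; p] \in ZZ],
      [/\ p' != y, p' != q & [set y; q; p'] \in ZZ],
      [/\ q' != x, q' != y, q' != q & [set x; y; q; q'] \in ZZ] &
      forall e, e \in A -> e \notin [set x; y; q] -> dep ZZ (e |: [set x; y; q])].
Proof.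
have delE : del b ZZ = restr (A :\ b) ZZ.
  apply/setP=> Z; rewrite !inE subsetD1.
  by case Zi: (Z \in ZZ) => //=; rewrite (crit_sub crA Zi).
have [R rR] : frep F (dep (del b ZZ)).
  rewrite delE; apply: (crit_del crA); apply: properD1.
  by apply: (in_crit tri_circ); rewrite !inE eqxx orbT.
have [C1 [C2 [t1 t2 bad]]] : exists C1 C2, [/\ thru C1, thru C2 & ~ eqlam R C1 C2].
  apply: NNPP => no; apply: (crit_nrep crA); apply: (const_frep rR) => C1 C2 t1 t2.
  by apply: NNPP => bad; apply: no; exists C1, C2.
have [q [p [p' [q' [[C1E C2E [qq qx qy]] [qx' qy' p2 p2'] tp tp']]]]] :=
  conflict_config rR t1 t2 bad.
have [Cc2 xC2 yC2 bC2] := and4P t2.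
have pN z : z \in C2 -> (p != z) && (p' != z).
  by move=> zC; apply/andP; split; apply: contraTneq zC => <-.
have [px px'] := andP (pN x xC2); have [py py'] := andP (pN y yC2).
have [pq pq'] : p != q /\ p' != q by apply/andP/pN; rewrite C2E !inE eqxx !orbT.
have [pr pr'] : p != q' /\ p' != q' by apply/andP/pN; rewrite C2E !inE eqxx !orbT.
have tp2 : [set y; q; p'] \in ZZ.
  suff <- : sdiff [set x; q'; p'] C2 = [set y; q; p'] by rewrite ZD ?(circ_in Cc2).
  apply/setP=> g; rewrite C2E !inE.
  case: (eqVneq g x) => [->|gx]; first by neqs.
  case: (eqVneq g y) => [->|gy]; first by neqs.
  case: (eqVneq g q) => [->|gq]; first by neqs.
  case: (eqVneq g q') => [->|gq']; first by neqs.
  by case: (eqVneq g p').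
have q'q : q' != q by rewrite eq_sym.
exists q, p, p', q'; split=> //.
- split=> //; apply/depP=> -[Z [Zi Z0 ZS]]; case/eqP: Z0.
  have ZC : Z \subset C2 by rewrite C2E; apply: subset_trans ZS _; apply: subsetUl.
  have q2' : q' \in C2 by rewrite C2E !inE eqxx !orbT.
  apply: (circ_sub0 Cc2 Zi ZC q2').
  by apply/negP=> /(subsetP ZS); rewrite !inE; neqs.
- by split=> //; rewrite -C2E; apply: circ_in.
move=> e eA; rewrite !inE !negb_or => /andP[/andP[ex ey] eq].
have nil Z : Z \in ZZ -> e \in Z -> Z \subset e |: C2 -> dep ZZ (e |: [set x; y; q]).
  move=> Zi eZ ZS; case: (eqVneq e q') => [->|eq'].
    apply/depP; exists C2; split; first exact: circ_in.
      exact: circ_neq0 Cc2.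
    by rewrite C2E; apply/subsetP=> g; rewrite !inE; do 4![case: (g == _) => //].
  case q'Z: (q' \in Z); last first.
    apply/depP; exists Z; split=> //; first by apply/set0Pn; exists e.
    apply/subsetP=> g gZ; have := subsetP ZS g gZ; rewrite C2E !inE.
    by case: (eqVneq g q') gZ => [->|_ _]; rewrite ?q'Z // orbF.
  apply/depP; exists (sdiff Z C2); split; first by rewrite ZD ?(circ_in Cc2).
    by apply/set0Pn; exists e; rewrite in_sdiff eZ C2E !inE; neqs.
  apply/subsetP=> g; rewrite in_sdiff => gS; have := subset_imp ZS g; move: gS.
  rewrite C2E !inE; case: (eqVneq g q') => [->|gq']; first by rewrite q'Z !orbT.
  by rewrite orbF; case: (g == x); case: (g == y); case: (g == q); case: (g == e); case: (g \in Z).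
case: (boolP (out e C2)) => [eo2|/outPn[Z [Zi eZ ZS]]]; last exact: nil eZ ZS.
case e1: (e \in C1).
  have [Z [Zi eZ ZS _ _]] := conflict_sep rR t1 t2 bad e1 ex ey.
  exact: nil eZ ZS.
case: (boolP (out e C1)) => [eo1|/outPn[Z [Zi eZ ZS]]].
  by case: bad; apply: (lam_eq rR (e := e)); rewrite ?eo1 ?eo2 ?orbT.
(* Adding the triangles {x, q, p} and {x, q', p'} trades p and p' for elements of C2, so whatever C1
   spans is spanned by C2. *)
pose Z1 := if p \in Z then sdiff Z [set x; q; p] else Z.
pose Z2 := if p' \in Z then sdiff Z1 [set x; q'; p'] else Z1.
have Zi1 : Z1 \in ZZ by rewrite /Z1; case: ifP => // _; apply: ZD.
have Zi2 : Z2 \in ZZ by rewrite /Z2; case: ifP => // _; apply: ZD.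
move: e1; rewrite C1E !inE (negPf ex) (negPf ey) /= => /norP[ep ep'].
have pp : p != p'.
  have := conflict_card rR t1 t2 bad; apply: contra_eq_neq => pp.
  suff -> : core C1 = [set p] by rewrite cards1.
  apply/setP=> g; rewrite in_core C1E -pp !inE.
  case: (eqVneq g x) => [->|gx]; first by neqs.
  case: (eqVneq g y) => [->|gy]; first by neqs.
  by case: (g == p).
case: (eqVneq e q') => [eq'|eq'].
  by apply: (nil C2); rewrite ?subsetUr ?(circ_in Cc2) // eq' C2E !inE eqxx !orbT.
apply: (nil Z2) => //.
  have e1 : e \in Z1 by rewrite /Z1; case: ifP => // _; rewrite in_sdiff eZ !inE; neqs.
  by rewrite /Z2; case: ifP => // _; rewrite in_sdiff e1 !inE; neqs.
apply/subsetP=> g; have := subset_imp ZS g; rewrite C1E C2E /Z2 /Z1.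
case: (eqVneq g p) => [->|gp].
  case pZ: (p \in Z); case pZ': (p' \in Z); rewrite !inE ?pZ; neqs => //.
case: (eqVneq g p') => [->|gp'].
  by case pZ: (p \in Z); case pZ': (p' \in Z); rewrite !inE ?pZ'; neqs.
case: (p \in Z); case: (p' \in Z); rewrite !inE (negPf gp) (negPf gp') !orbF;
  by case: (g \in Z); case: (g == e); case: (g == x); case: (g == y); case: (g == q); case: (g == q').
Qed.
End Triangle.

(** * Without triangles: the dual Fano plane *)

Section Glue.
Variables (T : finType) (F : fieldType) (A : {set T}) (ZZ : {set {set T}}).
Implicit Types B C D Y Z W : {set T}.
Implicit Types c : {ffun T -> F}.
Implicit Type R : {ffun T -> F} -> Prop.
Hypothesis crA : critical F A ZZ.
Let bZ := crit_bspace crA.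
Let ZD := bZ.2.

(* A common lift of representations of ZZ / x and ZZ / y that agree on ZZ / x / y. *)
Record glued R x y : Prop := Glued {
  glued0 : R 0;
  gluedD : forall c d, R c -> R d -> R (c + d);
  gluedZ : forall t c, R c -> R (sc t c);
  glued_l : code_for (punct x R) (dep (con x ZZ));
  glued_r : code_for (punct y R) (dep (con y ZZ));
  glued_xy : forall c, R c -> supp c \subset [set x; y] -> c = 0
}.

Lemma glued_sym R x y : glued R x y -> glued R y x.
Proof. by case=> ? ? ? ? ? H; split=> // c Rc cS; apply: H; rewrite // setUC. Qed.

Lemma nodep_pair x y : x != y -> ~~ dep ZZ [set x; y].
Proof.
move=> xy; apply/depP=> -[Z [Zi Z0 ZS]].
case xZ: (x \in Z); case yZ: (y \in Z).
- have := crit_nonparallel crA xy; suff <- : Z = [set x; y] by rewrite Zi.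
  by apply/eqP; rewrite eqEsubset ZS subUset !sub1set xZ yZ.
- have := crit_nonloop crA x; suff <- : Z = [set x] by rewrite Zi.
  apply/eqP; rewrite eqEsubset sub1set xZ andbT; apply/subsetP=> g gZ.
  by have := subsetP ZS g gZ; rewrite !inE => /orP[//|/eqP gy]; rewrite -gy gZ in yZ.
- have := crit_nonloop crA y; suff <- : Z = [set y] by rewrite Zi.
  apply/eqP; rewrite eqEsubset sub1set yZ andbT; apply/subsetP=> g gZ.
  by have := subsetP ZS g gZ; rewrite !inE => /orP[/eqP gx|//]; rewrite -gx gZ in xZ.
case/set0Pn: Z0 => g gZ; have := subsetP ZS g gZ; rewrite !inE.
by case/orP=> /eqP gE; rewrite -gE gZ in xZ yZ.
Qed.

Lemma pair_notin x y Z : x != y -> Z \in ZZ -> Z != set0 -> ~~ (Z \subset [set x; y]).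
Proof.
by move=> xy Zi Z0; apply: contra (nodep_pair xy) => ZS; apply/depP; exists Z.
Qed.

Lemma code_for_iff (R R' : {ffun T -> F} -> Prop) (D : pred {set T}) :
  (forall c, R c <-> R' c) -> code_for R D -> code_for R' D.
Proof.
move=> eqR [r0 rD rZ rC rd]; split.
- exact/eqR.
- by move=> c d /eqR Rc /eqR Rd; apply/eqR/rD.
- by move=> t c /eqR Rc; apply/eqR/rZ.
- by move=> C Cm; have [c /eqR Rc cC] := rC C Cm; exists c.
by move=> c /eqR; apply: rd.
Qed.

Lemma code_at0 R e c : code_for R (dep (con e ZZ)) -> R c -> c e = 0.
Proof.
move=> rR Rc; apply: suppN; apply/negP=> ec.
have [C [Cc eC _]] := code_thru rR Rc ec.
by have := con_notin (circ_in Cc); rewrite eC.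
Qed.

(** Both contractions yield representations of the contraction of {x, y}, and these agree after
    rescaling one of them. R consists of the vectors that become relations of either contraction
    when the coordinate is dropped; [code_sub_eq] makes the agreement an equality, so that relations
    of each contraction lift to R. *)
Lemma exists_glued x y : x \in A -> y \in A -> x != y -> exists R, glued R x y.
Proof.
move=> xA yA xy.
have [Rx rx] := crit_con crA xA (crit_nonloop crA x).
have [Ry0 ry0] := crit_con crA yA (crit_nonloop crA y).
have loop_con u v : u != v -> [set v] \notin con u ZZ.
  move=> uv; apply: contra (nodep_pair uv) => /conP[Z Zi eqZ].
  have vZ : v \in Z by have := set11 v; rewrite eqZ inE => /andP[].
  apply/depP; exists Z; split=> //; first by apply/set0Pn; exists v.
  apply/subsetP=> g gZ; rewrite !inE; case: (eqVneq g u) => //= gu.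
  by rewrite -in_set1 eqZ !inE gu.
have yx : y != x by rewrite eq_sym.
have bx : bspace (con x ZZ) := bspace_con x bZ.
have by_ : bspace (con y ZZ) := bspace_con y bZ.
have rxy := code_con bx (loop_con x y xy) rx.
have ryx := code_con by_ (loop_con y x yx) ry0.
rewrite conC in ryx.
have [s s0 Hs] := code_unique (bspace_con y bx) rxy ryx.
pose Ry c := Ry0 (rescale s c).
have ry : code_for Ry (dep (con y ZZ)) := code_rescale s0 ry0.
have sub c : punct y Rx c -> punct x Ry c.
  move=> /Hs[d Rd ed]; exists [ffun e => (s e)^-1 * d e].
    suff e1 : rescale s [ffun e => (s e)^-1 * d e] = d by rewrite /Ry e1.
    by apply/ffunP=> e; rewrite !ffunE mulVKf.
  apply/ffunP=> e; rewrite zeroatE ffunE; move/ffunP/(_ e): ed.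
  rewrite rescaleE zeroatE => ed; apply: (mulfI (s0 e)); rewrite ed.
  by case: (e == x); rewrite ?mulr0 // mulVKf.
have ryx' := code_con by_ (loop_con y x yx) ry.
rewrite conC in ryx'.
have sub' := code_sub_eq rxy ryx' sub.
pose R c := Rx (zeroat x c) /\ Ry (zeroat y c).
have liftx c : Rx c -> exists2 d, R d & c = zeroat x d.
  move=> Rc; have cx := code_at0 rx Rc.
  have [d Rd ed] : punct x Ry (zeroat y c) by apply: sub; exists c.
  have dy := code_at0 ry Rd.
  exists [ffun e => if e == x then d x else c e]; last first.
    by apply/ffunP=> e; rewrite zeroatE ffunE; case: eqP => // ->.
  split.
    suff -> : zeroat x [ffun e => if e == x then d x else c e] = c by [].
    by apply/ffunP=> e; rewrite zeroatE ffunE; case: eqP => // ->.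
  suff -> : zeroat y [ffun e => if e == x then d x else c e] = d by [].
  apply/ffunP=> e; move/ffunP/(_ e): ed; rewrite !zeroatE ffunE.
  case: (eqVneq e y) => [->|ey]; first by rewrite dy.
  by case: (eqVneq e x) => [->|].
have lifty c : Ry c -> exists2 d, R d & c = zeroat y d.
  move=> Rc; have cy := code_at0 ry Rc.
  have [d Rd ed] : punct y Rx (zeroat x c) by apply: sub'; exists c.
  have dx := code_at0 rx Rd.
  exists [ffun e => if e == y then d y else c e]; last first.
    by apply/ffunP=> e; rewrite zeroatE ffunE; case: eqP => // ->.
  split; last first.
    suff -> : zeroat y [ffun e => if e == y then d y else c e] = c by [].
    by apply/ffunP=> e; rewrite zeroatE ffunE; case: eqP => // ->.
  suff -> : zeroat x [ffun e => if e == y then d y else c e] = d by [].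
  apply/ffunP=> e; move/ffunP/(_ e): ed; rewrite !zeroatE ffunE.
  case: (eqVneq e x) => [->|ex]; first by rewrite dx.
  by case: (eqVneq e y) => [->|].
exists R; split.
- by split; rewrite zeroat0; [apply: (code0 rx) | apply: (code0 ry)].
- move=> c d [? ?] [? ?]; split; rewrite zeroatD; first exact: (codeD rx).
  exact: (codeD ry).
- move=> t c [? ?]; split; rewrite zeroatZ; first exact: (codeZ rx).
  exact: (codeZ ry).
- apply: code_for_iff rx => c; split=> [/liftx//|[d [Rd _] ->]]; exact: Rd.
- apply: code_for_iff ry => c; split=> [/lifty//|[d [_ Rd] ->]]; exact: Rd.
move=> c [Rc Rc'] cS.
have nd u v : u != v -> ~~ dep (con u ZZ) [set v].
  by move=> uv; rewrite con_dep ?(crit_nonloop crA) ?nodep_pair.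
have c0 : zeroat x c = 0.
  apply: (code_indep rx Rc (A := [set y])); last exact: nd.
  rewrite supp_zeroat; apply/subsetP=> g; rewrite in_setD1 => /andP[gx /(subsetP cS)].
  by rewrite !inE (negPf gx).
have c0' : zeroat y c = 0.
  apply: (code_indep ry Rc' (A := [set x])); last exact: nd.
  rewrite supp_zeroat; apply/subsetP=> g; rewrite in_setD1 => /andP[gy /(subsetP cS)].
  by rewrite !inE (negPf gy) orbF.
apply/ffunP=> e; rewrite ffunE; case: (eqVneq e x) => [->|ex].
  by move/ffunP/(_ x): c0'; rewrite zeroatE ffunE; neqs.
by move/ffunP/(_ e): c0; rewrite zeroatE ffunE (negPf ex).
Qed.

Section Glued.
Variables (R : {ffun T -> F} -> Prop) (x y : T).
Hypotheses (xy : x != y) (gR : glued R x y).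

Lemma glued_comb c d t : R c -> R d -> R (c + sc t d).
Proof. by move=> Rc Rd; apply: (gluedD gR) => //; apply: (gluedZ gR). Qed.

(** Lift the chain of C minus x. If its coefficient at x were 0, then C minus x would support a
    relation of the contraction of y, which forces [y |: (C :\ x)] to be a cycle; adding C leaves a
    nonempty cycle inside {x, y}. *)
Lemma glued_chain_l C : circ ZZ C -> x \in C -> exists2 c, R c & supp c = C.
Proof.
move=> Cc xC; have Ci := circ_in Cc.
have Cx : circ (con x ZZ) (C :\ x).
  apply: circ_con_in => //; apply: contraTneq (crit_nonloop crA x) => <-.
  by rewrite negbK.
have [_ [c Rc ->]] := code_circ (glued_l gR) Cx; rewrite supp_zeroat => cC.
case xc: (x \in supp c).
  by exists c; rewrite // -(setD1K xc) cC setD1K.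
have cS : supp c = C :\ x by rewrite -cC; apply/esym/setDidPl; rewrite disjoint_sym disjoints1 xc.
have Py : punct y R (zeroat y c) by exists c.
have sub0 Y : Y \in ZZ -> Y \subset C :\ x -> Y = set0.
  move=> Yi YS; apply: (circ_sub0 Cc Yi _ xC); first by apply: subset_trans YS (subsetDl _ _).
  by apply/negP=> /(subsetP YS); rewrite !inE eqxx.
have lift a : a \in C -> a != x -> a != y ->
    exists Z, [/\ Z \in ZZ, a \in Z, y \in Z & Z \subset y |: (C :\ x)].
  move=> aC ax ay; have ac : a \in supp (zeroat y c).
    by rewrite supp_zeroat cS !inE ay ax.
  have [Y [Yc aY YS]] := code_thru (glued_r gR) Py ac.
  have /conP[Z Zi eqY] := circ_in Yc.
  have aZ : a \in Z by move: aY; rewrite eqY inE => /andP[].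
  have ZS : Z \subset y |: (C :\ x).
    rewrite -subDset -eqY; apply: subset_trans YS _.
    by rewrite supp_zeroat cS subsetDl.
  exists Z; split=> //; apply/negPn/negP=> yZ.
  suff Z0 : Z = set0 by rewrite Z0 inE in aZ.
  apply: sub0 => //; apply/subsetP=> g gZ; have := subsetP ZS g gZ; rewrite in_setU1.
  by case: eqP => // gy; rewrite -gy gZ in yZ.
have [a aC axy] : exists2 a, a \in C & a \notin [set x; y].
  by apply/subsetPn; apply: pair_notin => //; apply: circ_neq0 Cc.
move: axy; rewrite !inE negb_or => /andP[ax ay].
have [Z [Zi aZ yZ ZS]] := lift a aC ax ay.
have ZE : Z = y |: (C :\ x).
  apply/eqP; rewrite eqEsubset ZS subUset sub1set yZ; apply/subsetP=> g.
  rewrite in_setD1 => /andP[gx gC]; case: (eqVneq g y) => [->//|gy].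
  have [Z' [Zi' gZ' yZ' ZS']] := lift g gC gx gy.
  suff : sdiff Z Z' = set0 by move/eqP; rewrite sdiff_eq0 => /eqP->.
  apply: sub0; first exact: ZD.
  apply/subsetP=> h; rewrite in_sdiff => hS; have := subset_imp ZS h.
  have := subset_imp ZS' h; move: hS; rewrite in_setU1; case: (eqVneq h y) => [->|_].
    by rewrite yZ yZ'.
  by case: (h \in Z); case: (h \in Z').
have Si : sdiff C Z \in ZZ by apply: ZD.
have S0 : sdiff C Z != set0.
  by apply/set0Pn; exists x; rewrite in_sdiff xC ZE !inE; neqs.
have := pair_notin xy Si S0; case/negP; apply/subsetP=> g.
rewrite in_sdiff ZE !inE; case: (eqVneq g x) => //= _; case: (eqVneq g y) => //= _.
by rewrite addbb.
Qed.

End Glued.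

(* The only obstruction to gluing: two circuits through x and y, disjoint
   elsewhere, on which the glued code has different slopes at {x, y}. *)
Record clash R x y W1 W2 : Prop := Clash {
  clash1 : circ ZZ W1;
  clash2 : circ ZZ W2;
  clash_x1 : x \in W1; clash_y1 : y \in W1;
  clash_x2 : x \in W2; clash_y2 : y \in W2;
  clash_dis : forall e, e \in W1 -> e \in W2 -> e \in [set x; y];
  clash_circ : circ ZZ (sdiff W1 W2);
  clash_xy : forall Z, Z \in ZZ -> Z \subset W1 :|: W2 -> (x \in Z) = (y \in Z);
  clash_lam : exists c1 c2, [/\ R c1, R c2, supp c1 = W1, supp c2 = W2 &
    c1 x * c2 y != c2 x * c1 y]
}.

(** Here x is a chord of C: cancel x between the chains of the two circuits into which it cuts C. *)
Lemma glued_split R x y C Z : x != y -> glued R x y -> circ ZZ C -> x \notin C ->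
  Z \in ZZ -> x \in Z -> Z \subset x |: C -> exists2 c, R c & supp c = C.
Proof.
move=> xy gR Cc xC Zi xZ ZS.
have Zc := circ_ext crA Cc xC Zi xZ ZS.
have Zi' : sdiff Z C \in ZZ by apply: ZD => //; apply: circ_in.
have xZ' : x \in sdiff Z C by rewrite in_sdiff xZ (negPf xC).
have ZS' : sdiff Z C \subset x |: C by sets.
have Zc' := circ_ext crA Cc xC Zi' xZ' ZS'.
have [c Rc cZ] := glued_chain_l xy gR Zc xZ.
have [d Rd dZ] := glued_chain_l xy gR Zc' xZ'.
have dx : d x != 0 by rewrite -in_supp dZ.
have cx : c x != 0 by rewrite -in_supp cZ.
have t0 : - (c x / d x) != 0 by rewrite oppr_eq0 mulf_neq0 ?invr_eq0.
exists (c + sc (- (c x / d x)) d); first exact: (glued_comb gR).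
apply/setP=> g; rewrite in_supp addE scE; case: (eqVneq g x) => [->|gx].
  by rewrite mulNr divfK // subrr eqxx (negPf xC).
case gZ: (g \in Z); case gC: (g \in C).
- by rewrite (@suppN _ _ d g) ?dZ ?in_sdiff ?gZ ?gC // mulr0 addr0 -in_supp cZ gZ.
- by have := subsetP ZS g gZ; rewrite !inE (negPf gx) gC.
- rewrite (@suppN _ _ c g) ?cZ ?gZ // add0r mulf_eq0 (negPf t0) -in_supp dZ.
  by rewrite in_sdiff gZ gC.
rewrite (@suppN _ _ c g) ?cZ ?gZ // add0r mulf_eq0 (negPf t0) -in_supp dZ.
by rewrite in_sdiff gZ gC.
Qed.

Lemma glued_frep R x y : x != y -> glued R x y ->
  (forall W1 W2, ~ clash R x y W1 W2) -> frep F (dep ZZ).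
Proof.
move=> xy gR noclash; have gR' := glued_sym gR; have yx : y != x by rewrite eq_sym.
exists R; split; [exact: glued0 gR | exact: gluedD gR | exact: gluedZ gR | |].
  move=> C Cm; have Cc : circ ZZ C := Cm.
  case: (boolP (x \in C)) => [|xC]; first exact: (glued_chain_l xy gR).
  case: (boolP (y \in C)) => [|yC]; first exact: (glued_chain_l yx gR').
  case: (boolP [exists Z in ZZ, (x \in Z) && (Z \subset x |: C)]) => [|nox].
    by case/exists_inP=> Z Zi /andP[xZ ZS]; apply: (glued_split xy gR Cc xC Zi).
  case: (boolP [exists Z in ZZ, (y \in Z) && (Z \subset y |: C)]) => [|noy].
    by case/exists_inP=> Z Zi /andP[yZ ZS]; apply: (glued_split yx gR' Cc yC Zi).
  have inx Z : Z \in ZZ -> x \in Z -> ~~ (Z \subset x |: C).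
    by move=> Zi xZ; apply: contra nox => ZS; apply/exists_inP; exists Z; rewrite ?xZ.
  have iny Z : Z \in ZZ -> y \in Z -> ~~ (Z \subset y |: C).
    by move=> Zi yZ; apply: contra noy => ZS; apply/exists_inP; exists Z; rewrite ?yZ.
  pose L := [set x; y] :|: C.
  have both Z : Z \in ZZ -> Z \subset L -> (x \in Z) = (y \in Z).
    move=> Zi ZS; case xZ: (x \in Z); case yZ: (y \in Z) => //.
      case/negP: (inx Z Zi xZ); apply/subsetP=> g gZ; have := subsetP ZS g gZ; rewrite !inE.
      by case: (eqVneq g y) gZ => [->|]; rewrite ?yZ // orbF.
    case/negP: (iny Z Zi yZ); apply/subsetP=> g gZ; have := subsetP ZS g gZ; rewrite !inE.
    by case: (eqVneq g x) gZ => [->|]; rewrite ?xZ.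
  have LE Z : Z \subset L -> x \notin Z -> y \notin Z -> Z \subset C.
    move=> ZS xZ yZ; apply/subsetP=> g gZ; have := subsetP ZS g gZ; rewrite !inE.
    by case: (eqVneq g x) gZ => [->|_]; rewrite ?(negPf xZ) //; case: (eqVneq g y) => [->|]; rewrite ?(negPf yZ).
  have Cx : circ (con x ZZ) C by apply: circ_con_out.
  have [_ [c Rc ->]] := code_circ (glued_l gR) Cx; rewrite supp_zeroat => cC.
  case xc: (x \in supp c); last first.
    by exists c; rewrite // -cC; apply/esym/setDidPl; rewrite disjoint_sym disjoints1 xc.
  have cS : supp c = x |: C by rewrite -cC setD1K.
  have cy : zeroat y c = c by apply: zeroat_id; rewrite suppN // cS !inE; neqs.
  have Py : punct y R c by exists c; rewrite ?cy.
  (* The lift has support [x |: C]. Seen in the contraction of y it yields a cycle W containing x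
     and, by [both], also y. Then W and W + C are circuits that meet only in x and y, and equal
     slopes allow both points to be cancelled at once. *)
  have [Y [Yc xY YS]] := code_thru (glued_r gR) Py xc.
  have /conP[W Wi eqY] := circ_in Yc.
  have xW : x \in W by move: xY; rewrite eqY inE => /andP[].
  have WL : W \subset L.
    rewrite /L -setUA [[set y] :|: C]setUC setUA -cS setUC -subDset -eqY; exact: YS.
  have circW Z : Z \in ZZ -> Z \subset L -> x \in Z -> circ ZZ Z.
    move=> Zi ZL xZ; have yZ : y \in Z by rewrite -both.
    have CnZ : ~~ (C \subset Z).
      apply/negP=> CZ; have Si : sdiff Z C \in ZZ by apply: ZD => //; apply: circ_in.
      have S0 : sdiff Z C != set0 by apply/set0Pn; exists x; rewrite in_sdiff xZ (negPf xC).
      case/negP: (pair_notin xy Si S0).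
      apply/subsetP=> g; rewrite in_sdiff; have := subset_imp CZ g; have := subset_imp ZL g.
      by rewrite !inE; case: (g == x); case: (g == y); case: (g \in C); case: (g \in Z).
    have nil Y' : Y' \in ZZ -> Y' \subset Z -> x \notin Y' -> Y' = set0.
      move=> Yi YZ xY'; have YL := subset_trans YZ ZL.
      have YC : Y' \subset C by apply: LE; rewrite // -both.
      by apply/eqP; apply: contraNT CnZ => Y0; rewrite -(circ_min Cc Yi YC Y0).
    apply/circP; split=> //; first by apply/set0Pn; exists x.
    move=> Y' Yi Y0 YZ; case xY': (x \in Y'); last by rewrite (nil Y') ?xY' ?eqxx in Y0.
    apply/eqP; rewrite -sdiff_eq0; apply/eqP; apply: nil; first exact: ZD.
      by sets.
    by rewrite in_sdiff xY' xZ.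
  pose W' := sdiff W C.
  have Wi' : W' \in ZZ by apply: ZD => //; apply: circ_in.
  have WL' : W' \subset L by rewrite /W' /L; move: WL; rewrite /L => WL; sets.
  have xW' : x \in W' by rewrite in_sdiff xW (negPf xC).
  have Wc := circW W Wi WL xW; have Wc' := circW W' Wi' WL' xW'.
  have yW : y \in W by rewrite -both. have yW' : y \in W' by rewrite -both.
  have [c1 R1 s1] := glued_chain_l xy gR Wc xW.
  have [c2 R2 s2] := glued_chain_l xy gR Wc' xW'.
  have WWC : sdiff W W' = C by apply/setP=> g; rewrite !in_sdiff; case: (g \in W); case: (g \in C).
  have lam : c1 x * c2 y = c2 x * c1 y.
    apply/eqP/negPn/negP=> ne; apply: (noclash W W'); split=> //.
    - move=> e eW; rewrite in_sdiff eW addTb => eC; have := subsetP WL e eW.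
      by rewrite /L in_setU (negPf eC) orbF.
    - by rewrite WWC.
    - by move=> Z Zi ZS; apply: both => //; apply: subset_trans ZS _; rewrite subUset WL.
    by exists c1, c2.
  have x2 : c2 x != 0 by rewrite -in_supp s2.
  have x1 : c1 x != 0 by rewrite -in_supp s1.
  have t0 : - (c1 x / c2 x) != 0 by rewrite oppr_eq0 mulf_neq0 ?invr_eq0.
  exists (c1 + sc (- (c1 x / c2 x)) c2); first exact: (glued_comb gR).
  apply/setP=> g; rewrite in_supp addE scE; case: (eqVneq g x) => [->|gx].
    by rewrite mulNr divfK // subrr eqxx (negPf xC).
  case: (eqVneq g y) => [->|gy].
    by rewrite mulNr mulrAC lam mulrAC divff // mul1r subrr eqxx (negPf yC).
  have gL : g \in W -> g \in C by move/(subsetP WL); rewrite !inE (negPf gx) (negPf gy).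
  case gW: (g \in W).
    by rewrite (@suppN _ _ c2 g) ?s2 ?in_sdiff ?gW ?gL // mulr0 addr0 -in_supp s1 gW.
  rewrite (@suppN _ _ c1 g) ?s1 ?gW // add0r mulf_eq0 (negPf t0) -in_supp s2.
  by rewrite in_sdiff gW addFb.
move=> c Rc c0; have half u v : u != v -> glued R u v -> u \in supp c -> dep ZZ (supp c).
  move=> uv gu uc; have Pu : punct u R (zeroat u c) by exists c.
  have nz : supp (zeroat u c) != set0.
    apply: contraNneq c0; rewrite supp_zeroat => /eqP; rewrite setD_eq0 => cu.
    have -> : c = 0.
      apply: (glued_xy gu) => //; apply: subset_trans cu _.
      by rewrite sub1set !inE eqxx.
    by rewrite supp0.
  have := code_dep (glued_l gu) Pu nz.
  by rewrite con_dep ?(crit_nonloop crA) // supp_zeroat setD1K.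
case: (boolP (x \in supp c)) => [|xc]; first exact: half xy gR.
case: (boolP (y \in supp c)) => [|yc]; first exact: half yx gR'.
case: (boolP (dep ZZ (supp c))) => // nd.
(* Suppose that the support of c avoids x and y and is independent. Being a relation of the
   contraction of u forces it to become a cycle once u is added; for u = x and u = y this makes x
   and y parallel. *)
have full u v : u != v -> glued R u v -> u \notin supp c -> u |: supp c \in ZZ.
  move=> uv gu uc; have Pu : punct u R c by exists c; rewrite ?zeroat_id ?suppN.
  have lift a : a \in supp c -> exists Z, [/\ Z \in ZZ, a \in Z, u \in Z & Z \subset u |: supp c].
    move=> ac; have [Y [Yc aY YS]] := code_thru (glued_l gu) Pu ac.
    have /conP[Z Zi eqY] := circ_in Yc.
    have aZ : a \in Z by move: aY; rewrite eqY inE => /andP[].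
    have ZS : Z \subset u |: supp c by rewrite -subDset -eqY.
    exists Z; split=> //; apply: contraNT nd => uZ; apply/depP; exists Z; split=> //.
      by apply/set0Pn; exists a.
    apply/subsetP=> g gZ; have := subsetP ZS g gZ; rewrite in_setU1.
    by case: eqP => // gu'; rewrite -gu' gZ in uZ.
  have [a ac] := set0Pn _ c0; have [Z [Zi aZ uZ ZS]] := lift a ac.
  suff -> : u |: supp c = Z by [].
  apply/eqP; rewrite eqEsubset ZS andbT subUset sub1set uZ; apply/subsetP=> g gc.
  have [Z' [Zi' gZ' uZ' ZS']] := lift g gc.
  suff : sdiff Z Z' == set0 by rewrite sdiff_eq0 => /eqP->.
  apply: contraNT nd => S0; apply/depP; exists (sdiff Z Z'); split=> //; first exact: ZD.
  apply/subsetP=> h; rewrite in_sdiff => hS; have := subset_imp ZS h.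
  have := subset_imp ZS' h; move: hS; rewrite in_setU1; case: (eqVneq h u) => [->|_].
    by rewrite uZ uZ'.
  by case: (h \in Z); case: (h \in Z'); case: (h \in supp c).
have Si : sdiff (x |: supp c) (y |: supp c) \in ZZ.
  by apply: ZD; [exact: full xy gR xc | exact: full yx gR' yc].
have S0 : sdiff (x |: supp c) (y |: supp c) != set0.
  by apply/set0Pn; exists x; rewrite in_sdiff setU11 in_setU1 (negPf xy) (negPf xc).
case/negP: (pair_notin xy Si S0); apply/subsetP=> g.
by rewrite in_sdiff !in_setU1 !inE; case: (g == x); case: (g == y); rewrite //= addbb.
Qed.

End Glue.

(** * Contractions that stay connected *)

Section Connectivity.
Variable T : finType.
Implicit Types A B C D Y Z W : {set T}.
Implicit Types ZZ : {set {set T}}.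

(** Loops are left out because contracting an element turns its parallel elements into loops;
    connectivity is meant up to loops. *)
Definition ground ZZ : {set T} :=
  [set e | ([set e] \notin ZZ) && [exists Z in ZZ, e \in Z]].

Definition conn ZZ := forall e f, e \in ground ZZ -> f \in ground ZZ ->
  exists C, [/\ circ ZZ C, e \in C & f \in C].

Lemma groundP ZZ e : reflect ([set e] \notin ZZ /\ exists2 Z, Z \in ZZ & e \in Z) (e \in ground ZZ).
Proof.
rewrite inE; apply: (iffP andP) => -[n0].
  by case/exists_inP=> Z Zi eZ; split=> //; exists Z.
by case=> Z Zi eZ; split=> //; apply/exists_inP; exists Z.
Qed.

Lemma circ_ground ZZ C e f : circ ZZ C -> e \in C -> f \in C -> e != f -> e \in ground ZZ.
Proof.
move=> Cc eC fC ef; apply/groundP; split; last by exists C => //; apply: circ_in.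
apply/negP=> ei; have := circ_min Cc ei; rewrite sub1set -card_gt0 cards1 => /(_ eC isT) eqC.
by move: fC; rewrite -eqC inE eq_sym (negPf ef).
Qed.

(* Contract the element whose contraction has the largest component. *)
Lemma conn_con ZZ : bspace ZZ -> conn ZZ -> ground ZZ != set0 ->
  exists2 x, x \in ground ZZ & conn (con x ZZ).
Proof.
move=> bZ cZ /set0Pn[x0 gx0].
pose comp x k := [set f in ground (con x ZZ) | [exists C, [&& circ (con x ZZ) C, k \in C & f \in C]]].
pose P (xk : T * T) := (xk.1 \in ground ZZ) && (xk.2 \in ground (con xk.1 ZZ)).
case: (pickP P) => [xk0 P0|noP]; last first.
  exists x0 => // e f ge; by have := noP (x0, e); rewrite /P /= gx0 ge.
pose m xk := #|comp xk.1 xk.2|.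
case: (arg_maxnP m P0) => -[x k] /andP[/= gx gk] max.
exists x => //.
have bx := bspace_con x bZ.
have x0' : [set x] \notin ZZ by case/groundP: gx.
suff all f : f \in ground (con x ZZ) -> f \in comp x k.
  move=> e f /all; rewrite inE => /andP[_ /existsP[C1 /and3P[c1 k1 e1]]].
  move/all; rewrite inE => /andP[_ /existsP[C2 /and3P[c2 k2 f2]]].
  have [|C [? ? ? _]] := circ_link bx c1 c2 e1 f2; last by exists C.
  by apply/set0Pn; exists k; rewrite inE k1.
(* Let y be outside this component. Then the whole component, together with x, lies in a single
   component of the contraction of y, against maximality. *)
move=> gy; apply/negPn/negP=> yN; set y := f in gy yN.
have [y0 [Zy Zyi yZ]] := groundP _ _ gy.
have yx : y != x by apply: contraTneq yZ => ->; apply: con_notin Zyi.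
have y1 : [set y] \notin ZZ by apply: contra y0 => yi; apply: con_inN; rewrite // inE eq_sym.
have gy1 : y \in ground ZZ.
  by apply/groundP; split=> //; case/conP: Zyi yZ => Z Zi ->; rewrite inE => /andP[_ yZ]; exists Z.
have by_ := bspace_con y bZ.
have xy0 : [set x] \notin con y ZZ.
  apply: contra y0 => /conP[Z Zi eqZ].
  have xZ : x \in Z by have := set11 x; rewrite eqZ inE => /andP[].
  have yZ' : y \in Z.
    apply: contraNT x0' => yZ'; rewrite eqZ; suff -> : Z :\ y = Z by [].
    by apply/setDidPl; rewrite disjoint_sym disjoints1.
  suff -> : [set y] = Z :\ x by apply: con_in.
  apply/setP=> g; rewrite !inE; move/setP/(_ g): eqZ; rewrite !inE.
  case: (eqVneq g y) => [->|gy']; first by rewrite yx yZ'.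
  by case: (eqVneq g x) => //= _ <-.
(* A circuit D of [ZZ] through g and x avoids y and does not span it, as otherwise y would be linked
   to D minus x in the contraction of x, hence to k. So D survives the contraction of y. *)
have key g : g \in comp x k -> exists D, [/\ circ (con y ZZ) D, x \in D & g \in D].
  move=> gC; move: (gC); rewrite inE => /andP[gg /existsP[C1 /and3P[c1 k1 g1]]].
  have [g0 [Zg Zgi gZ]] := groundP _ _ gg.
  have gx' : g != x by apply: contraTneq gZ => ->; apply: con_notin Zgi.
  have ggZ : g \in ground ZZ.
    apply/groundP; split; first by apply: contra g0 => gi; apply: con_inN; rewrite // inE eq_sym.
    by case/conP: Zgi gZ => Z Zi ->; rewrite inE => /andP[_ gZ]; exists Z.
  have [D [Dc gD xD]] := cZ g x ggZ gx.
  have Dx : circ (con x ZZ) (D :\ x).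
    apply: circ_con_in => //; apply: contraTneq gD => ->; by rewrite inE.
  have link h : h \in D -> h != x -> exists C, [/\ circ (con x ZZ) C, k \in C & h \in C].
    move=> hD hx; have gDx : g \in D :\ x by rewrite !inE gx'.
    have hDx : h \in D :\ x by rewrite !inE hx.
    have [|C [? ? ? _]] := circ_link bx c1 Dx k1 hDx; last by exists C.
    by apply/set0Pn; exists g; rewrite inE g1.
  have notlink C h : circ (con x ZZ) C -> y \in C -> h \in C -> h \in D -> h != x -> False.
    move=> Cc yC hC hD hx; have [C2 [c2 k2 h2]] := link h hD hx.
    case/negP: yN; rewrite inE gy; apply/existsP.
    have [|C' [? ? ? _]] := circ_link bx c2 Cc k2 yC; last by exists C'; apply/and3P.
    by apply/set0Pn; exists h; rewrite inE h2.
  have yD : y \notin D.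
    apply/negP=> yD; apply: (notlink (D :\ x) g); rewrite ?inE ?gx' ?yx //.
  exists D; split=> //; apply: circ_con_out => // Z Zi yZ'; apply/negP=> ZS.
  have yZx : y \in Z :\ x by rewrite !inE yx.
  have [V [Vc yV VS]] := circ_thru bx (con_in x Zi) yZx.
  have [h hV hy] : exists2 h, h \in V & h != y.
    have: ~~ (V \subset [set y]).
      apply: contra y0 => Vy; suff <- : V = [set y] by apply: circ_in.
      by apply/eqP; rewrite eqEsubset Vy sub1set.
    by case/subsetPn=> h hV; rewrite inE => hy; exists h.
  have := subsetP VS h hV; rewrite !inE => /andP[hx hZ].
  have := subsetP ZS h hZ; rewrite !inE (negPf hy) /= => hD.
  exact: (notlink V h).
have gxy : x \in ground (con y ZZ).
  have kC : k \in comp x k.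
    rewrite inE gk; have [k0 [Zk Zki kZ]] := groundP _ _ gk.
    have [C [Cc kC _]] := circ_thru bx Zki kZ.
    by apply/existsP; exists C; rewrite Cc kC.
  have [D [Dc xD kD]] := key k kC.
  by apply/groundP; split=> //; exists D => //; apply: circ_in.
have sub : x |: comp x k \subset comp y x.
  apply/subsetP=> g; rewrite in_setU1 => /orP[/eqP->|gC].
    rewrite inE gxy; have [_ [Zx Zxi xZ]] := groundP _ _ gxy.
    have [C [Cc xC _]] := circ_thru by_ Zxi xZ.
    by apply/existsP; exists C; rewrite Cc xC.
  have [D [Dc xD gD]] := key g gC; rewrite inE; apply/andP; split.
    apply: (circ_ground Dc gD xD); move: gC; rewrite inE => /andP[/groundP[_ [Z Zi gZ]] _].
    by apply: contraTneq gZ => ->; apply: con_notin Zi.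
  by apply/existsP; exists D; apply/and3P.
have xN : x \notin comp x k.
  rewrite inE negb_and; apply/orP; left; apply/negP=> /groundP[_ [Z Zi xZ]].
  by have := con_notin Zi; rewrite xZ.
have := max (y, x); rewrite /P /= gy1 gxy => /(_ isT); rewrite /m /=.
have := subset_leq_card sub; rewrite cardsU1 xN add1n => lt /(leq_trans lt).
by rewrite ltnn.
Qed.

End Connectivity.

(** * Consequences of a clash of slopes *)

Section Clash.
Variables (T : finType) (F : fieldType) (A : {set T}) (ZZ : {set {set T}}).
Implicit Types B C D Y Z W : {set T}.
Implicit Types c : {ffun T -> F}.
Hypothesis crA : critical F A ZZ.
Let bZ := crit_bspace crA.
Let ZD := bZ.2.
Variables (R : {ffun T -> F} -> Prop) (x y : T).
Hypotheses (xy : x != y) (gR : glued ZZ R x y).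

(* A representation of ZZ / e gives d1 and d2 the same slope; it agrees with R on
   ZZ / e / x and on ZZ / e / y up to scaling, and the circuit G ties these
   scalings together on D1 and D2. *)
Lemma slope_link e D1 D2 d1 d2 : e \in A -> e != x -> e != y ->
    (forall Z, Z \in ZZ -> e \in Z -> ~~ (Z \subset [set x; y; e])) ->
    circ (con e ZZ) D1 -> circ (con e ZZ) D2 ->
    x \in D1 -> y \in D1 -> x \in D2 -> y \in D2 ->
    (forall Y, Y \in con e ZZ -> Y \subset D1 :|: D2 -> (x \in Y) = (y \in Y)) ->
    punct e R d1 -> punct e R d2 -> supp d1 = D1 -> supp d2 = D2 ->
    (exists G f1 f2, [/\ circ (con e (con x (con y ZZ))) G,
       f1 \in G, f1 \in D1, f2 \in G & f2 \in D2]) ->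
  d1 x * d2 y = d2 x * d1 y.
Proof.
move=> eA ex ey offe c1 c2 x1 y1 x2 y2 both Rd1 Rd2 s1 s2 [G [f1 [f2 [Gc f1G f1D f2G f2D]]]].
have [Re rRe] := crit_con crA eA (crit_nonloop crA e).
have be : bspace (con e ZZ) by apply: bspace_con.
have loop2 u : u != e -> [set u] \notin con e ZZ.
  move=> ue; apply: contra (nodep_pair crA ue) => /conP[Z Zi eqZ]; apply/depP; exists Z.
  have uZ : u \in Z by have := set11 u; rewrite eqZ inE => /andP[].
  split=> //; first by apply/set0Pn; exists u.
  apply/subsetP=> g gZ; rewrite !inE; case: (eqVneq g e) => [_|ge]; rewrite ?orbT //.
  by rewrite -in_set1 eqZ !inE ge gZ.
have [xe ye] : x != e /\ y != e by rewrite ![_ == e]eq_sym.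
have loopx := loop2 x xe; have loopy := loop2 y ye.
have loop2' u : u != e -> [set e] \notin con u ZZ.
  move=> ue; apply: contra (nodep_pair crA ue) => /conP[Z Zi eqZ]; apply/depP; exists Z.
  have uZ : e \in Z by have := set11 e; rewrite eqZ inE => /andP[].
  split=> //; first by apply/set0Pn; exists e.
  apply/subsetP=> g gZ; rewrite !inE; case: (eqVneq g u) => [//|gu].
  by rewrite -in_set1 eqZ !inE gu gZ.
have loop3 u v : [set u; v] = [set x; y] -> u != v -> [set v] \notin con u (con e ZZ).
  move=> uv nuv; apply/negP=> /conP[Y /conP[Z Zi ->] eqZ].
  have vZ : v \in Z by have := set11 v; rewrite eqZ !inE => /and3P[].
  have ZS : Z \subset [set x; y; e].
    apply/subsetP=> g gZ; rewrite -uv !inE; case: (eqVneq g u) => // gu.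
    case: (eqVneq g e) => [_|ge]; rewrite ?orbT // orbF /=.
    by rewrite -in_set1 eqZ !inE gu ge gZ.
  case eZ: (e \in Z); first by have := offe Z Zi eZ; rewrite ZS.
  case/negP: (nodep_pair crA xy); apply/depP; exists Z; split=> //.
    by apply/set0Pn; exists v.
  apply/subsetP=> g gZ; have := subsetP ZS g gZ; rewrite in_setU in_set1.
  by case: eqP => [gE|_]; [rewrite -gE gZ in eZ | rewrite orbF].
have yx : y != x by rewrite eq_sym.
have loopxy := loop3 x y erefl xy.
have pswap u c : punct u (punct e R) c <-> punct e (punct u R) c.
  by split=> -[_ [d Rd ->] ->]; eexists; rewrite 1?zeroatC //; eexists; rewrite ?Rd //; exact: Rd.
have rx : code_for (punct x (punct e R)) (dep (con x (con e ZZ))).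
  rewrite conC; apply: code_for_iff (code_con (bspace_con x bZ) (loop2' x xe) (glued_l gR)).
  by move=> c; split=> /pswap.
have ry : code_for (punct y (punct e R)) (dep (con y (con e ZZ))).
  rewrite conC; apply: code_for_iff (code_con (bspace_con y bZ) (loop2' y ye) (glued_r gR)).
  by move=> c; split=> /pswap.
have rex := code_con be loopx rRe; have rey := code_con be loopy rRe.
have bxe := bspace_con x be; have bye := bspace_con y be.
have [sx sx0 Hx] := code_unique bxe rx rex.
have [sy sy0 Hy] := code_unique bye ry rey.
have [h1 Rh1 hD1] := code_circ rRe c1; have [h2 Rh2 hD2] := code_circ rRe c2.
have nset u D : u \in D -> [set x; y] \subset D -> u \in [set x; y] -> D != [set u].
  move=> uD /subsetP xyD uxy; apply/eqP=> eqD.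
  have xD := xyD x; have yD := xyD y; rewrite eqD !inE !eqxx orbT in xD yD.
  by case/negP: xy; rewrite (eqP (xD isT)) (eqP (yD isT)).
have xyS D : x \in D -> y \in D -> [set x; y] \subset D.
  by move=> xD yD; rewrite subUset !sub1set xD.
have kx D d h : circ (con e ZZ) D -> x \in D -> y \in D -> punct e R d -> Re h ->
    supp d = D -> supp h = D -> exists k, forall f, f != x -> h f = k * (sx f * d f).
  move=> Dc xD yD Rd Rh dD hD.
  have Dx : circ (con x (con e ZZ)) (D :\ x).
    by apply: circ_con_in => //; apply: nset; rewrite ?xyS // !inE eqxx.
  have P1 : punct x (punct e R) (zeroat x d) by exists d.
  have P2 : punct x Re (zeroat x h) by exists h.
  have S1 : supp (rescale sx (zeroat x d)) = D :\ x by rewrite supp_rescale // supp_zeroat dD.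
  have S2 : supp (zeroat x h) \subset D :\ x by rewrite supp_zeroat hD.
  have [k ek] := code_circ_eq rex Dx (Hx _ P1) P2 S1 S2.
  exists k => f fx; move/ffunP/(_ f): ek; rewrite zeroatE scE rescaleE zeroatE.
  by rewrite (negPf fx).
have ky D d h : circ (con e ZZ) D -> x \in D -> y \in D -> punct e R d -> Re h ->
    supp d = D -> supp h = D -> exists k, forall f, f != y -> h f = k * (sy f * d f).
  move=> Dc xD yD Rd Rh dD hD.
  have Dx : circ (con y (con e ZZ)) (D :\ y).
    by apply: circ_con_in => //; apply: nset; rewrite ?xyS // !inE eqxx orbT.
  have P1 : punct y (punct e R) (zeroat y d) by exists d.
  have P2 : punct y Re (zeroat y h) by exists h.
  have S1 : supp (rescale sy (zeroat y d)) = D :\ y by rewrite supp_rescale // supp_zeroat dD.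
  have S2 : supp (zeroat y h) \subset D :\ y by rewrite supp_zeroat hD.
  have [k ek] := code_circ_eq rey Dx (Hy _ P1) P2 S1 S2.
  exists k => f fy; move/ffunP/(_ f): ek; rewrite zeroatE scE rescaleE zeroatE.
  by rewrite (negPf fy).
have [k1 K1] := kx D1 d1 h1 c1 x1 y1 Rd1 Rh1 s1 hD1.
have [k2 K2] := kx D2 d2 h2 c2 x2 y2 Rd2 Rh2 s2 hD2.
have [l1 L1] := ky D1 d1 h1 c1 x1 y1 Rd1 Rh1 s1 hD1.
have [l2 L2] := ky D2 d2 h2 c2 x2 y2 Rd2 Rh2 s2 hD2.
(* On the circuit G of the contraction of e, x and y, the two scalings differ by a constant factor
   t. *)
have [t [t0 Ht]] : exists t, t != 0 /\ {in G, forall f, sy f = t * sx f}.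
  have Gc' : circ (con y (con x (con e ZZ))) G.
    by rewrite (conC y x) (conC y e) (conC x e).
  have rxy := code_con bxe loopxy rx; have rexy := code_con bxe loopxy rex.
  have [_ [_ [g Rg ->] ->]] := code_circ rxy Gc'; set g0 := zeroat y _ => gG.
  have Q1 : punct y (punct x Re) (rescale sx g0).
    have [r Rr er] := Hx (zeroat x g) (ex_intro2 _ _ g Rg erefl).
    exists (zeroat x r); first by exists r.
    rewrite -er; apply/ffunP=> f; rewrite /g0 !(rescaleE, zeroatE).
    by case: (f == y); rewrite ?mulr0.
  have Q2 : punct y (punct x Re) (rescale sy g0).
    have [r Rr er] := Hy (zeroat y g) (ex_intro2 _ _ g Rg erefl).
    exists (zeroat x r); first by exists r.
    rewrite zeroatC -er; apply/ffunP=> f; rewrite /g0 !(rescaleE, zeroatE).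
    by case: (f == y); case: (f == x); rewrite ?mulr0.
  have S1 : supp (rescale sx g0) = G by rewrite supp_rescale.
  have S2 : supp (rescale sy g0) \subset G by rewrite supp_rescale // gG.
  have [t et] := code_circ_eq rexy Gc' Q1 Q2 S1 S2.
  have Ht : {in G, forall f, sy f = t * sx f}.
    move=> f fG; move/ffunP/(_ f): et; rewrite scE !rescaleE mulrA.
    by apply: mulIf; rewrite -in_supp gG.
  exists t; split=> //; have := sy0 f1; rewrite Ht // mulf_eq0 negb_or => /andP[] //.
have nxy f : f \in G -> f != x /\ f != y.
  move=> fG; split; apply: contraTneq fG => ->.
    by apply: con_notin (_ : G \in con x (con e (con y ZZ))); rewrite conC; apply: circ_in.
  apply: con_notin (_ : G \in con y (con x (con e ZZ))).
  by rewrite (conC y x) (conC y e) (conC x e); apply: circ_in.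
have kl D d h k l f : f \in D -> f \in G -> supp h = D -> 
    (forall f, f != x -> h f = k * (sx f * d f)) ->
    (forall f, f != y -> h f = l * (sy f * d f)) -> k = l * t.
  move=> fD fG hD Kh Lh; have [fx fy] := nxy f fG.
  have hf : h f != 0 by rewrite -in_supp hD.
  have e1 := Kh f fx; have e2 := Lh f fy.
  have dsf : sx f * d f != 0 by apply: contraNneq hf => z; rewrite e1 z mulr0.
  by apply: (mulIf dsf); rewrite -e1 e2 Ht //; ring.
have kl1 := kl D1 d1 h1 k1 l1 f1 f1D f1G hD1 K1 L1.
have kl2 := kl D2 d2 h2 k2 l2 f2 f2D f2G hD2 K2 L2.
(* A combination of h1 and h2 that vanishes at x also vanishes at y, since by [both] a cycle inside
   D1 and D2 contains both points or neither. *)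
have hh : h1 x * h2 y = h2 x * h1 y.
  apply/eqP; rewrite -subr_eq0; apply/negPn/negP=> w0.
  pose w := sc (h1 x) h2 + sc (- h2 x) h1.
  have Rw : Re w by apply: (code_comb rRe) => //; apply: (codeZ rRe).
  have yw : y \in supp w.
    by rewrite in_supp /w addE !scE mulNr.
  have [Y [Yc yY YS]] := code_thru rRe Rw yw.
  have wS : supp w \subset D1 :|: D2.
    apply: supp_sub => g; rewrite in_setU negb_or => /andP[g1 g2].
    by rewrite addE !scE (@suppN _ _ h1 g) ?hD1 // (@suppN _ _ h2 g) ?hD2 // !mulr0 addr0.
  have := both Y (circ_in Yc) (subset_trans YS wS); rewrite yY => xY.
  have := subsetP YS x xY; rewrite in_supp addE !scE.
  by rewrite mulNr mulrC subrr eqxx.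
have hx1 : h1 x != 0 by rewrite -in_supp hD1.
have hx2 : h2 x != 0 by rewrite -in_supp hD2.
have := L1 x xy; have := L2 x xy; have := K1 y yx; have := K2 y yx.
move=> e2 e1 e4 e3.
have l10 : l1 != 0 by apply: contraNneq hx1 => z; rewrite e3 z mul0r.
have l20 : l2 != 0 by apply: contraNneq hx2 => z; rewrite e4 z mul0r.
apply: (mulfI l10); apply: (mulfI l20); apply: (mulfI t0).
apply: (mulfI (sx0 y)); apply: (mulfI (sy0 x)).
have -> : sy x * (sx y * (t * (l2 * (l1 * (d1 x * d2 y))))) =
    (l1 * (sy x * d1 x)) * (l2 * t * (sx y * d2 y)) by ring.
by rewrite -kl2 -e2 -e3 hh e1 e4 kl1; ring.
Qed.

End Clash.

(* The dual Fano plane on the basis x, y, z1, z2, with p1 = x + y + z1,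
   p2 = x + y + z2 and q = x + z1 + z2. *)
Definition f7star (T : finType) (A : {set T}) ZZ x y z1 z2 p1 p2 q :=
  [/\ uniq [:: x; y; z1; z2; p1; p2; q], ~~ dep ZZ [set x; y; z1; z2],
    [/\ [set x; y; z1; p1] \in ZZ, [set x; y; z2; p2] \in ZZ & [set x; z1; z2; q] \in ZZ] &
    forall e, e \in A -> e \notin [set x; y; z1; z2] -> dep ZZ (e |: [set x; y; z1; z2])].

Section ClashConfig.
Variables (T : finType) (F : fieldType) (A : {set T}) (ZZ : {set {set T}}).
Implicit Types B C D E G Y Z W : {set T}.
Hypothesis crA : critical F A ZZ.
Let bZ := crit_bspace crA.
Let ZD := bZ.2.
Variables (R : {ffun T -> F} -> Prop) (x y : T).
Hypotheses (xy : x != y) (gR : glued ZZ R x y).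
Hypothesis tf : forall a b c, a != b -> a != c -> b != c -> [set a; b; c] \notin ZZ.
Let KK := con x (con y ZZ).
Hypothesis cn : conn KK.

Lemma sub3_notin a b c Z : a != b -> a != c -> b != c -> Z \in ZZ -> Z != set0 ->
  ~~ (Z \subset [set a; b; c]).
Proof.
move=> ab ac bc Zi Z0; apply/negP=> ZS.
have [aZ|aZ] := boolP (a \in Z); last first.
  apply: (negP (pair_notin crA bc Zi Z0)); apply/subsetP=> g gZ.
  have := subsetP ZS g gZ; rewrite !inE.
  by case: (eqVneq g a) aZ => [<-|//]; rewrite gZ.
have [bZ'|bZ'] := boolP (b \in Z); last first.
  apply: (negP (pair_notin crA ac Zi Z0)); apply/subsetP=> g gZ.
  have := subsetP ZS g gZ; rewrite !inE.
  by case: (eqVneq g b) bZ' => [<-|]; rewrite ?gZ ?orbF.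
have [cZ|cZ] := boolP (c \in Z); last first.
  apply: (negP (pair_notin crA ab Zi Z0)); apply/subsetP=> g gZ.
  have := subsetP ZS g gZ; rewrite !inE.
  by case: (eqVneq g c) cZ => [<-|]; rewrite ?gZ ?orbF.
have := tf ab ac bc; suff <- : Z = [set a; b; c] by rewrite Zi.
by apply/eqP; rewrite eqEsubset ZS !subUset !sub1set aZ bZ' cZ.
Qed.

Lemma KP Y : reflect (exists2 Z, Z \in ZZ & Y = Z :\ y :\ x) (Y \in KK).
Proof.
apply: (iffP (conP _ _ _)) => [[_ /conP[Z Zi ->] ->]|[Z Zi ->]]; first by exists Z.
by exists (Z :\ y) => //; apply: con_in.
Qed.

Lemma K_bspace : bspace KK.
Proof. by apply: bspace_con; apply: bspace_con. Qed.

Lemma K_neq Y e : Y \in KK -> e \in Y -> [/\ e != x, e != y & e \in A].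
Proof.
case/KP=> Z Zi ->; rewrite !inE => /and3P[ex ey eZ]; split=> //.
exact: subsetP (crit_sub crA Zi) e eZ.
Qed.

Lemma off_xy e Z : e != x -> e != y -> Z \in ZZ -> e \in Z -> ~~ (Z \subset [set x; y; e]).
Proof.
move=> ex ey Zi eZ; apply: sub3_notin => //; last by apply/set0Pn; exists e.
  by rewrite eq_sym.
by rewrite eq_sym.
Qed.

Lemma K_nonloop e : e != x -> e != y -> [set e] \notin KK.
Proof.
move=> ex ey; apply/negP=> /KP[Z Zi eqZ].
have eZ : e \in Z by have := set11 e; rewrite eqZ !inE => /and3P[].
apply: (negP (off_xy ex ey Zi eZ)); apply/subsetP=> g gZ; rewrite !inE.
case: (eqVneq g x) => //= gx; case: (eqVneq g y) => //= gy.
by rewrite -in_set1 eqZ !inE gx gy.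
Qed.

Lemma K_ground e : e \in A -> e != x -> e != y -> e \in ground KK.
Proof.
move=> eA ex ey; apply/groundP; split; first exact: K_nonloop.
have [C Cc eC] := crit_cover crA eA; exists (C :\ y :\ x); last by rewrite !inE ex ey.
by apply/KP; exists C => //; apply: circ_in.
Qed.

Section Fixed.
Variables W1 W2 : {set T}.
Hypothesis cl : clash ZZ R x y W1 W2.
Let W := W1 :|: W2.
Let P := sdiff W1 W2.

Lemma inP e : (e \in P) = [&& e \in W, e != x & e != y].
Proof.
have [_ _ x1 y1 x2 y2 dis _ _ _] := cl; rewrite !inE.
case: (eqVneq e x) => [->|ex]; first by rewrite x1 x2.
case: (eqVneq e y) => [->|ey]; first by rewrite y1 y2.
case e1: (e \in W1); case e2: (e \in W2) => //.
by have := dis e e1 e2; rewrite !inE (negPf ex) (negPf ey).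
Qed.

(** After adding W1 if necessary, the cycle avoids x, hence y by [clash_xy], and so lies inside the
    circuit P. *)
Lemma W_cycles Z : Z \in ZZ -> Z \subset W -> [\/ Z = set0, Z = W1, Z = W2 | Z = P].
Proof.
have [c1 c2 x1 y1 x2 y2 dis cP cxy _] := cl.
suff H Y : Y \in ZZ -> Y \subset W -> x \notin Y -> Y = set0 \/ Y = P.
  move=> Zi ZW; case xZ: (x \in Z); last first.
    by case: (H Z) => // [|->|->]; rewrite ?xZ; [| constructor 1 | constructor 4].
  case: (H (sdiff Z W1)).
  - by apply: ZD => //; apply: circ_in.
  - by apply: imp_subset => g; have := subset_imp ZW g; rewrite !inE; case: (g \in Z); case: (g \in W1).
  - by rewrite in_sdiff xZ x1.
  - by move/eqP; rewrite sdiff_eq0 => /eqP->; constructor 2.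
  move=> e; constructor 3; apply: imp_set_eq => g; move/setP/(_ g): e; rewrite !inE.
  by case: (g \in Z); case: (g \in W1); case: (g \in W2).
move=> Yi YW xY; have yY : y \notin Y by rewrite -(cxy Y).
case: (eqVneq Y set0) => [|Y0]; [by left | right]; apply: circ_min cP Yi _ Y0.
apply/subsetP=> g gY; rewrite inP (subsetP YW g gY) /=.
by apply/andP; split; apply: contraTneq gY => ->.
Qed.

Lemma K_cycles Y : Y \in KK -> Y \subset P ->
  [\/ Y = set0, Y = W1 :\ y :\ x, Y = W2 :\ y :\ x | Y = P].
Proof.
case/KP=> Z Zi -> ZP; have ZW : Z \subset W.
  apply/subsetP=> g gZ; have [_ _ x1 y1 _ _ _ _ _ _] := cl.
  case: (eqVneq g x) => [->|gx]; first by rewrite inE x1.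
  case: (eqVneq g y) => [->|gy]; first by rewrite inE y1.
  by have := subsetP ZP g; rewrite !in_setD1 gx gy gZ inP => /(_ isT)/and3P[].
have [->|->|->|->] := W_cycles Zi ZW.
- by constructor 1; rewrite !set0D.
- by constructor 2.
- by constructor 3.
- constructor 4; apply/setP=> g; rewrite !in_setD1 inP.
  by case: (g == x); case: (g == y); rewrite /= ?andbF ?andbT.
Qed.

Lemma K_part Y f : Y \in KK -> Y \subset P -> f \in Y -> f \in W1 -> W1 :\ y :\ x \subset Y.
Proof.
move=> Yi YP fY f1; have [fx fy _] := K_neq Yi fY.
have f2 : f \notin W2.
  have [_ _ _ _ _ _ dis _ _ _] := cl; apply/negP=> f2.
  by have := dis f f1 f2; rewrite !inE (negPf fx) (negPf fy).
have [eqY|->|eqY|->] := K_cycles Yi YP.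
- by rewrite eqY inE in fY.
- by [].
- by rewrite eqY !inE (negPf f2) !andbF in fY.
apply/subsetP=> g; rewrite inP !inE => /and3P[-> -> ->]; exact: isT.
Qed.

Lemma K_W1 : W1 :\ y :\ x \in KK.
Proof. by apply/KP; exists W1 => //; apply: circ_in; case: cl. Qed.

Lemma W1_other a : exists f, [/\ f \in W1, f != x, f != y & f != a].
Proof.
have [c1 c2 x1 y1 x2 y2 dis cP cxy _] := cl; apply: NNPP => no.
have sub : W1 \subset [set x; y; a].
  apply/subsetP=> g gW; rewrite !inE; apply/negPn/negP; rewrite !negb_or => /andP[/andP[? ?] ?].
  by apply: no; exists g.
case: (eqVneq a x) => [ax|ax].
  apply: (negP (pair_notin crA xy (circ_in c1) (circ_neq0 c1))).
  by apply: subset_trans sub _; rewrite ax !subUset !sub1set !inE !eqxx orbT.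
case: (eqVneq a y) => [ay|ay].
  apply: (negP (pair_notin crA xy (circ_in c1) (circ_neq0 c1))).
  by apply: subset_trans sub _; rewrite ay !subUset !sub1set !inE !eqxx orbT.
by apply: (negP (sub3_notin _ _ _ (circ_in c1) (circ_neq0 c1)) sub); rewrite // eq_sym.
Qed.

(** Contracting an e that P does not span in [KK] preserves the circuits W1 and W2, and G links
    them; so [slope_link] contradicts the clash. *)
Lemma off_closure e G f1 f2 : e \in A -> e != x -> e != y ->
    (forall Y, Y \in KK -> e \in Y -> ~~ (Y \subset e |: P)) ->
    circ (con e KK) G -> f1 \in G -> f1 \in W1 -> f2 \in G -> f2 \in W2 -> False.
Proof.
move=> eA ex ey off Gc f1G f1W f2G f2W.
have [c1 c2 x1 y1 x2 y2 dis cP cxy [d1 [d2 [Rd1 Rd2 s1 s2 /eqP[]]]]] := cl.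
have offW Z : Z \in ZZ -> e \in Z -> ~~ (Z \subset e |: W).
  move=> Zi eZ; have ZK : Z :\ y :\ x \in KK by apply/KP; exists Z.
  have eK : e \in Z :\ y :\ x by rewrite !inE ex ey.
  apply: contra (off _ ZK eK) => ZW; apply/subsetP=> g; rewrite !in_setD1 => /and3P[gx gy gZ].
  by have := subsetP ZW g gZ; rewrite !in_setU1 inP gx gy !andbT.
have eW : e \notin W.
  apply/negP=> eW; have eP : e \in P by rewrite inP eW ex ey.
  by have := offW P (circ_in cP) eP; case/negP; apply/subsetP=> g; rewrite inP in_setU1 => /and3P[->]; rewrite orbT.
have /norP[e1 e2] : ~~ ((e \in W1) || (e \in W2)) by rewrite -in_setU.
have sub1 : e |: W1 \subset e |: W by apply/setUS/subsetUl.
have sub2 : e |: W2 \subset e |: W by apply/setUS/subsetUr.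
apply: (slope_link crA xy gR eA ex ey (D1 := W1) (D2 := W2)) => //.
- by move=> Z; apply: off_xy.
- apply: circ_con_out => // Z Zi eZ; apply: contra (offW Z Zi eZ) => /subset_trans; exact.
- apply: circ_con_out => // Z Zi eZ; apply: contra (offW Z Zi eZ) => /subset_trans; exact.
- move=> _ /conP[Z Zi ->] ZS; rewrite !in_setD1 ![_ == e]eq_sym ex ey /=.
  apply: cxy => //; case eZ: (e \in Z).
    by have := offW Z Zi eZ; rewrite -subDset ZS.
  apply: subset_trans ZS; apply/subsetP=> g gZ; rewrite !inE gZ andbT.
  by apply: contraFneq eZ => <-.
- exists d1 => //; apply/ffunP=> g; rewrite zeroatE.
  by case: (eqVneq g e) => [->|//]; rewrite suppN // s1.
- exists d2 => //; apply/ffunP=> g; rewrite zeroatE.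
  by case: (eqVneq g e) => [->|//]; rewrite suppN // s2.
- by exists G, f1, f2.
Qed.

(** Contract e: W1 minus e and W2 are still circuits, and Y minus e links them through f and f2, so
    [slope_link] contradicts the clash. Thus a circuit Y of this kind that meets W2 has at most one
    element in W1. *)
Lemma off_part q Y e f f2 : q \in A -> q \notin W -> circ KK Y -> q \in Y -> Y \subset q |: P ->
  e \in Y -> f \in Y -> e \in W1 -> f \in W1 -> e != f -> f2 \in Y -> f2 \in W2 -> False.
Proof.
move=> qA qW Yc qY YS eY fY e1 f1 ef f2Y f2W.
have [c1 c2 x1 y1 x2 y2 dis cP cxy [d1 [d2 [Rd1 Rd2 s1 s2 /eqP[]]]]] := cl.
have [ex ey eA] := K_neq (circ_in Yc) eY; have [fx fy fA] := K_neq (circ_in Yc) fY.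
have [f2x f2y f2A] := K_neq (circ_in Yc) f2Y.
have only1 g : g \in W1 -> g != x -> g != y -> g \notin W2.
  move=> g1 gx gy; apply/negP=> g2; have := dis g g1 g2; rewrite !inE.
  by rewrite (negPf gx) (negPf gy).
have e2 := only1 e e1 ex ey.
have xe : x != e by rewrite eq_sym.
have ye : y != e by rewrite eq_sym.
have f2e : f2 != e by apply: contraNneq e2 => <-.
have eq1 : zeroat e d1 x * zeroat e d2 y = zeroat e d2 x * zeroat e d1 y.
  apply: (slope_link crA xy gR eA ex ey (D1 := W1 :\ e) (D2 := W2)) => //; rewrite ?in_setD1 ?xe ?ye //.
  - by move=> Z; apply: off_xy.
  - apply: circ_con_in => //; apply: contraTneq fY => eqW; move: f1; rewrite eqW inE => /eqP fe.
    by rewrite fe eqxx in ef.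
  - apply: circ_con_out => // Z Zi eZ; apply/negP=> ZS.
    have eW : e |: W2 \subset W by rewrite subUset sub1set in_setU e1 subsetUr.
    have := W_cycles Zi (subset_trans ZS eW).
    have fZ : f \notin Z.
      apply/negP=> /(subsetP ZS); rewrite in_setU1 (eq_sym f) (negPf ef) /=.
      by apply/negP; apply: only1.
    case=> eqZ; rewrite eqZ ?inE in eZ fZ.
    + by [].
    + by rewrite f1 in fZ.
    + by rewrite eZ in e2.
    + by rewrite f1 (negPf (only1 f f1 fx fy)) in fZ.
  - move=> _ /conP[Z Zi ->] ZS; rewrite !in_setD1 xe ye /=.
    apply: cxy => //; apply/subsetP=> g gZ; case: (eqVneq g e) => [->|ge]; first by rewrite inE e1.
    by have := subsetP ZS g; rewrite !inE ge gZ /=; apply.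
  - by exists d1.
  - by exists d2.
  - by rewrite supp_zeroat s1.
  - by rewrite supp_zeroat s2; apply/setDidPl; rewrite disjoint_sym disjoints1.
  - exists (Y :\ e), f, f2; split; rewrite ?in_setD1 ?f2e ?(eq_sym f) ?ef ?f1 //.
    apply: circ_con_in => //; apply: contraTneq qY => ->; rewrite inE.
    by apply: contraNneq qW => ->; rewrite inE e1.
by move: eq1; rewrite !zeroatE (negPf xe) (negPf ye).
Qed.

End Fixed.

Lemma clash_swap W1 W2 : clash ZZ R x y W1 W2 -> clash ZZ R x y W2 W1.
Proof.
case=> c1 c2 x1 y1 x2 y2 dis cP cxy [d1 [d2 [Rd1 Rd2 s1 s2 ne]]]; split=> //.
- by move=> e e2 e1; apply: dis.
- by rewrite sdiffC.
- by move=> Z Zi; rewrite setUC; apply: cxy.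
by exists d2, d1; split=> //; rewrite eq_sym.
Qed.

Lemma clash_one W1 W2 g : clash ZZ R x y W1 W2 -> g \in W1 -> g != x -> g != y -> g \notin W2.
Proof.
move=> cl g1 gx gy; apply/negP=> g2; have := clash_dis cl g1 g2; rewrite !inE.
by rewrite (negPf gx) (negPf gy).
Qed.

(** C has as few elements off W1 + W2 as a circuit of [KK] meeting both W1 and W2 can have. If Y
    avoids W2, adding Y to C removes e; a circuit of the sum through f2 either meets W1 and beats C,
    or is a proper part of C. *)
Lemma no_halfline W1 W2 C Y e f2 : clash ZZ R x y W1 W2 -> circ KK C ->
    (forall C' f1 f2, circ KK C' -> f1 \in C' -> f1 \in W1 -> f2 \in C' -> f2 \in W2 ->
      (#|C :\: sdiff W1 W2| <= #|C' :\: sdiff W1 W2|)%N) ->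
    f2 \in C -> f2 \in W2 -> e \in C -> e \notin sdiff W1 W2 ->
    Y \in KK -> e \in Y -> Y \subset e |: sdiff W1 W2 -> (forall g, g \in Y -> g \notin W2) -> False.
Proof.
move=> cl Cc min f2C f2W eC eP Yi eY YS Y2.
have SK : sdiff C Y \in KK by apply: K_bspace.2 => //; apply: circ_in.
have f2S : f2 \in sdiff C Y.
  by rewrite in_sdiff f2C; case f2Y: (f2 \in Y) => //; have := Y2 f2 f2Y; rewrite f2W.
have [C' [Cc' f2C' CS]] := circ_thru K_bspace SK f2S.
have eC' : e \notin C' by apply/negP=> /(subsetP CS); rewrite in_sdiff eC eY.
have [[f1 f1C f1W]|no] := classic (exists2 f1, f1 \in C' & f1 \in W1).
  have := min C' f1 f2 Cc' f1C f1W f2C' f2W; rewrite leqNgt => /negP; apply.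
  apply: proper_card; apply/properP; split; last by exists e; rewrite !in_setD ?eC ?eP // (negPf eC') andbF.
  apply/subsetP=> g; rewrite !in_setD => /andP[gP gC']; rewrite gP /=.
  have := subsetP CS g gC'; rewrite in_sdiff.
  case gY: (g \in Y); last by rewrite addbF.
  have := subsetP YS g gY; rewrite in_setU1 (negPf gP) orbF => /eqP ge.
  by rewrite ge (negPf eC') in gC'.
have C'C : C' \subset C.
  apply/subsetP=> g gC'; have := subsetP CS g gC'; rewrite in_sdiff.
  case gY: (g \in Y); last by rewrite addbF.
  have := subsetP YS g gY; rewrite in_setU1 => /orP[/eqP ge|]; first by rewrite -ge gC' in eC'.
  rewrite (inP cl) => /and3P[]; rewrite inE (negPf (Y2 g gY)) orbF => g1.
  by case: no; exists g.
by have := circ_sub0 Cc (circ_in Cc') C'C eC eC'; move: f2C' => /[swap] ->; rewrite inE.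
Qed.

(** A nonempty cycle of [KK] inside W1 + W2 contains all of W1 or all of W2 apart from x and y. As Y
    misses p1 and p2, it contains no such cycle, so all its nonempty parts in [KK] contain q. *)
Lemma q_circ W1 W2 Y q p1 p2 : clash ZZ R x y W1 W2 -> q \notin sdiff W1 W2 -> Y \in KK ->
  q \in Y -> Y \subset q |: sdiff W1 W2 ->
  p1 \in W1 -> p1 != x -> p1 != y -> p1 \notin Y ->
  p2 \in W2 -> p2 != x -> p2 != y -> p2 \notin Y -> circ KK Y.
Proof.
move=> cl qP Yi qY YS p11 p1x p1y p1Y p22 p2x p2y p2Y.
have aux V : V \in KK -> V \subset Y -> q \notin V -> V = set0.
  move=> Vi VY qV; apply/eqP; apply/set0Pn=> -[f fV].
  have VP : V \subset sdiff W1 W2.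
    apply/subsetP=> g gV; have := subsetP YS g (subsetP VY g gV); rewrite in_setU1.
    by case/orP=> // /eqP gq; rewrite -gq gV in qV.
  have := subsetP VP f fV; rewrite (inP cl) in_setU => /and3P[/orP[f1|f2] _ _].
    have := subsetP (K_part cl Vi VP fV f1) p1; rewrite !in_setD1 p1x p1y p11 => /(_ isT)/(subsetP VY).
    by rewrite (negPf p1Y).
  rewrite sdiffC in VP; have := subsetP (K_part (clash_swap cl) Vi VP fV f2) p2.
  rewrite !in_setD1 p2x p2y p22 => /(_ isT)/(subsetP VY).
  by rewrite (negPf p2Y).
apply/circP; split=> //; first by apply/set0Pn; exists q.
move=> V Vi V0 VY; case qV: (q \in V); last by rewrite (aux V) ?eqxx ?qV // in V0.
apply/esym/eqP; rewrite -sdiff_eq0; apply/eqP; apply: aux.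
- exact: K_bspace.2.
- by sets.
- by rewrite in_sdiff qV qY.
Qed.

(** A further element g of W1 would lie in Y together with z1, or in Y + W1 together with p1;
    [off_part] excludes both. *)
Lemma part_two W1 W2 Y q z1 p1 z2 p2 : clash ZZ R x y W1 W2 -> q \in A -> q \notin W1 :|: W2 ->
  Y \in KK -> q \in Y -> Y \subset q |: sdiff W1 W2 ->
  z1 \in Y -> z1 \in W1 -> z2 \in Y -> z2 \in W2 ->
  p1 \in W1 -> p1 != x -> p1 != y -> p1 \notin Y ->
  p2 \in W2 -> p2 != x -> p2 != y -> p2 \notin Y -> W1 = [set x; y; z1; p1].
Proof.
move=> cl qA qW Yi qY YS z1Y z11 z2Y z22 p11 p1x p1y p1Y p22 p2x p2y p2Y.
have qP : q \notin sdiff W1 W2 by rewrite (inP cl) (negPf qW).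
have Yc := q_circ cl qP Yi qY YS p11 p1x p1y p1Y p22 p2x p2y p2Y.
have [z1x z1y _] := K_neq Yi z1Y; have [z2x z2y _] := K_neq Yi z2Y.
apply/eqP; rewrite eqEsubset !subUset !sub1set (clash_x1 cl) (clash_y1 cl) z11 p11 !andbT.
apply/subsetP=> g g1; rewrite !inE; apply/negPn/negP; rewrite !negb_or => /andP[/andP[/andP[gx gy] gz] gp].
case gY: (g \in Y).
  by apply: (off_part cl qA qW Yc qY YS z1Y gY z11 g1 _ z2Y z22); rewrite eq_sym.
pose V := sdiff Y (W1 :\ y :\ x).
have Vi : V \in KK by apply: K_bspace.2 => //; apply: K_W1 cl.
have qW1 : q \notin W1 by apply: contra qW => q1; rewrite inE q1.
have qV : q \in V by rewrite in_sdiff qY !in_setD1 (negPf qW1) !andbF.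
have inV u : u \in W1 -> u != x -> u != y -> (u \in V) = (u \notin Y).
  by move=> u1 ux uy; rewrite in_sdiff !in_setD1 u1 ux uy addbT.
have inV2 u : u \in W2 -> u != x -> u != y -> (u \in V) = (u \in Y).
  move=> u2 ux uy; rewrite in_sdiff !in_setD1.
  by rewrite (negPf (clash_one (clash_swap cl) u2 ux uy)) !andbF addbF.
have VS : V \subset q |: sdiff W1 W2.
  apply/subsetP=> u; rewrite in_sdiff in_setU1 (inP cl) in_setU !in_setD1.
  case uY: (u \in Y) => /=.
    by have := subsetP YS u uY; rewrite in_setU1 (inP cl) in_setU.
  by case/and3P=> -> -> ->; rewrite orbT.
have z1V : z1 \notin V by rewrite inV // z1Y.
have p2V : p2 \notin V by rewrite inV2.
have z2V : z2 \in V by rewrite inV2.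
have p1V : p1 \in V by rewrite inV.
have gV : g \in V by rewrite inV // gY.
have Vc := q_circ cl qP Vi qV VS z11 z1x z1y z1V p22 p2x p2y p2V.
by apply: (off_part cl qA qW Vc qV VS p1V gV p11 g1 _ z2V z22); rewrite eq_sym.
Qed.

(** Connectivity of [KK] gives circuits that meet W1 and W2; take one with fewest elements outside P
    and let q be one of these. By [off_closure], P spans q, through some Y. By [no_halfline],
    applied to Y and to its sums with W1 and W2, Y contains some but not all elements of each
    part. *)
Lemma clash_line W1 W2 : clash ZZ R x y W1 W2 -> exists Y q z1 p1 z2 p2,
  [/\ [/\ q \in A, q \notin W1 :|: W2, Y \in KK, q \in Y & Y \subset q |: sdiff W1 W2],
  [/\ z1 \in Y, z1 \in W1, z2 \in Y & z2 \in W2],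
  [/\ p1 \in W1, p1 != x, p1 != y & p1 \notin Y] &
  [/\ p2 \in W2, p2 != x, p2 != y & p2 \notin Y]].
Proof.
move=> cl; have cl' := clash_swap cl.
have [f1 [f1W f1x f1y _]] := W1_other cl x.
have [f2 [f2W f2x f2y _]] := W1_other cl' x.
have f1A := subsetP (crit_sub crA (circ_in (clash1 cl))) f1 f1W.
have f2A := subsetP (crit_sub crA (circ_in (clash2 cl))) f2 f2W.
have [C0 [Cc0 f1C0 f2C0]] := cn (K_ground f1A f1x f1y) (K_ground f2A f2x f2y).
pose P := sdiff W1 W2.
pose pc (C : {set T}) := [&& circ KK C, C :&: W1 != set0 & C :&: W2 != set0].
have pcI (C : {set T}) g h : circ KK C -> g \in C -> g \in W1 -> h \in C -> h \in W2 -> pc C.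
  move=> Cc gC g1 hC h2; rewrite /pc Cc /=; apply/andP; split; apply/set0Pn.
    by exists g; rewrite inE gC.
  by exists h; rewrite inE hC.
case: (arg_minnP (fun C : {set T} => #|C :\: P|) (pcI C0 f1 f2 Cc0 f1C0 f1W f2C0 f2W)).
move=> C /and3P[Cc /set0Pn[g1] /setIP[g1C g1W] /set0Pn[g2] /setIP[g2C g2W]] min.
have [g1x g1y _] := K_neq (circ_in Cc) g1C; have [g2x g2y _] := K_neq (circ_in Cc) g2C.
have [q qC qP] : exists2 q, q \in C & q \notin P.
  apply/subsetPn/negP=> CP.
  have sub := K_part cl (circ_in Cc) CP g1C g1W.
  have eqC := circ_min Cc (K_W1 cl) sub.
  have : g2 \in W1 :\ y :\ x.
    rewrite eqC //; apply/set0Pn; exists g1; by rewrite !in_setD1 g1x g1y.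
  by rewrite !in_setD1 (negPf (clash_one cl' g2W g2x g2y)) !andbF.
have [qx qy qA] := K_neq (circ_in Cc) qC.
have qW : q \notin W1 :|: W2 by apply: contra qP => qW; rewrite (inP cl) qW qx qy.
have /norP[q1 q2] : ~~ ((q \in W1) || (q \in W2)) by rewrite -in_setU.
have [Y [Yi qY YS]] : exists Y, [/\ Y \in KK, q \in Y & Y \subset q |: P].
  apply: NNPP => no; apply: (off_closure cl qA qx qy _ _ (f1 := g1) (f2 := g2) (G := C :\ q)) => //.
  - by move=> Y Yi qY; apply/negP=> YS; apply: no; exists Y.
  - apply: circ_con_in => //; apply: contraTneq g1C => ->; rewrite inE.
    by apply: contraNneq q1 => <-.
  - by rewrite in_setD1 g1C andbT; apply: contraNneq q1 => <-.
  - by rewrite in_setD1 g2C andbT; apply: contraNneq q2 => <-.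
have half1 V : V \in KK -> q \in V -> V \subset q |: P -> (forall g, g \in V -> g \notin W2) -> False.
  move=> Vi qV VS; apply: (no_halfline cl Cc _ g2C g2W qC qP Vi qV VS).
  by move=> C' h1 h2 Cc' ? ? ? ?; apply: min; apply: (pcI C' h1 h2).
have half2 V : V \in KK -> q \in V -> V \subset q |: P -> (forall g, g \in V -> g \notin W1) -> False.
  move: qP; rewrite /P sdiffC => qP Vi qV VS; apply: (no_halfline cl' Cc _ g1C g1W qC qP Vi qV VS).
  by move=> C' h1 h2 Cc' ? ? ? ?; rewrite sdiffC; apply: min; apply: (pcI C' h2 h1).
have shiftS (V U : {set T}) : V \subset q |: P -> U \subset P -> sdiff V U \subset q |: P.
  by move=> VS US; sets.
have W1P : W1 :\ y :\ x \subset P.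
  by apply/subsetP=> g; rewrite !in_setD1 (inP cl) in_setU => /and3P[-> -> ->].
have W2P : W2 :\ y :\ x \subset P.
  by apply/subsetP=> g; rewrite !in_setD1 (inP cl) in_setU => /and3P[-> -> ->]; rewrite orbT.
have ex1 : exists2 z, z \in Y & z \in W1.
  by apply: NNPP => no; apply: (half2 Y) => // g gY; apply/negP=> gW; apply: no; exists g.
have ex2 : exists2 z, z \in Y & z \in W2.
  by apply: NNPP => no; apply: (half1 Y) => // g gY; apply/negP=> gW; apply: no; exists g.
have nx1 : exists p, [/\ p \in W1, p != x, p != y & p \notin Y].
  apply: NNPP => no; apply: (half2 (sdiff Y (W1 :\ y :\ x))).
  - by apply: K_bspace.2 => //; apply: K_W1 cl.
  - by rewrite in_sdiff qY !in_setD1 (negPf q1) !andbF.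
  - exact: shiftS.
  move=> g; rewrite in_sdiff !in_setD1 => gS; apply/negP=> gW; move: gS; rewrite gW andbT.
  case gY: (g \in Y); last by case/andP=> gx gy; apply: no; exists g; rewrite gY.
  have [-> -> _] := K_neq Yi gY; exact/negP.
have nx2 : exists p, [/\ p \in W2, p != x, p != y & p \notin Y].
  apply: NNPP => no; apply: (half1 (sdiff Y (W2 :\ y :\ x))).
  - by apply: K_bspace.2 => //; apply: K_W1 cl'.
  - by rewrite in_sdiff qY !in_setD1 (negPf q2) !andbF.
  - exact: shiftS.
  move=> g; rewrite in_sdiff !in_setD1 => gS; apply/negP=> gW; move: gS; rewrite gW andbT.
  case gY: (g \in Y); last by case/andP=> gx gy; apply: no; exists g; rewrite gY.
  have [-> -> _] := K_neq Yi gY; exact/negP.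
case: ex1 => z1 z1Y z11; case: ex2 => z2 z2Y z22; case: nx1 => p1 Hp1; case: nx2 => p2 Hp2.
by exists Y, q, z1, p1, z2, p2.
Qed.

Lemma clash_config W1 W2 : clash ZZ R x y W1 W2 ->
  exists a b z1 z2 p1 p2 q, f7star A ZZ a b z1 z2 p1 p2 q.
Proof.
move=> cl; have cl' := clash_swap cl.
have [Y [q [z1 [p1 [z2 [p2 [[qA qW Yi qY YS] [z1Y z11 z2Y z22]]]]]]]] := clash_line cl.
move=> [p11 p1x p1y p1Y] [p22 p2x p2y p2Y].
have qP : q \notin sdiff W1 W2 by rewrite (inP cl) (negPf qW).
have YS' : Y \subset q |: sdiff W2 W1 by rewrite sdiffC.
have qW' : q \notin W2 :|: W1 by rewrite setUC.
have eW1 := part_two cl qA qW Yi qY YS z1Y z11 z2Y z22 p11 p1x p1y p1Y p22 p2x p2y p2Y.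
have eW2 := part_two cl' qA qW' Yi qY YS' z2Y z22 z1Y z11 p22 p2x p2y p2Y p11 p1x p1y p1Y.
have Yc := q_circ cl qP Yi qY YS p11 p1x p1y p1Y p22 p2x p2y p2Y.
have [z1x z1y _] := K_neq Yi z1Y; have [z2x z2y _] := K_neq Yi z2Y.
have [qx qy _] := K_neq Yi qY.
have z12 := clash_one cl z11 z1x z1y; have p12 := clash_one cl p11 p1x p1y.
have := qW; rewrite eW1 eW2 !inE !negb_or => /andP[/andP[/andP[_ qz1] qp1] /andP[/andP[_ qz2] qp2]].
move: z12 p12; rewrite eW2 !inE !negb_or => /andP[/andP[_ z1z2] z1p2] /andP[/andP[_ p1z2] p1p2].
have z1p1 : z1 != p1 by apply: contraTneq z1Y => ->.
have z2p2 : z2 != p2 by apply: contraTneq z2Y => ->.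
have uniqS a b : a != b -> [set a; b] = [set x; y] -> uniq [:: a; b; z1; z2; p1; p2; q].
  move=> ab eqS.
  have inab u : u != x -> u != y -> (u == a = false) * (u == b = false).
    move=> ux uy; have: u \notin [set a; b] by rewrite eqS !inE negb_or ux.
    by rewrite !inE negb_or => /andP[/negPf ? /negPf ?].
  have inab' u : u != x -> u != y -> (a == u = false) * (b == u = false).
    by move=> ux uy; rewrite !(eq_sym _ u); apply: inab.
  rewrite /= !inE (negPf ab) !(inab' z1) // !(inab' z2) // !(inab' p1) // !(inab' p2) //.
  by rewrite !(inab' q) //; neqs.
have eY : Y = [set q; z1; z2].
  apply/eqP; rewrite eqEsubset !subUset !sub1set qY z1Y z2Y !andbT.
  apply/subsetP=> g gY; have [gx gy _] := K_neq Yi gY.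
  have := subsetP YS g gY; rewrite in_setU1 (inP cl) eW1 eW2 !inE (negPf gx) (negPf gy) /= andbT.
  case: (eqVneq g p1) => [eg|_]; first by rewrite -eg gY in p1Y.
  case: (eqVneq g p2) => [eg|_]; first by rewrite -eg gY in p2Y.
  by rewrite !orbF orbA.
have indepB : ~~ dep ZZ [set x; y; z1; z2].
  apply/depP=> -[Z [Zi Z0 ZS]].
  have p1S : p1 \notin Z.
    by apply: contra (_ : p1 \notin [set x; y; z1; z2]); [apply: (subsetP ZS) | rewrite !inE; neqs].
  have p2S : p2 \notin Z.
    by apply: contra (_ : p2 \notin [set x; y; z1; z2]); [apply: (subsetP ZS) | rewrite !inE; neqs].
  have ZW : Z \subset W1 :|: W2.
    apply: subset_trans ZS _; rewrite !subUset !sub1set !inE (clash_x1 cl) (clash_y1 cl) z11 z22.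
    by rewrite orbT.
  have [eqZ|eqZ|eqZ|eqZ] := W_cycles cl Zi ZW.
  - by rewrite eqZ eqxx in Z0.
  - by rewrite eqZ p11 in p1S.
  - by rewrite eqZ p22 in p2S.
  - by rewrite eqZ (inP cl) inE p11 p1x p1y in p1S.
have spanB e : e \in A -> e \notin [set x; y; z1; z2] -> dep ZZ (e |: [set x; y; z1; z2]).
  move=> eA eB.
  have fin V : V \in ZZ -> e \in V -> V \subset e |: (W1 :|: W2) -> e != p1 -> e != p2 ->
      dep ZZ (e |: [set x; y; z1; z2]).
    move=> Vi eV VS ep1 ep2.
    pose V1 := if p1 \in V then sdiff V W1 else V.
    pose V2 := if p2 \in V then sdiff V1 W2 else V1.
    have V1i : V1 \in ZZ by rewrite /V1; case: ifP => // _; apply: ZD => //; apply: circ_in; case: cl.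
    have V2i : V2 \in ZZ by rewrite /V2; case: ifP => // _; apply: ZD => //; apply: circ_in; case: cl.
    have eW : e \notin W1 :|: W2.
      move: eB; rewrite eW1 eW2 !inE !negb_or => /andP[/andP[/andP[-> ->] ->] ->].
      by rewrite ep1 ep2.
    have /norP[e1 e2] : ~~ ((e \in W1) || (e \in W2)) by rewrite -in_setU.
    apply/depP; exists V2; split=> //.
      apply/set0Pn; exists e; rewrite /V2 /V1; do 2!case: ifP => _;
        by rewrite ?in_sdiff ?(negPf e1) ?(negPf e2) eV.
    apply/subsetP=> g; rewrite /V2 /V1 => gV2.
    have gS : g \in e |: (W1 :|: W2).
      case gV: (g \in V); first exact: subsetP VS g gV.
      move: gV2; rewrite in_setU1 in_setU; do 2!case: ifP => _; rewrite ?in_sdiff ?gV /=;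
        by case: (g \in W1); case: (g \in W2); rewrite ?orbT.
    move: gV2 gS; rewrite eW1 eW2.
    case: (eqVneq g p1) => [->|gp1].
      case: ifP => p2V; case: ifP => p1V; rewrite ?in_sdiff ?inE ?p1V; neqs; rewrite ?orbT //.
    case: (eqVneq g p2) => [->|gp2].
      case: ifP => p2V; case: ifP => p1V; rewrite ?in_sdiff ?inE ?p2V; neqs; rewrite ?orbT //.
    by rewrite !inE (negPf gp1) (negPf gp2) !orbF => _; case: (g == e); case: (g == x); case: (g == y);
       case: (g == z1); case: (g == z2).
  have fromK V : V \in KK -> e \in V -> V \subset e |: sdiff W1 W2 -> e != p1 -> e != p2 ->
      dep ZZ (e |: [set x; y; z1; z2]).
    case/KP=> V' V'i -> eV VS; apply: (fin V') => //; first by move: eV; rewrite !in_setD1 => /and3P[].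
    apply/subsetP=> g gV; have := subsetP VS g; rewrite !in_setD1 !in_setU1 (inP cl) gV.
    case: (eqVneq g x) => [->|_]; first by rewrite in_setU (clash_x1 cl) orbT.
    case: (eqVneq g y) => [->|_]; first by rewrite in_setU (clash_y1 cl) orbT.
    by rewrite /= andbT; apply.
  case: (eqVneq e p1) => [->|ep1].
    apply: (depS (A := W1)); first by rewrite eW1; sets.
    by apply/depP; exists W1; split=> //; [exact: circ_in (clash1 cl) | exact: circ_neq0 (clash1 cl)].
  case: (eqVneq e p2) => [->|ep2].
    apply: (depS (A := W2)); first by rewrite eW2; sets.
    by apply/depP; exists W2; split=> //; [exact: circ_in (clash2 cl) | exact: circ_neq0 (clash2 cl)].
  case: (eqVneq e q) => [eq|eq]; first by apply: (fromK Y); rewrite ?eq // -eq.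
  move: eB; rewrite !inE !negb_or => /andP[/andP[/andP[ex ey] ez1] ez2].
  (* If P did not span e, then Y would survive the contraction of e; as Y contains z1 and z2, this
     contradicts [off_closure]. *)
  apply: NNPP => no; have off V : V \in KK -> e \in V -> ~~ (V \subset e |: sdiff W1 W2).
    by move=> Vi eV; apply/negP=> VS; apply: no; apply: (fromK V).
  have eY' : e \notin Y by rewrite eY !inE !negb_or eq ez1.
  apply: (off_closure cl eA ex ey off (G := Y) (f1 := z1) (f2 := z2)) => //.
  apply: circ_con_out => // V Vi eV; apply/negP=> VS.
  have eP : e \notin sdiff W1 W2.
    by rewrite (inP cl) eW1 eW2 !inE; neqs.
  case qV: (q \in V).
    apply: (negP (off (sdiff V Y) _ _)); first by apply: K_bspace.2.
      by rewrite in_sdiff eV (negPf eY').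
    apply/subsetP=> g; rewrite in_sdiff in_setU1; case: (eqVneq g e) => //= ge gVY.
    have gq : g != q by apply: contraTneq gVY => ->; rewrite qV qY.
    have gY : g \in Y.
      by move: gVY (subsetP VS g); rewrite in_setU1 (negPf ge); case: (g \in V) => // _ /(_ isT).
    by have := subsetP YS g gY; rewrite in_setU1 (negPf gq).
  apply: (negP (off V Vi eV)); apply/subsetP=> g gV; rewrite in_setU1.
  case: (eqVneq g e) => //= ge; have gq : g != q by apply: contraFneq qV => <-.
  have gY : g \in Y by have := subsetP VS g gV; rewrite in_setU1 (negPf ge).
  by have := subsetP YS g gY; rewrite in_setU1 (negPf gq).
(* The cycle Z above Y = {q, z1, z2} contains exactly one of x and y: with neither, Z is a triangle;
   with both, Z + W1 is the triangle {q, z2, p1}. The one that it contains plays the role of x in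
   [f7star]. *)
have [Z Zi eqY] := KP _ Yi.
have Hz g : g != x -> g != y -> (g \in Z) = (g \in [set q; z1; z2]).
  by move=> gx gy; rewrite -eY eqY !in_setD1 gx gy.
have c1 : [set x; y; z1; p1] \in ZZ by rewrite -eW1; apply: circ_in; case: cl.
have c2 : [set x; y; z2; p2] \in ZZ by rewrite -eW2; apply: circ_in; case: cl.
have swapxy u v : [set y; x; u; v] = [set x; y; u; v] by rewrite (setUC [set y]).
case xZ: (x \in Z); case yZ: (y \in Z).
- suff Hb : sdiff Z W1 = [set q; z2; p1].
    have := tf qz2 qp1 (_ : z2 != p1); rewrite -Hb ZD ?eW1 // eq_sym => /(_ p1z2); by [].
  apply/setP=> g; rewrite in_sdiff eW1.
  case: (eqVneq g x) => [->|gx]; first by rewrite xZ !inE; neqs.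
  case: (eqVneq g y) => [->|gy]; first by rewrite yZ !inE; neqs.
  rewrite Hz // !inE; neqs; case: (eqVneq g z1) => [->|gz1]; first by neqs.
  case: (eqVneq g p1) => [->|gp1]; first by neqs.
  by rewrite /= addbF !orbF.
- exists x, y, z1, z2, p1, p2, q; split=> //; first exact: uniqS.
  split=> //; suff <- : Z = [set x; z1; z2; q] by [].
  apply/setP=> g; case: (eqVneq g x) => [->|gx]; first by rewrite xZ !inE eqxx.
  case: (eqVneq g y) => [->|gy]; first by rewrite yZ !inE; neqs.
  by rewrite Hz // !inE (negPf gx) /=; case: (g == q); case: (g == z1); case: (g == z2).
- exists y, x, z1, z2, p1, p2, q; split; first by apply: uniqS; rewrite 1?eq_sym // setUC.
  + by rewrite swapxy.
  + rewrite !swapxy; split=> //; suff <- : Z = [set y; z1; z2; q] by [].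
    apply/setP=> g; case: (eqVneq g y) => [->|gy]; first by rewrite yZ !inE eqxx.
    case: (eqVneq g x) => [->|gx]; first by rewrite xZ !inE; neqs.
    by rewrite Hz // !inE (negPf gy) /=; case: (g == q); case: (g == z1); case: (g == z2).
  by move=> e; rewrite swapxy; apply: spanB.
have := tf qz1 qz2 z1z2; suff <- : Z = [set q; z1; z2] by rewrite Zi.
apply/setP=> g; case: (eqVneq g x) => [->|gx]; first by rewrite xZ !inE; neqs.
case: (eqVneq g y) => [->|gy]; first by rewrite yZ !inE; neqs.
by rewrite Hz.
Qed.

End ClashConfig.

(* The Fano plane on the basis x, y, q, with b = x + y, p = x + q, p' = y + q and
   q' = x + y + q. *)
Definition fano_conf (T : finType) (A : {set T}) (ZZ : {set {set T}}) x y b q p p' q' :=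
  [/\ [/\ x != y, x != b & y != b], [set x; y; b] \in ZZ,
      [/\ ~~ dep ZZ [set x; y; q], q != x & q != y],
      [/\ p != x, p != q & [set x; q; p] \in ZZ] &
      [/\ [/\ p' != y, p' != q & [set y; q; p'] \in ZZ],
      [/\ q' != x, q' != y, q' != q & [set x; y; q; q'] \in ZZ] &
      forall e, e \in A -> e \notin [set x; y; q] -> dep ZZ (e |: [set x; y; q])]].

(** Without triangles, x and y come from two applications of [conn_con], so that contracting both
    leaves a connected matroid, as [clash_line] requires. If no clash occurred, the glued code would
    represent [ZZ]. *)
Lemma critical_config (T : finType) (F : fieldType) (A : {set T}) ZZ : critical F A ZZ ->
  (exists x y b q p p' q', fano_conf A ZZ x y b q p p' q') \/
  (forall a b c, a != b -> a != c -> b != c -> [set a; b; c] \notin ZZ) /\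
  (exists x y z1 z2 p1 p2 q, f7star A ZZ x y z1 z2 p1 p2 q).
Proof.
move=> crA; have bZ := crit_bspace crA.
case: (classic (exists x y b, [/\ x != y, x != b, y != b & [set x; y; b] \in ZZ])) => [|notri].
  case=> x [y [b [xy xb yb tri]]]; left.
  have [q [p [p' [q' [H1 H2 H3 H4 H5]]]]] := triangle_config crA xy xb yb tri.
  by exists x, y, b, q, p, p', q'.
right.
have tf a b c : a != b -> a != c -> b != c -> [set a; b; c] \notin ZZ.
  by move=> ab ac bc; apply/negP=> tri; apply: notri; exists a, b, c.
split=> //; have inA e Z : Z \in ZZ -> e \in Z -> e \in A by move=> Zi; apply: (subsetP (crit_sub crA Zi)).
have grA e : e \in ground ZZ -> e \in A by case/groundP=> _ [Z Zi eZ]; apply: inA eZ.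
have cZ : conn ZZ by move=> e f /grA eA /grA fA; exact: (crit_linked crA eA fA).
have Agr e : e \in A -> e \in ground ZZ.
  move=> eA; apply/groundP; split; first exact: crit_nonloop crA e.
  by have [C Cc eC] := crit_cover crA eA; exists C => //; apply: circ_in.
have gr0 : ground ZZ != set0.
  apply/negP=> /eqP g0; apply: (crit_nrep crA).
  have Z0 Z : Z \in ZZ -> Z = set0.
    move=> Zi; apply/eqP; apply/set0Pn=> -[e eZ].
    by have := Agr e (inA e Z Zi eZ); rewrite g0 inE.
  exists (fun c => c = 0); split=> //.
  - by move=> c d -> ->; rewrite addr0.
  - by move=> t c ->; apply/ffunP=> e; rewrite !ffunE mulr0.
  - by move=> C Cc; have /circP[/Z0->] : circ ZZ C := Cc; rewrite eqxx.
  - by move=> c ->; rewrite supp0 eqxx.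
have [x /grA xA cx] := conn_con bZ cZ gr0.
have pairx e : e != x -> [set e] \notin con x ZZ.
  move=> ex; apply: contra (nodep_pair crA ex) => /conP[Z Zi eqZ].
  have eZ : e \in Z by have := set11 e; rewrite eqZ inE => /andP[].
  apply/depP; exists Z; split=> //; first by apply/set0Pn; exists e.
  apply/subsetP=> g gZ; rewrite !inE; case: (eqVneq g x) => [_|gx]; first by rewrite orbT.
  by rewrite -in_set1 eqZ !inE gx gZ.
have gx0 : ground (con x ZZ) != set0.
  have [C Cc xC] := crit_cover crA xA.
  have [y yC yx] : exists2 y, y \in C & y != x.
    have: ~~ (C \subset [set x]).
      apply: contra (crit_nonloop crA x) => Cx; suff <- : C = [set x] by apply: circ_in.
      by apply/eqP; rewrite eqEsubset Cx sub1set.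
    by case/subsetPn=> y yC; rewrite inE => yx; exists y.
  apply/set0Pn; exists y; apply/groundP; split; first exact: pairx.
  by exists (C :\ x); [apply/con_in/circ_in | rewrite !inE yx].
have [y gy cy] := conn_con (bspace_con x bZ) cx gx0.
have yx : y != x.
  by case/groundP: gy => _ [Z Zi yZ]; apply: contraTneq yZ => ->; apply: con_notin Zi.
have yA : y \in A.
  case/groundP: gy => _ [_ /conP[Z Zi ->]]; rewrite inE => /andP[_]; exact: inA.
have xy : x != y by rewrite eq_sym.
have [R gR] := exists_glued crA xA yA xy.
apply: NNPP => no; apply: (crit_nrep crA); apply: (glued_frep crA xy gR) => W1 W2 cl.
apply: no; rewrite conC in cy.
exact: (clash_config crA xy gR tf cy cl).
Qed.

(** * Coordinates and fields of characteristic two *)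

Section Coordinates.
Variables (T : finType) (ZZ : {set {set T}}).
Hypothesis bZ : bspace ZZ.
Let ZD := bZ.2.
Implicit Types B S X Y Z : {set T}.

Lemma sdiffK X Y : sdiff X (sdiff X Y) = Y.
Proof. by sets. Qed.

(* e is the sum of the elements of S. *)
Definition coordinates B e S := (S \subset B) && (sdiff [set e] S \in ZZ).
Definition cl B : {set T} := [set e | [exists S, coordinates B e S]].
Definition coords B e : {set T} := odflt set0 [pick S | coordinates B e S].

Lemma coordP B e : e \in cl B -> coordinates B e (coords B e).
Proof.
rewrite inE /coords => /existsP[S HS]; case: pickP => [//|no].
by have := no S; rewrite HS.
Qed.

Lemma coord_sub B e : coords B e \subset B.
Proof. by rewrite /coords; case: pickP => [S /andP[]|_]; rewrite ?sub0set. Qed.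

Lemma indep_cycle B Z : ~~ dep ZZ B -> Z \in ZZ -> Z \subset B -> Z = set0.
Proof.
move=> iB Zi ZB; apply/eqP; apply: contraNT iB => Z0; apply/depP; by exists Z.
Qed.

Lemma coordE B e S : ~~ dep ZZ B -> S \subset B -> sdiff [set e] S \in ZZ ->
  (e \in cl B) * (coords B e = S).
Proof.
move=> iB SB Si; have ecl : e \in cl B by rewrite inE; apply/existsP; exists S; rewrite /coordinates SB.
split=> //; have /andP[S'B S'i] := coordP ecl; apply/eqP; rewrite -sdiff_eq0; apply/eqP.
apply: (indep_cycle iB); last by sets.
have -> : sdiff (coords B e) S = sdiff (sdiff [set e] (coords B e)) (sdiff [set e] S) by sets.
exact: ZD.
Qed.

Lemma coord_id B e : ~~ dep ZZ B -> e \in B -> (e \in cl B) * (coords B e = [set e]).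
Proof.
move=> iB eB; apply: coordE; rewrite ?sub1set //.
by rewrite (_ : sdiff _ _ = set0) ?bZ.1 //; apply/eqP; rewrite sdiff_eq0.
Qed.

(* The sum of the elements of X in the basis B. *)
Definition par B X : {set T} := [set b | odd #|[set e in X | b \in coords B e]|].

Lemma par_sub B X : par B X \subset B.
Proof.
apply/subsetP=> b; rewrite inE => odd_b; apply/negPn/negP=> bB.
move: odd_b; rewrite (_ : [set e in X | _] = set0) ?cards0 //.
apply/setP=> e; rewrite !inE; apply/negP=> /andP[_ bc].
by have := subsetP (coord_sub B e) b bc; rewrite (negPf bB).
Qed.

Lemma parU1 B X e : e \notin X -> par B (e |: X) = sdiff (coords B e) (par B X).
Proof.
move=> eX; apply/setP=> b; rewrite !inE.
have -> : [set f in e |: X | b \in coords B f] =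
    if b \in coords B e then e |: [set f in X | b \in coords B f] else [set f in X | b \in coords B f].
  apply/setP=> f; case: ifP => be; rewrite !inE; case: (eqVneq f e) => [->|] //=.
  by rewrite be (negPf eX).
by case: ifP => // _; rewrite cardsU1 inE (negPf eX).
Qed.

Lemma par0 B : par B set0 = set0.
Proof.
apply/setP=> b; rewrite !inE; rewrite (_ : [set _ in _ | _] = set0) ?cards0 //.
by apply/setP=> e; rewrite !inE.
Qed.

Lemma par_cycle B X : X \subset cl B -> sdiff X (par B X) \in ZZ.
Proof.
have [n] := ubnP #|X|; elim: n X => // n IHn X ltn XB.
case: (set_0Vmem X) => [->|[e eX]]; first by rewrite par0 sdiff0 bZ.1.
have XE := setD1K eX; have eN : e \notin X :\ e by rewrite !inE eqxx.
have ltn' : (#|X :\ e| < n)%N by move: ltn; rewrite (cardsD1 e X) eX.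
have Yi := IHn _ ltn' (subset_trans (subsetDl _ _) XB).
have /andP[_ Ei] := coordP (subsetP XB e eX).
rewrite -XE parU1 //.
have -> : sdiff (e |: X :\ e) (sdiff (coords B e) (par B (X :\ e))) =
  sdiff (sdiff (X :\ e) (par B (X :\ e))) (sdiff [set e] (coords B e)).
  by move: eN => /negPf eN; apply/setP=> f; rewrite !in_sdiff in_setU1 in_set1;
     case: (eqVneq f e) => [->|]; rewrite ?eN; do ?case: (_ \in _).
exact: ZD.
Qed.

Lemma coord_cycle B X : ~~ dep ZZ B -> X \subset cl B -> (X \in ZZ) = (par B X == set0).
Proof.
move=> iB XB; have Xi := par_cycle XB; apply/idP/eqP=> [Xz|p0]; last by rewrite p0 sdiff0 in Xi.
apply: (indep_cycle iB) (par_sub B X).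
by rewrite -[par B X](sdiffK X); apply: ZD.
Qed.

Lemma cl_sub B e : ~~ dep ZZ B -> e \in B -> e \in cl B.
Proof. by move=> iB eB; rewrite (coord_id iB eB). Qed.

Lemma cl_cycle B Z e : Z \in ZZ -> e \in Z -> Z :\ e \subset cl B -> e \in cl B.
Proof.
move=> Zi eZ ZB; rewrite inE; apply/existsP; exists (par B (Z :\ e)).
rewrite /coordinates par_sub /=.
have -> : sdiff [set e] (par B (Z :\ e)) = sdiff Z (sdiff (Z :\ e) (par B (Z :\ e))).
  apply/setP=> f; rewrite !in_sdiff !inE; case: (eqVneq f e) => [->|_] /=; first by rewrite eZ.
  by rewrite addbA addbb.
by apply: ZD => //; apply: par_cycle.
Qed.

Lemma dep_cl B e : ~~ dep ZZ B -> dep ZZ (e |: B) -> e \in cl B.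
Proof.
move=> iB /depP[Z [Zi Z0 ZS]]; have eZ : e \in Z.
  apply: contraNT iB => eZ; apply/depP; exists Z; split=> //.
  apply/subsetP=> f fZ; have := subsetP ZS f fZ; rewrite in_setU1 => /orP[/eqP fe|//].
  by rewrite -fe fZ in eZ.
apply: (cl_cycle Zi eZ); apply/subsetP=> f; rewrite !inE => /andP[fe fZ].
have := subsetP ZS f fZ; rewrite in_setU1 (negPf fe) => /= fB.
by have := cl_sub iB fB; rewrite inE.
Qed.

(** Extend A to a basis B; h is the set of elements whose coordinates in B involve a. A cycle meets
    it evenly because the elements of the cycle sum to zero. *)
Lemma exists_cocycle A a : ~~ dep ZZ A -> a \in A -> exists h : {set T},
  [/\ forall Z, Z \in ZZ -> ~~ odd #|Z :&: h|, a \in h & forall e, e \in A -> e \in h -> e = a].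
Proof.
move=> iA aA.
have [B /maxsetP[iB maxB] AB] := maxset_exists (P := fun B => ~~ dep ZZ B) iA.
have clT e : e \in cl B.
  case: (boolP (e \in B)) => [|eB]; first exact: cl_sub.
  apply: dep_cl => //; apply: contraT => ieB.
  have := maxB _ ieB (subsetUr _ _) => /setP/(_ e); by rewrite in_setU1 eqxx (negPf eB).
exists [set e | a \in coords B e]; split.
- move=> Z Zi; have ZB : Z \subset cl B by apply/subsetP=> e _.
  move: Zi; rewrite (coord_cycle iB ZB) => /eqP/setP/(_ a); rewrite !inE => /negbT.
  by rewrite (_ : [set e in Z | a \in coords B e] = Z :&: [set e | a \in coords B e]) //;
    apply/setP=> e; rewrite !inE.
- by rewrite inE (coord_id iB (subsetP AB a aA)) set11.
by move=> e eA; rewrite inE (coord_id iB (subsetP AB e eA)) inE => /eqP.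
Qed.

(** Relations are the vectors whose sum over every cocycle vanishes, a cocycle being a set that
    meets all cycles evenly. In characteristic two the 0/1 vector of a cycle qualifies; conversely,
    an independent support would meet some cocycle in a single element. *)
Lemma char2_frep (F : fieldType) : 2%:R = 0 :> F -> frep F (dep ZZ).
Proof.
move=> c2.
exists (fun c => forall h : {set T}, (forall Z, Z \in ZZ -> ~~ odd #|Z :&: h|) -> \sum_(e in h) c e = 0).
split.
- by move=> h _; rewrite big1 // => e _; rewrite ffunE.
- move=> c d Rc Rd h hh; under eq_bigr do rewrite ffunE.
  by rewrite big_split /= Rc // Rd // addr0.
- move=> t c Rc h hh; under eq_bigr do rewrite ffunE.
  by rewrite -mulr_sumr Rc // mulr0.
- move=> C Cc; have Ci : C \in ZZ by apply: circ_in.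
  exists [ffun e => (e \in C)%:R]; last by apply/setP=> e; rewrite inE ffunE; case: (e \in C); rewrite ?oner_eq0 ?eqxx.
  move=> h hh; under eq_bigr do rewrite ffunE.
  rewrite -natr_sum (_ : (\sum_(e in h) (e \in C))%N = #|C :&: h|); last first.
    rewrite -sum1_card big_mkcond [RHS]big_mkcond; apply: eq_bigr => e _.
    by rewrite inE; case: (e \in C); case: (e \in h).
  have /negPf ev := hh C Ci; rewrite -(odd_double_half #|C :&: h|) ev add0n.
  by rewrite -mul2n natrM c2 mul0r.
move=> c Rc c0; apply: contraT => ic; case/set0Pn: c0 => a ac.
have [h [hh ah hu]] := exists_cocycle ic ac.
have := Rc h hh; rewrite (bigD1 a) //= big1 ?addr0 => [ca|e /andP[eh ea]].
  by move: ac; rewrite inE ca eqxx.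
by apply: suppN; apply: contra ea => ec; apply/eqP; apply: hu.
Qed.

End Coordinates.

(** * The Fano plane forces characteristic two *)

Section FanoCharacteristic.
Variables (T : finType) (F : fieldType) (ZZ : {set {set T}}).
Hypothesis bZ : bspace ZZ.
Let ZD := bZ.2.
Variables (R : {ffun T -> F} -> Prop) (a b c ab ac bc d : T).
Hypothesis rR : code_for R (dep ZZ).
Let l := [:: a; b; c; ab; ac; bc; d].
Hypotheses (ul : uniq l)
  (girth : forall Z, Z \in ZZ -> Z != set0 -> Z \subset l -> (2 < #|Z|)%N).

Lemma line_circ u v w : u \in l -> v \in l -> w \in l -> [set u; v; w] \in ZZ ->
  circ ZZ [set u; v; w].
Proof.
move=> ul' vl wl Li; have LS : [set u; v; w] \subset l.
  by apply/subsetP=> g; rewrite !in_setU !in_set1 => /orP[/orP[]|] /eqP->.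
apply/circP; split=> //; first by apply/set0Pn; exists u; rewrite !inE eqxx.
move=> Z Zi Z0 ZL; apply/eqP; rewrite eqEcard ZL /=.
have := girth Zi Z0 (subset_trans ZL LS); apply: leq_trans.
rewrite (_ : [set u; v; w] = [set e in [:: u; v; w]]) ?cardsE ?card_size //.
by apply/setP=> g; rewrite !inE -!orbA.
Qed.

(** A proper nonempty part in [ZZ] and its complement would both contain at least three of the four
    points. *)
Lemma quad_circ u v w : uniq [:: u; v; w; d] -> {subset [:: u; v; w; d] <= l} ->
  [set u; v; w; d] \in ZZ -> circ ZZ [set u; v; w; d].
Proof.
move=> uq ql Qi; have QS : [set u; v; w; d] \subset l.
  by apply/subsetP=> g gq; apply: ql; move: gq; rewrite !in_setU !in_set1 !in_cons in_nil orbF -!orbA.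
apply/circP; split=> //; first by apply/set0Pn; exists u; rewrite !inE eqxx.
move=> Z Zi Z0 ZQ; apply/eqP; rewrite -sdiff_eq0; apply/negPn/negP=> S0.
have SQ : sdiff Z [set u; v; w; d] \subset [set u; v; w; d] by sets.
have lt1 := girth Zi Z0 (subset_trans ZQ QS).
have lt2 := girth (ZD Zi Qi) S0 (subset_trans SQ QS).
have : (#|[set u; v; w; d]| <= 4)%N.
  by rewrite -(_ : [set e in [:: u; v; w; d]] = [set u; v; w; d]) ?cardsE ?card_size //;
    apply/setP=> g; rewrite !inE -!orbA.
have <- : (#|Z| + #|sdiff Z [set u; v; w; d]| = #|[set u; v; w; d]|)%N.
  by rewrite -(cardsID Z [set u; v; w; d]) (setIidPr ZQ) (_ : sdiff Z _ = [set u; v; w; d] :\: Z) //; sets.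
by case: #|Z| lt1 => [|[|[|n]]] // _; case: #|_| lt2 => [|[|[|m]]] // _; rewrite !addnS.
Qed.


Hypotheses (Lab : [set a; b; ab] \in ZZ) (Lac : [set a; c; ac] \in ZZ)
  (Lbc : [set b; c; bc] \in ZZ) (Lm : [set ab; ac; bc] \in ZZ)
  (Lc : [set d; c; ab] \in ZZ) (Lb : [set d; b; ac] \in ZZ) (La : [set d; a; bc] \in ZZ).

(** Eliminating m between the chains of the lines {u, v, m} and {d, w, m} leaves a relation on {u,
    v, w, d}, hence a multiple of [al]; at u and v only the first line contributes. *)
Lemma line_ratio u v w m al : {subset [:: u; v; w; m; d] <= l} -> uniq [:: u; v; w; m; d] ->
  [set u; v; m] \in ZZ -> [set d; w; m] \in ZZ -> circ ZZ [set u; v; w; d] ->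
  R al -> supp al = [set u; v; w; d] ->
  exists be k, [/\ R be, supp be = [set u; v; m], k != 0, be u = k * al u & be v = k * al v].
Proof.
move=> sl uq L1 L2 Qc Ral sal.
have lin g : g \in [:: u; v; w; m; d] -> g \in l by apply: sl.
have c1 : circ ZZ [set u; v; m] by apply: line_circ => //; apply: lin; rewrite !inE eqxx ?orbT.
have c2 : circ ZZ [set d; w; m] by apply: line_circ => //; apply: lin; rewrite !inE eqxx ?orbT.
have [be Rbe sbe] := code_circ rR c1; have [ga Rga sga] := code_circ rR c2.
move: uq; rewrite /= !inE !negb_or => /and5P[/and4P[uv uw um ud] /and3P[vw vm vd] /andP[wm wd] md _].
have s0 (g : T) (h : {ffun T -> F}) S : supp h = S -> g \notin S -> h g = 0 by move=> <- ?; apply: suppN.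
have n0 (g : T) (h : {ffun T -> F}) S : supp h = S -> g \in S -> h g != 0 by move=> <-; rewrite in_supp.
have gm : ga m != 0 by apply: (n0 _ _ _ sga); rewrite !inE eqxx orbT.
pose de := sc (be m) ga + sc (- ga m) be.
have Rde : R de by apply: (codeD rR); apply: (codeZ rR).
have dS : supp de \subset [set u; v; w; d].
  apply: supp_sub => g; rewrite !inE !negb_or => /andP[/andP[/andP[gu gv] gw] gd].
  rewrite addE !scE; case: (eqVneq g m) => [->|gm']; first by ring.
  rewrite (s0 g ga _ sga) ?(s0 g be _ sbe) ?mulr0 ?addr0 //.
    by rewrite !inE !negb_or gu gv gm'.
  by rewrite !inE !negb_or gd gw gm'.
have [t et] := code_circ_eq rR Qc Ral Rde sal dS.
have gu : ga u = 0.
  by apply: (s0 _ _ _ sga); rewrite !inE !negb_or ud uw um.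
have gv : ga v = 0.
  by apply: (s0 _ _ _ sga); rewrite !inE !negb_or vd vw vm.
have /ffunP/(_ u) := et; rewrite addE !scE gu mulr0 add0r => eu.
have /ffunP/(_ v) := et; rewrite addE !scE gv mulr0 add0r => ev.
exists be, (- t / ga m).
have bu : be u != 0 by apply: (n0 _ _ _ sbe); rewrite !inE eqxx.
have e1 : be u = - t / ga m * al u by rewrite mulrAC mulNr -eu; field.
have e2 : be v = - t / ga m * al v by rewrite mulrAC mulNr -ev; field.
split=> //; by apply: contraNneq bu => z; rewrite e1 z mul0r.
Qed.

(* As d = a + b + c, the points ab, ac, bc are multiples of a + b, a + c, b + c,
   which are collinear only if 2 = 0. *)
Lemma fano_char2 : 2%:R = 0 :> F.
Proof.
have ABi : [set a; b; c; d] \in ZZ.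
  rewrite (_ : [set a; b; c; d] = sdiff [set a; b; ab] [set d; c; ab]); first exact: ZD.
  move: ul; rewrite /l /= !inE !negb_or => /and5P[/andP[? /and5P[? ? ? ? ?]] /and5P[? ? ? ? ?] /and4P[? ? ? ?] /and3P[? ? ?] /and3P[/andP[? ?] ? _]].
  apply/setP=> g; rewrite !inE.
  case: (eqVneq g a) => [->|ga]; neqs => //.
  case: (eqVneq g b) => [->|gb]; neqs => //.
  case: (eqVneq g c) => [->|gc]; neqs => //.
  case: (eqVneq g d) => [->|gd]; neqs => //.
  by rewrite addbb.
move: ul; rewrite /l /= !inE !negb_or => /and5P[/andP[n1 /and5P[n2 n3 n4 n5 n6]] /and5P[m1 m2 m3 m4 m5] /and4P[o1 o2 o3 o4] /and3P[p1 p2 p3] /and3P[/andP[q1 q2] r1 _]].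
have Qc : circ ZZ [set a; b; c; d].
  apply: quad_circ => //; first by rewrite /= !inE; neqs.
  by move=> g; rewrite !inE => /or4P[] /eqP->; rewrite eqxx ?orbT.
have Q2 : [set a; c; b; d] = [set a; b; c; d] by rewrite (setUAC [set a]).
have Q3 : [set b; c; a; d] = [set a; b; c; d] by rewrite (setUC [set b; c]) setUA.
have [al Ral sal] := code_circ rR Qc.
have [be1 [k1 [R1 s1 k10 e1a e1b]]] : exists be k,
    [/\ R be, supp be = [set a; b; ab], k != 0, be a = k * al a & be b = k * al b].
  apply: (line_ratio (w := c)) => //; first by move=> g; rewrite !inE => /orP[/eqP->|/or4P[] /eqP->]; rewrite eqxx ?orbT.
  by rewrite /= !inE; neqs.
have [be2 [k2 [R2 s2 k20 e2a e2c]]] : exists be k,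
    [/\ R be, supp be = [set a; c; ac], k != 0, be a = k * al a & be c = k * al c].
  apply: (line_ratio (w := b)) => //; rewrite ?Q2 //; first by move=> g; rewrite !inE => /orP[/eqP->|/or4P[] /eqP->]; rewrite eqxx ?orbT.
  by rewrite /= !inE; neqs.
have [be3 [k3 [R3 s3 k30 e3b e3c]]] : exists be k,
    [/\ R be, supp be = [set b; c; bc], k != 0, be b = k * al b & be c = k * al c].
  apply: (line_ratio (w := a)) => //; rewrite ?Q3 //; first by move=> g; rewrite !inE => /orP[/eqP->|/or4P[] /eqP->]; rewrite eqxx ?orbT.
  by rewrite /= !inE; neqs.
have Mc : circ ZZ [set ab; ac; bc] by apply: line_circ => //; rewrite !inE eqxx ?orbT.
have [ta Rta sta] := code_circ rR Mc.
have s0 (g : T) (h : {ffun T -> F}) S : supp h = S -> g \notin S -> h g = 0 by move=> <- ?; apply: suppN.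
have n0 (g : T) (h : {ffun T -> F}) S : supp h = S -> g \in S -> h g != 0 by move=> <-; rewrite in_supp.
have b1 : be1 ab != 0 by apply: (n0 _ _ _ s1); rewrite !inE eqxx orbT.
have b2 : be2 ac != 0 by apply: (n0 _ _ _ s2); rewrite !inE eqxx orbT.
have b3 : be3 bc != 0 by apply: (n0 _ _ _ s3); rewrite !inE eqxx orbT.
have t1 : ta ab != 0 by apply: (n0 _ _ _ sta); rewrite !inE eqxx.
pose si := ta + sc (- (ta ab / be1 ab)) be1 + sc (- (ta ac / be2 ac)) be2 + sc (- (ta bc / be3 bc)) be3.
have Rsi : R si by do 3?apply: (codeD rR) => //; apply: (codeZ rR).
have tz g : g \notin [set ab; ac; bc] -> ta g = 0 by apply: s0 sta.
have z1 g : g \notin [set a; b; ab] -> be1 g = 0 by apply: s0 s1.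
have z2 g : g \notin [set a; c; ac] -> be2 g = 0 by apply: s0 s2.
have z3 g : g \notin [set b; c; bc] -> be3 g = 0 by apply: s0 s3.
have si0 : si = 0.
  apply: (code_indep rR Rsi (A := [set a; b; c])).
    apply: supp_sub => g; rewrite !inE !negb_or => /andP[/andP[ga gb] gc]; rewrite !addE !scE.
    case: (eqVneq g ab) => [->|gab]; first by rewrite (z2 ab) ?(z3 ab) ?inE; neqs => //; field; rewrite ?b1 ?b2 ?b3.
    case: (eqVneq g ac) => [->|gac]; first by rewrite (z1 ac) ?(z3 ac) ?inE; neqs => //; field; rewrite ?b1 ?b2 ?b3.
    case: (eqVneq g bc) => [->|gbc]; first by rewrite (z1 bc) ?(z2 bc) ?inE; neqs => //; field; rewrite ?b1 ?b2 ?b3.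
    by rewrite (tz g) ?(z1 g) ?(z2 g) ?(z3 g) ?inE; neqs => //; ring.
  apply/depP=> -[Z [Zi Z0 ZS]].
  have ZQ : Z \subset [set a; b; c; d] by apply: subset_trans ZS _; apply: subsetUl.
  have eqZ := circ_min Qc Zi ZQ Z0.
  by have := subsetP ZS d; rewrite eqZ !inE eqxx orbT; neqs => /(_ isT).
have ea : ta ab / be1 ab * k1 + ta ac / be2 ac * k2 = 0.
  have /ffunP/(_ a) := si0; rewrite !addE !scE (tz a) ?(z3 a) ?inE; neqs => //; rewrite ffunE e1a e2a => h.
  have a0 : al a != 0 by apply: (n0 _ _ _ sal); rewrite !inE eqxx.
  apply: (mulIf a0); rewrite mul0r -[RHS]oppr0 -h; ring.
have eb : ta ab / be1 ab * k1 + ta bc / be3 bc * k3 = 0.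
  have /ffunP/(_ b) := si0; rewrite !addE !scE (tz b) ?(z2 b) ?inE; neqs => //; rewrite ffunE e1b e3b => h.
  have a0 : al b != 0 by apply: (n0 _ _ _ sal); rewrite !inE eqxx ?orbT.
  apply: (mulIf a0); rewrite mul0r -[RHS]oppr0 -h; ring.
have ec : ta ac / be2 ac * k2 + ta bc / be3 bc * k3 = 0.
  have /ffunP/(_ c) := si0; rewrite !addE !scE (tz c) ?(z1 c) ?inE; neqs => //; rewrite ffunE e2c e3c => h.
  have a0 : al c != 0 by apply: (n0 _ _ _ sal); rewrite !inE eqxx ?orbT.
  apply: (mulIf a0); rewrite mul0r -[RHS]oppr0 -h; ring.
move: ea eb ec; set r := _ * k1; set s := _ * k2; set t := _ * k3 => ea eb ec.
have r0 : r != 0 by rewrite !mulf_neq0 ?invr_eq0.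
apply: (mulIf r0); rewrite mul0r.
have -> : 2%:R * r = (r + s) + (r + t) - (s + t) by ring.
by rewrite ea eb ec subr0 addr0.
Qed.

End FanoCharacteristic.

(** * Computing with coordinate vectors over F_2 *)

Definition addl (v w : seq bool) : seq bool := [seq p.1 (+) p.2 | p <- zip v w].
Definition suml n (vs : seq (seq bool)) : seq bool := foldr addl (nseq n false) vs.
Definition null (v : seq bool) : bool := all negb v.
(** The vectors [vs] sum to zero modulo [vf]: by [mod_cycle], elements with these labels form a
    cycle once the element labelled [vf] is contracted. As labels are lists of booleans,
    configurations can be checked by evaluation. *)
Definition vanish n vf vs : bool := null (suml n vs) || null (suml n (vf :: vs)).

(* Seven labels that become, modulo vf, the points of a Fano plane. *)
Definition fano_labels n vf vs : bool :=
  if vs is [:: a; b; c; ab; ac; bc; d] then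
    [&& uniq (vf :: vs), all (fun v => ~~ vanish n vf [:: v]) vs,
        pairwise (fun v w => ~~ vanish n vf [:: v; w]) vs,
        [&& vanish n vf [:: a; b; ab], vanish n vf [:: a; c; ac],
            vanish n vf [:: b; c; bc] & vanish n vf [:: ab; ac; bc]] &
        [&& vanish n vf [:: d; c; ab], vanish n vf [:: d; b; ac] &
            vanish n vf [:: d; a; bc]]]
  else false.

Lemma seq1E (T : finType) (u : T) : [set e in [:: u]] = [set u].
Proof. by apply/setP=> g; rewrite !inE. Qed.

Lemma seq2E (T : finType) (u v : T) : [set e in [:: u; v]] = [set u; v].
Proof. by apply/setP=> g; rewrite !inE. Qed.

Lemma seq3E (T : finType) (u v w : T) : [set e in [:: u; v; w]] = [set u; v; w].
Proof. by apply/setP=> g; rewrite !inE -orbA. Qed.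

Lemma pairwise_in (T : eqType) (r : rel T) l e f : symmetric r -> pairwise r l ->
  e \in l -> f \in l -> e != f -> r e f.
Proof.
move=> rS; elim: l => //= g l IH /andP[/allP rg rl]; rewrite !inE.
case/orP=> [/eqP->|el]; case/orP=> [/eqP->|fl].
- by rewrite eqxx.
- by move=> _; apply: rg.
- by move=> _; rewrite rS; apply: rg.
- exact: IH.
Qed.

Section Labels.
Variables (T : finType) (ZZ : {set {set T}}) (s : seq T).
Hypothesis bZ : bspace ZZ.
Let B := [set e in s].
Hypothesis iB : ~~ dep ZZ B.

Definition lab e : seq bool := [seq b \in coords ZZ B e | b <- s].

Lemma lab_coord e (S : {set T}) : S \subset B -> sdiff [set e] S \in ZZ ->
  (e \in cl ZZ B) * (lab e = [seq b \in S | b <- s]).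
Proof. by move=> SB Si; rewrite /lab !(coordE bZ iB SB Si). Qed.

Lemma lab_par l : uniq l ->
  [seq b \in par ZZ B [set e in l] | b <- s] = suml (size s) (map lab l).
Proof.
elim: l => [_|e l IH /= /andP[el ul]].
  rewrite /= (_ : [set e in [::]] = set0) ?par0; last by apply/setP=> g; rewrite !inE.
  by elim: (s) => //= b s' ->; rewrite inE.
rewrite -/(suml _ _) -IH // (_ : [set e0 in e :: l] = e |: [set e in l]); last first.
  by apply/setP=> g; rewrite !inE.
rewrite parU1 ?inE // /lab /addl zip_map -map_comp.
by apply: eq_map => b; rewrite /= in_sdiff.
Qed.

Lemma list_cycle l : uniq l -> {subset l <= cl ZZ B} ->
  ([set e in l] \in ZZ) = null (suml (size s) (map lab l)).
Proof.
move=> ul lB; rewrite (coord_cycle bZ iB); last by apply/subsetP=> g; rewrite inE; apply: lB.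
rewrite -lab_par // /null all_map; apply/eqP/allP=> [-> b _ /=|H]; first by rewrite inE.
apply/setP=> b; rewrite [RHS]inE; apply/negP=> bp.
have := subsetP (par_sub ZZ B _) b bp; rewrite inE => /H /=; by rewrite bp.
Qed.

Lemma mod_cycle f l : uniq (f :: l) -> {subset f :: l <= cl ZZ B} ->
  ([set e in l] \in con f ZZ) = vanish (size s) (lab f) (map lab l).
Proof.
move=> /[dup] ufl /= /andP[fl ul] flB.
have -> : vanish (size s) (lab f) (map lab l) =
    ([set e in l] \in ZZ) || ([set e in f :: l] \in ZZ).
  rewrite !list_cycle //= => e el; apply: flB; by rewrite inE el orbT.
have eq_f : [set e in f :: l] = f |: [set e in l] by apply/setP=> g; rewrite !inE.
have nf : f \notin [set e in l] by rewrite inE.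
rewrite eq_f; apply/conP/orP=> [[Z Zi eqZ]|[li|li]].
- case fZ: (f \in Z); [right | left]; first by rewrite eqZ setD1K.
  by rewrite eqZ (_ : Z :\ f = Z) //; apply/setDidPl; rewrite disjoint_sym disjoints1 fZ.
- by exists [set e in l] => //; apply/esym/setDidPl; rewrite disjoint_sym disjoints1.
by exists (f |: [set e in l]); rewrite // setU1K.
Qed.

Lemma fano_minor (F : fieldType) f l : {subset f :: l <= cl ZZ B} ->
  fano_labels (size s) (lab f) (map lab l) -> frep F (dep (con f ZZ)) -> 2%:R = 0 :> F.
Proof.
case: l => [|a [|b [|c [|ab [|ac [|bc [|d [|? ?]]]]]]]] flB; try by [].
set l := [:: a; b; c; ab; ac; bc; d].
case/and5P=> ulab v1 v2 /and4P[L1 L2 L3 L4] /and3P[L5 L6 L7] [R rR].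
have ufl : uniq (f :: l) by apply: (map_uniq (f := lab)); exact: ulab.
have [fl ul] : f \notin l /\ uniq l by move/andP: ufl.
have mc l' : {subset l' <= l} -> uniq l' ->
    ([set e in l'] \in con f ZZ) = vanish (size s) (lab f) (map lab l').
  move=> sub u'; apply: mod_cycle.
    by rewrite cons_uniq u' andbT; apply: contra fl; apply: sub.
  by move=> e; rewrite inE => /orP[/eqP->|/sub el]; apply: flB; rewrite inE ?eqxx // el orbT.
have inl k : (k < 7)%N -> nth a l k \in l by move=> kl; apply: mem_nth.
have line i j k : (i < 7)%N -> (j < 7)%N -> (k < 7)%N -> uniq [:: i; j; k] ->
    vanish (size s) (lab f) [:: lab (nth a l i); lab (nth a l j); lab (nth a l k)] ->
    [set nth a l i; nth a l j; nth a l k] \in con f ZZ.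
  move=> i7 j7 k7 ijk; rewrite -seq3E mc //.
    move=> e; rewrite !in_cons in_nil orbF => /or3P[] /eqP->; exact: inl.
  by move: ijk; rewrite /= !inE !nth_uniq.
apply: (fano_char2 (bspace_con f bZ) rR (a := a) (b := b) (c := c) (ab := ab) (ac := ac) (bc := bc) (d := d)).
- exact: ul.
- move=> Z Zi Z0 Zl.
  case: (ltngtP #|Z| 1) => [|Z1|/eqP/cards1P[e eqZ]].
  + by rewrite ltnS leqn0 cards_eq0 (negPf Z0).
  + rewrite ltn_neqAle Z1 andbT eq_sym; apply/negP=> /cards2P[e [e' [ee' eqZ]]].
    have el : e \in l by apply: (subsetP Zl); rewrite eqZ !inE eqxx.
    have el' : e' \in l by apply: (subsetP Zl); rewrite eqZ !inE eqxx orbT.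
    pose r e e' := [set e; e'] \notin con f ZZ.
    suff : r e e' by rewrite /r -eqZ Zi.
    apply: (pairwise_in (l := l)) => //; first by move=> u v; rewrite /r setUC.
    have p2 : pairwise _ (map lab l) := v2; rewrite pairwise_map in p2.
    move: (ul); rewrite uniq_pairwise => u2.
    have := conj u2 p2; rewrite !(rwP andP) -pairwise_relI.
    apply: sub_in_pairwise (_ : all (mem l) l); last by apply/allP.
    move=> u v ul' vl /= /andP[uv]; rewrite /r -seq2E mc //.
      by move=> g; rewrite in_cons mem_seq1 => /orP[] /eqP->.
    by rewrite /= inE uv.
  have el : e \in l by apply: (subsetP Zl); rewrite eqZ !inE eqxx.
  have : ~~ vanish (size s) (lab f) [:: lab e].
    by move/allP: v1; apply; apply: map_f.
  by rewrite -(mc [:: e]) ?seq1E -?eqZ ?Zi // => g; rewrite mem_seq1 => /eqP->.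
- exact: (line 0 1 3)%N.
- exact: (line 0 2 4)%N.
- exact: (line 1 2 5)%N.
- exact: (line 3 4 5)%N.
- exact: (line 6 2 3)%N.
- exact: (line 6 1 4)%N.
- exact: (line 6 0 5)%N.
Qed.

End Labels.

Section MoreLabels.
Variables (T : finType) (ZZ : {set {set T}}) (s : seq T).
Hypothesis bZ : bspace ZZ.
Let ZD := bZ.2.
Let B := [set e in s].
Hypothesis iB : ~~ dep ZZ B.

Lemma lab_eqP e f : lab ZZ s e = lab ZZ s f -> coords ZZ B e = coords ZZ B f.
Proof.
move/eq_in_map => H; apply/setP=> b; case: (boolP (b \in s)) => [/H //|bs].
have nb g : b \in coords ZZ B g = false.
  by apply/negP=> /(subsetP (coord_sub ZZ B g)); rewrite inE (negPf bs).
by rewrite !nb.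
Qed.

Lemma same_label e f : e \in cl ZZ B -> f \in cl ZZ B -> e != f ->
  lab ZZ s e = lab ZZ s f -> [set e; f] \in ZZ.
Proof.
move=> /coordP/andP[_ Ei] /coordP/andP[_ Fi] ef /lab_eqP eqS; rewrite eqS in Ei.
suff -> : [set e; f] = sdiff (sdiff [set e] (coords ZZ B f)) (sdiff [set f] (coords ZZ B f)) by apply: ZD.
apply/setP=> g; rewrite !in_sdiff !inE.
by case: (eqVneq g e) => [->|_]; rewrite ?(negPf ef); case: (_ \in _); case: (g == f).
Qed.

Lemma zero_label e : e \in cl ZZ B -> lab ZZ s e = nseq (size s) false -> [set e] \in ZZ.
Proof.
move=> /coordP/andP[_ Ei] lab0; suff S0 : coords ZZ B e = set0 by rewrite S0 sdiff0 in Ei.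
apply/setP=> b; rewrite inE; apply/negP=> bc.
have := subsetP (coord_sub ZZ B e) b bc; rewrite inE => bs.
have : true \in lab ZZ s e by apply/mapP; exists b.
by rewrite lab0 mem_nseq andbF.
Qed.

Lemma lab_base e : e \in s -> (e \in cl ZZ B) * (lab ZZ s e = [seq b == e | b <- s]).
Proof.
move=> es; have eB : e \in B by rewrite inE.
split; first by rewrite (coord_id bZ iB eB).
by rewrite /lab (coord_id bZ iB eB); apply: eq_map => b; rewrite inE.
Qed.

Lemma lab_cycle X e : X \in ZZ -> e \in X -> X :\ e \subset B ->
  (e \in cl ZZ B) * (lab ZZ s e = [seq b \in X :\ e | b <- s]).
Proof.
move=> Xi eX XB; apply: lab_coord => //.
rewrite (_ : sdiff _ _ = X) //; apply/setP=> g; rewrite in_sdiff !inE.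
by case: (eqVneq g e) => [->|].
Qed.

End MoreLabels.

(* The common features of the Fano plane (#|J| = 3) and its dual (#|J| = 4). *)
Definition seven_core (T : finType) (F : fieldType) (ZZ : {set {set T}}) (Q J : {set T}) :=
  [/\ [/\ #|Q| = 7, J \subset Q, ~~ dep ZZ J & #|J| = 3 \/ #|J| = 4],
      forall Z, Z \in ZZ -> Z != set0 -> Z \subset Q -> (#|J| <= #|Z|)%N,
      Q \subset cl ZZ J,
      forall e Z, e \notin Q -> Z \in ZZ -> e \in Z -> [set e] \notin ZZ ->
        exists2 a, a \in Q & [set a; e] \in ZZ &
      forall c, frep F (dep (del c ZZ)) -> c \in Q /\ forall e, e != c -> [set c; e] \notin ZZ].

(** * Seven points that carry a minimal counterexample *)

Section Core.
Variables (T : finType) (F : fieldType) (ZZ : {set {set T}}).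
Hypothesis bZ : bspace ZZ.
Let ZD := bZ.2.
Hypotheses (nrep : ~ frep F (dep ZZ))
  (frc : forall e Z, [set e] \notin ZZ -> Z \in ZZ -> e \in Z -> frep F (dep (con e ZZ))).
Variable A : {set T}.
Hypothesis crA : critical F A (restr A ZZ).

Lemma nonloopA e : e \in A -> [set e] \notin ZZ.
Proof.
by move=> eA; apply: contra (crit_nonloop crA e) => ei; rewrite inE ei sub1set.
Qed.

Lemma cycleA e : e \in A -> exists2 Z, Z \in ZZ & e \in Z.
Proof.
move=> eA; have [C /circ_in] := crit_cover crA eA.
by rewrite inE => /andP[Ci _] eC; exists C.
Qed.

Lemma conA e : e \in A -> frep F (dep (con e ZZ)).
Proof.
move=> eA; have [Z Zi eZ] := cycleA eA; apply: (frc _ Zi eZ); exact: nonloopA.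
Qed.

(** If A did not span e, contracting e would leave the restriction to A unchanged, although this
    contraction is representable. *)
Lemma crit_closes e Z : [set e] \notin ZZ -> Z \in ZZ -> e \in Z -> e \notin A ->
  exists Y, [/\ Y \in ZZ, e \in Y & Y \subset e |: A].
Proof.
move=> e0 Zi eZ eA; apply: NNPP => no; apply: (crit_nrep crA).
suff <- : restr A (con e ZZ) = restr A ZZ by apply: frep_restr; apply: frc eZ.
apply/setP=> Y; rewrite !inE; case YA: (Y \subset A); rewrite ?andbF // !andbT.
apply/conP/idP=> [[X Xi eqY]|Yi].
  case eX: (e \in X); last first.
    by rewrite eqY (_ : X :\ e = X) //; apply/setDidPl; rewrite disjoint_sym disjoints1 eX.
  by case: no; exists X; split=> //; rewrite -(setD1K eX) -eqY setUS.
exists Y => //; apply/esym/setDidPl; rewrite disjoint_sym disjoints1.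
by apply: contra eA; apply: (subsetP YA).
Qed.

Lemma all_closed J e Z : ~~ dep ZZ J -> A \subset cl ZZ J -> [set e] \notin ZZ -> Z \in ZZ -> e \in Z ->
  e \in cl ZZ J.
Proof.
move=> iJ AJ e0 Zi eZ; case eA: (e \in A); first exact: subsetP AJ e eA.
have [Y [Yi eY YS]] := crit_closes e0 Zi eZ (negbT eA).
apply: (cl_cycle bZ Yi eY); apply: subset_trans AJ.
by rewrite subDset.
Qed.

Lemma girthA Z : Z \in ZZ -> Z != set0 -> Z \subset A -> (2 < #|Z|)%N.
Proof.
move=> Zi Z0 ZA; have Zr : Z \in restr A ZZ by rewrite inE Zi.
case: (ltngtP #|Z| 1) => [|Z1|/eqP/cards1P[e eqZ]].
- by rewrite ltnS leqn0 cards_eq0 (negPf Z0).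
- rewrite ltn_neqAle Z1 andbT eq_sym; apply/negP=> /cards2P[e [f [ef eqZ]]].
  by have := crit_nonparallel crA ef; rewrite -eqZ Zr.
by have := crit_nonloop crA e; rewrite -eqZ Zr.
Qed.

(** The last clause of [seven_core] is the point. An element c with representable deletion lies in
    A, as otherwise the critical restriction would be a restriction of that deletion; it has no
    parallel element by [frep_parallel]; and outside the seven points it would have one. *)
Lemma core_of s l : uniq l -> size l = 7 -> {subset l <= A} -> {subset s <= l} -> uniq s ->
    size s = 3 \/ size s = 4 -> ~~ dep ZZ [set e in s] ->
    (forall Z, Z \in ZZ -> Z != set0 -> Z \subset l -> (size s <= #|Z|)%N) ->
    {subset l <= cl ZZ [set e in s]} ->
    (forall e Z, e \notin l -> Z \in ZZ -> e \in Z -> [set e] \notin ZZ ->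
        exists2 a, a \in l & [set a; e] \in ZZ) ->
  seven_core F ZZ [set e in l] [set e in s].
Proof.
move=> ul l7 lA sl us s34 iJ girth lcl par.
have parA c e : c \in A -> e != c -> frep F (dep (del c ZZ)) -> [set c; e] \notin ZZ.
  move=> cA ec fc; apply/negP=> cei; apply: nrep; apply: (frep_parallel bZ _ _ fc); first by rewrite eq_sym; exact: ec.
  apply/circP; split=> //; first by apply/set0Pn; exists c; rewrite !inE eqxx.
  have c0 := nonloopA cA.
  have e0 : [set e] \notin ZZ.
    apply: contra c0 => ei; suff -> : [set c] = sdiff [set c; e] [set e] by apply: ZD.
    by apply/setP=> g; rewrite !inE; case: (eqVneq g c) => [->|_]; [rewrite eq_sym (negPf ec) | case: (g == e)].
  move=> Z Zi Z0 Zce; apply/eqP; rewrite eqEsubset Zce subUset !sub1set /=.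
  apply/andP; split; apply: contraTT Zi => nZ.
    suff -> : Z = [set e] by [].
    apply/eqP; rewrite eqEcard cards1 card_gt0 Z0 andbT; apply/subsetP=> g gZ.
    have := subsetP Zce g gZ; rewrite !inE; case: (eqVneq g c) => [gc|//]; by rewrite gc (negPf nZ) in gZ.
  suff -> : Z = [set c] by [].
  apply/eqP; rewrite eqEcard cards1 card_gt0 Z0 andbT; apply/subsetP=> g gZ.
  have := subsetP Zce g gZ; rewrite !inE; case: (eqVneq g e) => [gc|]; rewrite ?orbF //.
  by rewrite gc (negPf nZ) in gZ.
split.
- split=> //; first by rewrite cardsE (card_uniqP ul).
    by apply/subsetP=> e; rewrite !inE; apply: sl.
  by rewrite cardsE (card_uniqP us).
- move=> Z Zi Z0 Zl; rewrite cardsE (card_uniqP us); apply: girth => //.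
  by apply/subsetP=> e /(subsetP Zl); rewrite inE.
- by apply/subsetP=> e; rewrite inE; apply: lcl.
- move=> e Z; rewrite inE => el Zi eZ e0; have [a al aei] := par e Z el Zi eZ e0.
  by exists a; rewrite ?inE.
move=> c fc.
have cA : c \in A.
  apply/negPn/negP=> cA; apply: (crit_nrep crA).
  rewrite (_ : restr A ZZ = restr A (del c ZZ)); first exact: frep_restr.
  apply/setP=> Z; rewrite !inE; case ZA: (Z \subset A); rewrite ?andbF // !andbT.
  case: (Z \in ZZ) => //=; apply/esym; by apply: contra cA; apply: (subsetP ZA).
split=> [|e ec]; last exact: parA.
rewrite inE; apply/negPn/negP=> cl'; have [Z Zi cZ] := cycleA cA.
have [a al aci] := par c Z cl' Zi cZ (nonloopA cA).
have ac : a != c by apply: contraNneq cl' => <-.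
by have := parA c a cA ac fc; rewrite setUC aci.
Qed.

(** The labels of the seven points are all the nonzero vectors of length three, so any other element
    in a cycle is a loop or has the label of one of them, to which it is then parallel. *)
Lemma fano_core x y b q p p' q' : fano_conf A (restr A ZZ) x y b q p p' q' ->
  exists Q J, seven_core F ZZ Q J.
Proof.
case=> [[xy xb yb] L1 [iB qx qy] [px pq L2] [[p'y p'q L3] [q'x q'y q'q L4] span]].
have inr X : X \in restr A ZZ -> X \in ZZ /\ X \subset A by rewrite inE => /andP.
have [L1i L1A] := inr _ L1; have [L2i L2A] := inr _ L2; have [L3i L3A] := inr _ L3.
have [L4i L4A] := inr _ L4.
pose s := [:: x; y; q]; pose l := [:: x; y; b; q; p; p'; q'].
have Es : [set e in s] = [set x; y; q] by rewrite seq3E.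
have xA : x \in A by apply: (subsetP L1A); rewrite !inE eqxx.
have yA : y \in A by apply: (subsetP L1A); rewrite !inE eqxx orbT.
have bA : b \in A by apply: (subsetP L1A); rewrite !inE eqxx orbT.
have qA : q \in A by apply: (subsetP L2A); rewrite !inE eqxx orbT.
have pA : p \in A by apply: (subsetP L2A); rewrite !inE eqxx orbT.
have p'A : p' \in A by apply: (subsetP L3A); rewrite !inE eqxx orbT.
have q'A : q' \in A by apply: (subsetP L4A); rewrite !inE eqxx orbT.
have sA : [set e in s] \subset A by rewrite Es !subUset !sub1set xA yA qA.
have iJ : ~~ dep ZZ [set e in s].
  rewrite Es; apply: contra iB => /depP[Z [Zi Z0 ZS]]; apply/depP; exists Z; split=> //.
  by rewrite inE Zi (subset_trans ZS) // -Es.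
have xs : x \in s by rewrite !inE eqxx.
have ys : y \in s by rewrite !inE eqxx orbT.
have qs : q \in s by rewrite !inE eqxx !orbT.
have [cx lx] := lab_base bZ iJ xs; have [cy ly] := lab_base bZ iJ ys.
have [cq lq] := lab_base bZ iJ qs.
have [cb lb] : (b \in cl ZZ [set e in s]) * (lab ZZ s b = [seq g \in [set x; y; b] :\ b | g <- s]).
  apply: lab_cycle => //; first by rewrite !inE eqxx orbT.
  by rewrite Es; sets.
have [cp lp] : (p \in cl ZZ [set e in s]) * (lab ZZ s p = [seq g \in [set x; q; p] :\ p | g <- s]).
  apply: lab_cycle => //; first by rewrite !inE eqxx orbT.
  by rewrite Es; sets.
have [cp' lp'] : (p' \in cl ZZ [set e in s]) * (lab ZZ s p' = [seq g \in [set y; q; p'] :\ p' | g <- s]).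
  apply: lab_cycle => //; first by rewrite !inE eqxx orbT.
  by rewrite Es; sets.
have [cq' lq'] : (q' \in cl ZZ [set e in s]) * (lab ZZ s q' = [seq g \in [set x; y; q; q'] :\ q' | g <- s]).
  apply: lab_cycle => //; first by rewrite !inE eqxx orbT.
  by rewrite Es; sets.
move: lx ly lq lb lp lp' lq'; rewrite /= !inE; neqs => lx ly lq lb lp lp' lq'.
rewrite !andNb in lb lp lp'.
have lA : {subset l <= A} by apply/allP; rewrite /= xA yA bA qA pA p'A q'A.
have AJ : A \subset cl ZZ [set e in s].
  apply/subsetP=> g gA; case: (boolP (g \in [set x; y; q])) => [|gs].
    by rewrite -Es inE => gs; rewrite (lab_base bZ iJ gs).
  apply: dep_cl => //; rewrite Es; have /depP[Z [Zi Z0 ZS]] := span g gA gs.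
  by apply/depP; exists Z; split=> //; case: (inr Z Zi).
have ml : map (lab ZZ s) l = [:: [:: true; false; false]; [:: false; true; false];
    [:: true; true; false]; [:: false; false; true]; [:: true; false; true];
    [:: false; true; true]; [:: true; true; true]].
  by rewrite /= lx ly lb lq lp lp' lq'.
have ul : uniq l by apply: (map_uniq (f := lab ZZ s)); rewrite ml.
exists [set e in l], [set e in s]; apply: core_of => //.
- by apply/allP; rewrite /= !inE !eqxx !orbT.
- by rewrite /= !inE; neqs.
- by left.
- move=> Z Zi Z0 Zl; apply: girthA => //.
  by apply/subsetP=> e /(subsetP Zl) el; apply: lA.
- by apply/allP; rewrite /= cx cy cb cq cp cp' cq'.
move=> e Z el Zi eZ e0; have ecl := all_closed iJ AJ e0 Zi eZ.
have [b1 [b2 [b3 le]]] : exists b1 b2 b3, lab ZZ s e = [:: b1; b2; b3] by do 3!eexists.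
have : (lab ZZ s e == nseq (size s) false) || (lab ZZ s e \in map (lab ZZ s) l).
  by rewrite ml le; move: b1 b2 b3 {le} => [] [] [].
case/orP=> [/eqP/(zero_label ecl)|/mapP[a al eqla]]; first by rewrite (negPf e0).
exists a => //; apply: (same_label bZ _ ecl).
- by apply: (subsetP AJ); apply: lA.
- by apply: contraNneq el => <-.
- by [].
Qed.

(** Only seven of the fifteen nonzero labels of length four occur in the dual Fano plane, so the
    other eight must be excluded one by one. *)
Lemma f7star_core x y z1 z2 p1 p2 q :
  (forall a b c, a != b -> a != c -> b != c -> [set a; b; c] \notin restr A ZZ) ->
  f7star A (restr A ZZ) x y z1 z2 p1 p2 q -> exists Q J, seven_core F ZZ Q J.
Proof.
move=> tf [ul iB [L1 L2 L3] span].
have inr X : X \in restr A ZZ -> X \in ZZ /\ X \subset A by rewrite inE => /andP.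
have [L1i L1A] := inr _ L1; have [L2i L2A] := inr _ L2; have [L3i L3A] := inr _ L3.
pose s := [:: x; y; z1; z2]; set l := [:: x; y; z1; z2; p1; p2; q] in ul.
have Es : [set e in s] = [set x; y; z1; z2] by apply/setP=> g; rewrite !inE -!orbA.
have xA : x \in A by apply: (subsetP L1A); rewrite !inE eqxx.
have yA : y \in A by apply: (subsetP L1A); rewrite !inE eqxx orbT.
have z1A : z1 \in A by apply: (subsetP L1A); rewrite !inE eqxx orbT.
have z2A : z2 \in A by apply: (subsetP L2A); rewrite !inE eqxx orbT.
have p1A : p1 \in A by apply: (subsetP L1A); rewrite !inE eqxx orbT.
have p2A : p2 \in A by apply: (subsetP L2A); rewrite !inE eqxx orbT.
have qA : q \in A by apply: (subsetP L3A); rewrite !inE eqxx orbT.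
have iJ : ~~ dep ZZ [set e in s].
  rewrite Es; apply: contra iB => /depP[Z [Zi Z0 ZS]]; apply/depP; exists Z; split=> //.
  by rewrite inE Zi (subset_trans ZS) // !subUset !sub1set xA yA z1A z2A.
have lA : {subset l <= A} by apply/allP; rewrite /= xA yA z1A z2A p1A p2A qA.
have xs : x \in s by rewrite !inE eqxx.
have ys : y \in s by rewrite !inE eqxx orbT.
have z1s : z1 \in s by rewrite !inE eqxx !orbT.
have z2s : z2 \in s by rewrite !inE eqxx !orbT.
have [cx lx] := lab_base bZ iJ xs; have [cy ly] := lab_base bZ iJ ys.
have [c1 l1] := lab_base bZ iJ z1s; have [c2 l2] := lab_base bZ iJ z2s.
have [cp1 lp1] : (p1 \in cl ZZ [set e in s]) * (lab ZZ s p1 = [seq g \in [set x; y; z1; p1] :\ p1 | g <- s]).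
  apply: lab_cycle => //; first by rewrite !inE eqxx orbT.
  by rewrite Es; sets.
have [cp2 lp2] : (p2 \in cl ZZ [set e in s]) * (lab ZZ s p2 = [seq g \in [set x; y; z2; p2] :\ p2 | g <- s]).
  apply: lab_cycle => //; first by rewrite !inE eqxx orbT.
  by rewrite Es; sets.
have [cq lq] : (q \in cl ZZ [set e in s]) * (lab ZZ s q = [seq g \in [set x; z1; z2; q] :\ q | g <- s]).
  apply: lab_cycle => //; first by rewrite !inE eqxx orbT.
  by rewrite Es; sets.
have us : uniq s by move: ul; rewrite (_ : l = s ++ [:: p1; p2; q]) // cat_uniq => /and3P[].
move: lx ly l1 l2 lp1 lp2 lq; move: (ul); rewrite /l /= !inE !negb_or.
case/and5P=> [/and5P[n1 n2 n3 n4 /andP[n5 n6]] /and5P[m1 m2 m3 m4 m5] /and4P[o1 o2 o3 o4] /and3P[r1 r2 r3] /and3P[/andP[r4 r5] r6 _]].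
neqs => lx ly l1 l2 lp1 lp2 lq.
have AJ : A \subset cl ZZ [set e in s].
  apply/subsetP=> g gA; case: (boolP (g \in [set x; y; z1; z2])) => [|gs].
    by rewrite -Es inE => gs; rewrite (lab_base bZ iJ gs).
  apply: dep_cl => //; rewrite Es; have /depP[Z [Zi Z0 ZS]] := span g gA gs.
  by apply/depP; exists Z; split=> //; case: (inr Z Zi).
have ml : map (lab ZZ s) l = [:: [:: true; false; false; false]; [:: false; true; false; false];
    [:: false; false; true; false]; [:: false; false; false; true]; [:: true; true; true; false];
    [:: true; true; false; true]; [:: true; false; true; true]].
  by rewrite /= lx ly l1 l2 lp1 lp2 lq.
have lcl : {subset l <= cl ZZ [set e in s]} by apply/allP; rewrite /= cx cy c1 c2 cp1 cp2 cq.
exists [set e in l], [set e in s]; apply: core_of => //.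
- by apply/allP; rewrite /= !inE !eqxx !orbT.
- by right.
- move=> Z Zi Z0 Zl.
  have ZA : Z \subset A by apply/subsetP=> e /(subsetP Zl) el; apply: lA.
  rewrite ltn_neqAle girthA // andbT; apply/negP=> Z3.
  have [a aZ] := set0Pn _ Z0; have : #|Z :\ a| == 2 by move: Z3; rewrite (cardsD1 a) aZ eqSS eq_sym.
  case/cards2P=> b [c [bc eqZ]].
  have /setP/(_ b) := eqZ; rewrite !inE eqxx => /andP[ba _].
  have /setP/(_ c) := eqZ; rewrite !inE eqxx orbT => /andP[ca _].
  have := tf a b c; rewrite eq_sym ba eq_sym ca bc -setUA -eqZ setD1K // inE Zi ZA => /(_ isT isT isT).
  by [].
move=> e Z el Zi eZ e0; have ecl := all_closed iJ AJ e0 Zi eZ.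
have [b1 [b2 [b3 [b4 le]]]] : exists b1 b2 b3 b4, lab ZZ s e = [:: b1; b2; b3; b4] by do 4!eexists.
(* A field of characteristic two represents every binary matroid, so [nrep] forbids a Fano plane in
   a representable contraction. *)
have fano f k : {subset f :: k <= e :: l} -> frep F (dep (con f ZZ)) ->
    fano_labels 4 (lab ZZ s f) (map (lab ZZ s) k) -> false.
  move=> kl fc fl; case: nrep; apply: char2_frep => //; apply: (fano_minor bZ iJ _ fl fc) => g gk.
  by have := kl g gk; rewrite inE => /orP[/eqP->|/lcl].
have fece : frep F (dep (con e ZZ)) by apply: frc eZ.
(* A new label makes a contraction contain a Fano plane, whence 2 = 0 in F. *)
have : (lab ZZ s e == nseq (size s) false) || (lab ZZ s e \in map (lab ZZ s) l).
  have sub k : all (mem (e :: l)) k -> {subset k <= e :: l} by move/allP.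
  move: b1 b2 b3 b4 le => [] [] [] [] le; rewrite ml le //.
  - apply: (fano x [:: y; z1; z2; p1; p2; q; e] _ (conA xA)); first by apply: sub; rewrite /= !inE !eqxx !orbT.
    by rewrite /= le lx ly l1 l2 lp1 lp2 lq.
  - apply: (fano q [:: x; y; z1; e; z2; p2; p1] _ (conA qA)); first by apply: sub; rewrite /= !inE !eqxx !orbT.
    by rewrite /= le lx ly l1 l2 lp1 lp2 lq.
  - apply: (fano p2 [:: x; y; z1; z2; e; q; p1] _ (conA p2A)); first by apply: sub; rewrite /= !inE !eqxx !orbT.
    by rewrite /= le lx ly l1 l2 lp1 lp2 lq.
  - apply: (fano p1 [:: x; y; z2; z1; e; q; p2] _ (conA p1A)); first by apply: sub; rewrite /= !inE !eqxx !orbT.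
    by rewrite /= le lx ly l1 l2 lp1 lp2 lq.
  - apply: (fano e [:: x; y; z1; q; p2; z2; p1] _ fece); first by apply: sub; rewrite /= !inE !eqxx !orbT.
    by rewrite /= le lx ly l1 l2 lp1 lp2 lq.
  - apply: (fano z2 [:: x; y; z1; p2; q; e; p1] _ (conA z2A)); first by apply: sub; rewrite /= !inE !eqxx !orbT.
    by rewrite /= le lx ly l1 l2 lp1 lp2 lq.
  - apply: (fano z1 [:: x; y; z2; p1; q; e; p2] _ (conA z1A)); first by apply: sub; rewrite /= !inE !eqxx !orbT.
    by rewrite /= le lx ly l1 l2 lp1 lp2 lq.
  - apply: (fano y [:: x; z1; z2; p1; p2; e; q] _ (conA yA)); first by apply: sub; rewrite /= !inE !eqxx !orbT.
    by rewrite /= le lx ly l1 l2 lp1 lp2 lq.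
case/orP=> [/eqP/(zero_label ecl)|/mapP[a al eqla]]; first by rewrite (negPf e0).
exists a => //; apply: (same_label bZ _ ecl).
- exact: lcl.
- by apply: contraNneq el => <-.
- by [].
Qed.
End Core.

Lemma exists_core (T : finType) (F : fieldType) (ZZ : {set {set T}}) : bspace ZZ -> ~ frep F (dep ZZ) ->
    (forall e Z, [set e] \notin ZZ -> Z \in ZZ -> e \in Z -> frep F (dep (con e ZZ))) ->
  exists Q J, seven_core F ZZ Q J.
Proof.
move=> bZ nrep frc; have [A crA] := exists_critical bZ nrep frc.
case: (critical_config crA) => [|[tf]].
  by move=> [x [y [b [q [p [p' [q' /(fano_core bZ nrep frc crA)]]]]]]].
by move=> [x [y [z1 [z2 [p1 [p2 [q /(f7star_core bZ nrep frc crA tf)]]]]]]].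
Qed.

(** * Matroid minors and cycle systems *)

Section Matroid.
Variables (T : finType) (M : matroid T).
Implicit Types A B D N X Y : {set T}.
Implicit Types e f : T.

Lemma dep_mono A B : A \subset B -> dependent M A -> dependent M B.
Proof. by move=> AB; apply: contra; apply: indepS. Qed.

Lemma circuitP D :
  reflect (dependent M D /\ forall e, e \in D -> indep M (D :\ e)) (circuit M D).
Proof.
apply: (iffP minsetP) => [[Dd Dm]|[Dd Dm]]; split=> //.
  move=> e eD; apply: contraT => De; have := Dm _ De (subsetDl _ _).
  by move/setP/(_ e); rewrite !inE eqxx eD.
move=> B Bd BD; apply/eqP; rewrite eqEsubset BD; apply: contraT => /subsetPn[e eD eB].
have := Dm e eD; rewrite -[indep _ _]negbK => /negP[]; apply: dep_mono Bd.
by rewrite subsetD1 BD.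
Qed.

Lemma dep_circuit A : dependent M A -> exists2 D, circuit M D & D \subset A.
Proof. by move=> /minset_exists[D Dm DA]; exists D. Qed.

Lemma circuit_dep D : circuit M D -> dependent M D.
Proof. by case/circuitP. Qed.

Lemma circuit_indep D e : circuit M D -> e \in D -> indep M (D :\ e).
Proof. by case/circuitP=> _; apply. Qed.

Lemma circuit_neq0 D : circuit M D -> D != set0.
Proof. by case/circuitP=> Dd _; apply: contraTneq Dd => ->; rewrite /dependent indep0. Qed.

Lemma circuit_sub D A : circuit M D -> indep M A -> D \subset A -> False.
Proof. by move=> /circuit_dep Dd iA DA; have := dep_mono DA Dd; rewrite /dependent iA. Qed.

Lemma circuit_inj D1 D2 : circuit M D1 -> circuit M D2 -> D1 \subset D2 -> D1 = D2.
Proof. by move=> /circuit_dep d1 /minsetP[_ m2]; apply: m2. Qed.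

Lemma indep_ext A B : indep M A -> indep M B ->
  exists E, [/\ indep M E, A \subset E, E \subset A :|: B & (#|B| <= #|E|)%N].
Proof.
move=> iA iB; pose P E := indep M E && (E \subset A :|: B).
have PA : P A by rewrite /P iA subsetUl.
have [E /maxsetP[/andP[iE ES] Em] AE] := maxset_exists PA.
exists E; split=> //; rewrite leqNgt; apply/negP=> ltE.
have [x /setDP[xB xE] ix] := indep_aug iE iB ltE.
have := Em (x |: E); rewrite /P ix subUset ES sub1set !inE xB orbT subsetUr => /(_ isT isT).
by move/setP/(_ x); rewrite !inE eqxx (negPf xE).
Qed.

Definition spanned N e := (e \in N) || dependent M (e |: N).

Lemma span_card N A : indep M N -> indep M A -> (forall e, e \in A -> spanned N e) ->
  (#|A| <= #|N|)%N.
Proof.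
move=> iN iA sA; rewrite leqNgt; apply/negP=> ltA.
have [x /setDP[xA xN] ix] := indep_aug iN iA ltA.
by have := sA x xA; rewrite /spanned (negPf xN) /dependent ix.
Qed.

(** If N together with e were independent, extending D minus e would give an independent set of at
    least that size; it avoids e, so N spans all its elements although it is larger than N. *)
Lemma span_circuit N D e : indep M N -> circuit M D -> e \in D ->
  (forall f, f \in D -> f != e -> spanned N f) -> spanned N e.
Proof.
move=> iN Dc eD sD; apply/norP=> -[eN]; rewrite /dependent negbK => ieN.
have [E [iE DE EB ltE]] := indep_ext (circuit_indep Dc eD) ieN.
have eE : e \notin E.
  by apply/negP=> eE; apply: (circuit_sub Dc iE); rewrite -(setD1K eD) subUset sub1set eE.
have : (#|E| <= #|N|)%N.
  apply: span_card => // f fE; have := subsetP EB f fE; rewrite !inE.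
  case: (eqVneq f e) => [fe|fe /=]; first by rewrite -fe fE in eE.
  by case/orP=> [fD|fN]; [apply: sD | rewrite /spanned fN].
by apply/negP; rewrite -ltnNge; apply: leq_trans ltE; rewrite cardsU1 eN.
Qed.

Lemma max_indep X : exists N, [/\ indep M N, N \subset X & forall e, e \in X -> spanned N e].
Proof.
pose P N := indep M N && (N \subset X).
have P0 : P set0 by rewrite /P indep0 sub0set.
have [N /maxsetP[/andP[iN NX] Nm] _] := maxset_exists P0; exists N; split=> // e eX.
apply/norP=> -[eN]; rewrite /dependent negbK => ieN.
have := Nm (e |: N); rewrite /P ieN subUset NX sub1set eX subsetUr => /(_ isT isT).
by move/setP/(_ e); rewrite !inE eqxx (negPf eN).
Qed.

(** For f in D2 but not in D1, extend D2 minus f inside the union of D1 and D2 to an independent set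
    as large as the independent union minus e. It misses f, so it is the whole union minus f, which
    contains D1. *)
Lemma circuit_unique A e D1 D2 : indep M A -> circuit M D1 -> circuit M D2 ->
  D1 \subset e |: A -> D2 \subset e |: A -> D1 = D2.
Proof.
move=> iA c1 c2 s1 s2; apply/eqP; apply: contraT => ne.
have [f f2 f1] : exists2 f, f \in D2 & f \notin D1.
  by apply/subsetPn; apply: contra ne => /(circuit_inj c2 c1)->.
have iU : indep M ((D1 :|: D2) :\ e).
  by apply: indepS iA; rewrite subDset subUset s1 s2.
have [E [iE DE ES ltE]] := indep_ext (circuit_indep c2 f2) iU.
have fE : f \notin E.
  by apply/negP=> fE; apply: (circuit_sub c2 iE); rewrite -(setD1K f2) subUset sub1set fE.
have EU : E \subset (D1 :|: D2) :\ f.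
  by rewrite subsetD1 fE andbT; clear -ES; sets.
case: (circuit_sub c1 iE).
suff -> : E = (D1 :|: D2) :\ f by rewrite subsetD1 f1 subsetUl.
apply/eqP; rewrite eqEcard EU; apply: leq_trans ltE.
have cD g : g \in D1 :|: D2 -> #|(D1 :|: D2) :\ g| = #|D1 :|: D2|.-1.
  by move=> gU; rewrite [in RHS](cardsD1 g) gU.
case: (boolP (e \in D1 :|: D2)) => eU; first by rewrite !cD // inE f2 orbT.
apply: leq_trans (subset_leq_card (subsetDl _ _)) _.
by rewrite (_ : _ :\ e = D1 :|: D2) //; apply/setDidPl; rewrite disjoint_sym disjoints1.
Qed.

(* The ground set of the minors is still T, where e becomes a coloop. *)
Definition contract_indep e : pred {set T} := fun A => indep M (e |: A).
Definition delete_indep e : pred {set T} := fun A => indep M (A :\ e).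

End Matroid.

Section Minors.
Variables (T : finType) (M : matroid T) (e : T).
Implicit Types A B D N X Y : {set T}.

Lemma contract0 (ie : indep M [set e]) : contract_indep M e set0.
Proof. by rewrite /contract_indep setU0. Qed.

Lemma contractS A B : A \subset B -> contract_indep M e B -> contract_indep M e A.
Proof. by move=> AB; apply: indepS; apply: setUS. Qed.

Lemma contract_aug A B : contract_indep M e A -> contract_indep M e B -> (#|A| < #|B|)%N ->
  exists2 x, x \in B :\: A & contract_indep M e (x |: A).
Proof.
rewrite /contract_indep => iA iB ltAB; case: (boolP (e \in B :\: A)) => eBA.
  by exists e => //; rewrite setUA setUid.
have lt : (#|e |: A| < #|e |: B|)%N.
  move: eBA; rewrite !cardsU1 inE negb_and negbK => /orP[eA|eB].
    by rewrite eA; case: (e \in B) => //=; rewrite add0n; apply: ltnW.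
  by rewrite eB; case: (e \in A) => /=; rewrite ?add0n ?add1n // ltnS ltnW.
have [x /setDP[]] := indep_aug iA iB lt; rewrite !inE negb_or => /orP[/eqP->|xB]; first by rewrite eqxx.
by case/andP=> _ xA ix; exists x; rewrite ?inE ?xA // setUCA.
Qed.

Definition contract (ie : indep M [set e]) : matroid T :=
  Matroid (contract0 ie) contractS contract_aug.

Lemma delete0 : delete_indep M e set0.
Proof. by rewrite /delete_indep set0D indep0. Qed.

Lemma deleteS A B : A \subset B -> delete_indep M e B -> delete_indep M e A.
Proof. by move=> AB; apply: indepS; apply: setSD. Qed.

Lemma delete_aug A B : delete_indep M e A -> delete_indep M e B -> (#|A| < #|B|)%N ->
  exists2 x, x \in B :\: A & delete_indep M e (x |: A).
Proof.
rewrite /delete_indep => iA iB ltAB; case: (boolP (e \in B :\: A)) => eBA.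
  exists e => //; apply: indepS iA.
  by apply/subsetP=> g; rewrite !inE; case: (g == e).
have lt : (#|A :\ e| < #|B :\ e|)%N.
  move: eBA ltAB; rewrite (cardsD1 e A) (cardsD1 e B) inE negb_and negbK.
  by case: (e \in A); case: (e \in B) => //=; rewrite ?add0n ?add1n // => _ /ltnW.
have [x /setDP[]] := indep_aug iA iB lt; rewrite !inE negb_and negbK => /andP[xe xB].
rewrite (negPf xe) /= => xA ix; exists x; rewrite ?inE ?xA //.
by rewrite setDUl (_ : [set x] :\ e = [set x]) //; apply/setDidPl; rewrite disjoints1 inE.
Qed.

Definition delete : matroid T := Matroid delete0 deleteS delete_aug.

Lemma contract_dep ie A : dependent (contract ie) A = dependent M (e |: A).
Proof. by []. Qed.

Lemma delete_dep A : dependent delete A = dependent M (A :\ e).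
Proof. by []. Qed.

End Minors.

Section MinorCircuits.
Variables (T : finType) (M : matroid T).
Implicit Types A B D N X Y : {set T}.

(** Its size is the measure of the induction: minors keep the ground set T, but an element that was
    removed lies in no circuit. *)
Definition incirc : {set T} := [set f | [exists D, circuit M D && (f \in D)]].

Lemma incircP f : reflect (exists2 D, circuit M D & f \in D) (f \in incirc).
Proof.
rewrite inE; apply: (iffP existsP) => [[D /andP[Dc fD]]|[D Dc fD]]; first by exists D.
by exists D; rewrite Dc.
Qed.

Variable e : T.

Lemma circuit_contract ie D : circuit M D -> e \in D -> circuit (@contract T M e ie) (D :\ e).
Proof.
move=> Dc eD; apply/circuitP; split; first by rewrite contract_dep setD1K // circuit_dep.
move=> f; rewrite !inE => /andP[fe fD]; apply: indepS (circuit_indep Dc fD).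
by apply/subsetP=> g; rewrite !inE; case: (eqVneq g e) => [->|]; rewrite ?eD 1?eq_sym ?fe // => _ /and3P[-> _ ->].
Qed.

(** A maximal subset X of D minus f that is independent in the contraction spans, together with e,
    all of D minus f and hence f. The circuit sought lies in [f |: X]. *)
Lemma contract_thru ie D f : circuit M D -> f \in D -> e \notin D ->
  exists D', [/\ circuit (@contract T M e ie) D', f \in D' & D' \subset D].
Proof.
move=> Dc fD eD; have [X [iX XD sX]] := max_indep (contract ie) (D :\ f).
have fX : f \notin X by apply: contraTN isT => /(subsetP XD); rewrite !inE eqxx.
have fe : f != e by apply: contraNneq eD => <-.
have : spanned M (e |: X) f.
  have iX' : indep M (e |: X) := iX.
  apply: (span_circuit iX' Dc fD) => g gD gf.
  have := sX g; rewrite !inE gf => /(_ gD)/orP[gX|]; first by rewrite /spanned !inE gX orbT.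
  by rewrite contract_dep setUCA => dg; rewrite /spanned dg orbT.
rewrite /spanned !inE (negPf fe) (negPf fX) /= setUCA -(contract_dep ie) => /dep_circuit[D' D'c D'S].
exists D'; split=> //.
  apply/negPn/negP=> fD'; apply: (circuit_sub D'c iX); apply/subsetP=> g gD'.
  have := subsetP D'S g gD'; rewrite !inE => /orP[/eqP gf|//]; by rewrite -gf gD' in fD'.
apply: subset_trans D'S _; rewrite subUset sub1set fD /=.
by apply: subset_trans XD _; apply: subsetDl.
Qed.

Lemma contract_circuit ie D : circuit (@contract T M e ie) D -> e \notin D.
Proof.
move=> Dc; apply/negP=> eD; have := circuit_indep Dc eD => iD.
have := circuit_dep Dc; rewrite contract_dep; have : indep M (e |: D :\ e) := iD.
by rewrite setD1K // setUC (setUidPl _) ?sub1set // /dependent => ->.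
Qed.

Lemma circuit_of_contract ie D f : circuit (@contract T M e ie) D -> f \in D ->
  exists D', [/\ circuit M D', f \in D' & D' \subset e |: D].
Proof.
move=> Dc fD; have eD := contract_circuit Dc.
have := circuit_dep Dc; rewrite contract_dep => /dep_circuit[D' D'c D'S].
exists D'; split=> //; apply/negPn/negP=> fD'.
have iD : indep M (e |: D :\ f) := circuit_indep Dc fD.
apply: (circuit_sub D'c iD); apply/subsetP=> g gD'; have := subsetP D'S g gD'.
rewrite !inE; case: (eqVneq g f) => [gf|//]; by rewrite -gf gD' in fD'.
Qed.

Lemma circuit_delete D : circuit (delete M e) D = circuit M D && (e \notin D).
Proof.
apply/circuitP/andP=> [[Dd Dm]|[Dc eD]].
  have eD : e \notin D.
    apply/negP=> eD; have iD : indep M ((D :\ e) :\ e) := Dm e eD.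
    by move: Dd; rewrite delete_dep /dependent; move: iD; rewrite setDDl setUid => ->.
  have idD A : e \notin A -> A :\ e = A by move=> eA; apply/setDidPl; rewrite disjoint_sym disjoints1.
  split=> //; apply/circuitP; split; first by move: Dd; rewrite delete_dep idD.
  move=> f fD; have := Dm f fD; rewrite /= /delete_indep idD //.
  by rewrite inE (negPf eD) andbF.
have idD : D :\ e = D by apply/setDidPl; rewrite disjoint_sym disjoints1.
split; first by rewrite delete_dep idD circuit_dep.
by move=> f fD; rewrite /= /delete_indep; apply: indepS (circuit_indep Dc fD); apply: subsetDl.
Qed.

End MinorCircuits.

Section MinorMeasure.
Variables (T : finType) (M : matroid T) (e : T).

Lemma incirc_contract ie : e \in incirc M -> (#|incirc (@contract T M e ie)| < #|incirc M|)%N.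
Proof.
move=> eM; apply: proper_card; apply/properP; split.
  apply/subsetP=> f /incircP[D Dc fD].
  by have [D' [D'c fD' _]] := circuit_of_contract Dc fD; apply/incircP; exists D'.
by exists e => //; apply/incircP=> -[D /contract_circuit eD]; rewrite (negPf eD).
Qed.

Lemma incirc_delete : e \in incirc M -> (#|incirc (delete M e)| < #|incirc M|)%N.
Proof.
move=> eM; apply: proper_card; apply/properP; split.
  by apply/subsetP=> f /incircP[D]; rewrite circuit_delete => /andP[Dc _] fD; apply/incircP; exists D.
by exists e => //; apply/incircP=> -[D]; rewrite circuit_delete => /andP[_ eD]; rewrite (negPf eD).
Qed.

End MinorMeasure.

(** * Cycle systems under minors, and the Hall condition *)

Section CycleSystems.
Variables (T J : finType).
Implicit Types (M : matroid T) (I S : {set J}) (C : J -> {set T}) (e f : T).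

(* A cycle system indexed by I; only |I| >= corank M is required. *)
Record csys M I C : Prop := Csys {
  csys_basis : exists2 B, indep M B & (#|T| <= #|B| + #|I|)%N;
  csys_cycle : forall i e, i \in I -> e \in C i ->
    exists D, [/\ circuit M D, e \in D & D \subset C i];
  csys_dep : forall S, S != set0 -> S \subset I -> dependent M (unique_union C S)
}.

Definition rows I C e : {set J} := [set i in I | e \in C i].

Lemma uuP C S e : reflect (exists2 i, i \in S & e \in C i /\ forall k, k \in S -> e \in C k -> k = i)
  (e \in unique_union C S).
Proof.
rewrite inE; apply: (iffP cards1P) => [[i eqi]|[i iS [eC un]]].
  have /setP/(_ i) := eqi; rewrite !inE eqxx => /andP[iS eC].
  exists i => //; split=> // k kS ek; have /setP/(_ k) := eqi; by rewrite !inE kS ek => /esym/eqP.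
exists i; apply/setP=> k; rewrite !inE; apply/andP/eqP=> [[kS ek]|->//]; exact: un.
Qed.

Lemma csys_empty M C A : csys M set0 C -> indep M A.
Proof.
case=> -[B iB]; rewrite cards0 addn0 -cardsT => leB _ _.
apply: indepS iB; suff -> : B = setT by apply: subsetT.
by apply/eqP; rewrite eqEcard subsetT.
Qed.

Lemma csys_contract M I C e ie : csys M I C -> csys (@contract T M e ie) I (fun i => C i :\ e).
Proof.
case=> [[B iB leB] cyc dp]; split.
- have [E [iE eE _ ltE]] := indep_ext ie iB; exists E; last by apply: leq_trans leB _; rewrite leq_add2r.
  by rewrite /= /contract_indep setUC (setUidPl _).
- move=> i f iI; rewrite !inE => /andP[fe fC]; have [D [Dc fD DC]] := cyc i f iI fC.
  case: (boolP (e \in D)) => eD.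
    exists (D :\ e); split; [exact: circuit_contract | by rewrite !inE fe | exact: setSD].
  have [D' [D'c fD' D'D]] := contract_thru ie Dc fD eD; exists D'; split=> //.
  rewrite subsetD1 (subset_trans D'D DC) /=; by apply: contra eD; apply: (subsetP D'D).
move=> S S0 SI; rewrite contract_dep; apply: dep_mono (dp S S0 SI).
apply/subsetP=> f fU; rewrite !inE; case: (eqVneq f e) => //= fe; move: fU; rewrite inE.
by congr (#|pred_of_set _| == 1)%N; apply/setP=> i; rewrite !inE fe.
Qed.

Lemma indep_avoid M D B c : circuit M D -> c \in D -> indep M B ->
  exists E, [/\ indep M E, c \notin E & (#|B| <= #|E|)%N].
Proof.
move=> Dc cD iB; have [E [iE DE _ ltE]] := indep_ext (circuit_indep Dc cD) iB.
exists E; split=> //; apply/negP=> cE; apply: (circuit_sub Dc iE).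
by rewrite -(setD1K cD) subUset sub1set cE.
Qed.

Lemma delete_basis M I B D c i : circuit M D -> c \in D -> indep M B -> i \in I ->
  (#|T| <= #|B| + #|I|)%N -> exists2 E, indep (delete M c) E & (#|T| <= #|E| + #|I :\ i|)%N.
Proof.
move=> Dc cD iB iI leB; have [E [iE cE ltE]] := indep_avoid Dc cD iB.
exists (c |: E); first by rewrite /= /delete_indep setU1K.
apply: leq_trans leB _; rewrite cardsU1 cE (cardsD1 i I) iI addnCA !addnA leq_add2r.
by rewrite add1n ltnS.
Qed.

Lemma csys_delete1 M I C c i : csys M I C -> rows I C c = [set i] ->
  csys (delete M c) (I :\ i) C.
Proof.
case=> [[B iB leB] cyc dp] rc.
have [iI cC] : i \in I /\ c \in C i by have /setP/(_ i) := rc; rewrite !inE eqxx => /andP.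
have out k : k \in I :\ i -> c \notin C k.
  rewrite !inE => /andP[ki kI]; apply/negP=> ck; have /setP/(_ k) := rc.
  by rewrite !inE kI ck (negPf ki).
have [D [Dc cD DC]] := cyc i c iI cC; split; first exact: delete_basis Dc cD iB iI leB.
- move=> k f kI fC; have kI' : k \in I by move: kI; rewrite inE => /andP[].
  have [D' [D'c fD' D'C]] := cyc k f kI' fC; exists D'; split=> //.
  by rewrite circuit_delete D'c; apply: contra (out k kI); apply: (subsetP D'C).
move=> S S0 SI; rewrite delete_dep; have SI' : S \subset I by apply: subset_trans SI (subsetDl _ _).
rewrite (_ : _ :\ c = unique_union C S); first exact: dp.
apply/setDidPl; rewrite disjoint_sym disjoints1; apply/uuP=> -[k kS [ck _]].
by have := out k (subsetP SI k kS); rewrite ck.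
Qed.

Definition merge M C c i k : {set T} :=
  \bigcup_(D : {set T} | circuit M D && (D \subset (C i :|: C k) :\ c)) D.

(** [merge] contains every f that lies in exactly one of C i and C k: a circuit through f in that
    one, if it contains c, is added to a circuit through c in the other, and a circuit of the sum
    through f avoids c. This is where M must be binary. Hence, for k in S, the old unique union over
    [i |: S] is contained in the new one over S. *)
Lemma csys_delete2 M ZZ I C c i k : bspace ZZ -> (forall A, dependent M A = dep ZZ A) ->
  csys M I C -> i != k -> rows I C c = [set i; k] ->
  csys (delete M c) (I :\ i) (fun j => if j == k then merge M C c i k else C j).
Proof.
move=> bZ MZ cs ik rc; have [[B iB leB] cyc dp] := cs.
have [iI ci] : i \in I /\ c \in C i by have /setP/(_ i) := rc; rewrite !inE eqxx => /andP.
have [kI ck] : k \in I /\ c \in C k by have /setP/(_ k) := rc; rewrite !inE eqxx orbT => /andP.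
have circE D : circuit M D = circ ZZ D by apply: minset_eq => A; rewrite MZ.
have out j : j \in I -> j != i -> j != k -> c \notin C j.
  move=> jI ji jk; apply/negP=> cj; have /setP/(_ j) := rc.
  by rewrite !inE jI cj (negPf ji) (negPf jk).
have [D [Dc cD DC]] := cyc i c iI ci; split; first exact: delete_basis Dc cD iB iI leB.
- move=> j f; rewrite in_setD1 => /andP[ji jI]; case: (eqVneq j k) => [_|jk] fC.
    case/bigcupP: fC => D' /andP[D'c D'S] fD'; exists D'; split=> //.
      by rewrite circuit_delete D'c; move: D'S; rewrite subsetD1 => /andP[].
    by apply: (bigcup_sup D'); rewrite D'c.
  have [D' [D'c fD' D'C]] := cyc j f jI fC; exists D'; split=> //.
  by rewrite circuit_delete D'c; apply: contra (out j jI ji jk); apply: (subsetP D'C).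
set C' := fun j => _; have C'k : C' k = merge M C c i k by rewrite /C' eqxx.
have C'j j : j != k -> C' j = C j by rewrite /C' => /negPf->.
have in_merge f : f \in C i :|: C k -> ~~ ((f \in C i) && (f \in C k)) -> f \in merge M C c i k.
  move=> fU fI.
  have [a [b [aI bI fa fb [cb UE]]]] : exists a b, [/\ a \in I, b \in I, f \in C a, f \notin C b &
      c \in C b /\ C i :|: C k = C a :|: C b].
    move: fI; case fi: (f \in C i) => /= fk; first by exists i, k.
    by exists k, i; rewrite fi setUC; split=> //; move: fU; rewrite inE fi.
  have [D1 [D1c fD1 D1C]] := cyc a f aI fa.
  apply/bigcupP; rewrite UE; case: (boolP (c \in D1)) => cD1; last first.
    exists D1 => //; rewrite D1c subsetD1 cD1 andbT /=.
    by apply: subset_trans D1C (subsetUl _ _).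
  have [D2 [D2c cD2 D2C]] := cyc b c bI cb.
  have Si : sdiff D1 D2 \in ZZ by apply: bZ.2; apply: circ_in; rewrite -circE.
  have fS : f \in sdiff D1 D2.
    by rewrite in_sdiff fD1 /=; apply: contra fb; apply: (subsetP D2C).
  have [D3 [D3c fD3 D3S]] := circ_thru bZ Si fS; exists D3 => //.
  rewrite circE D3c subsetD1 /=; apply/andP; split.
    by clear -D1C D2C D3S; sets.
  by apply/negP=> /(subsetP D3S); rewrite in_sdiff cD1 cD2.
move=> S S0 SI; rewrite delete_dep.
have Sout j : j \in S -> (j \in I) * (j != i).
  by move=> /(subsetP SI); rewrite !inE => /andP[-> ->].
case: (boolP (k \in S)) => kS; last first.
  have SI' : S \subset I by apply: subset_trans SI (subsetDl _ _).
  apply: dep_mono (dp S S0 SI'); rewrite subsetD1; apply/andP; split.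
    apply/subsetP=> f /uuP[j jS [fj un]]; have jk : j != k by apply: contraNneq kS => <-.
    apply/uuP; exists j => //; split; first by rewrite C'j.
    move=> j' j'S; have j'k : j' != k by apply: contraNneq kS => <-.
    by rewrite C'j //; apply: un.
  apply/uuP=> -[j jS [cj _]]; have jk : j != k by apply: contraNneq kS => <-.
  by have [jI ji] := Sout j jS; move: (out j jI ji jk); rewrite cj.
have S1I : i |: S \subset I.
  by rewrite subUset sub1set iI; apply: subset_trans SI (subsetDl _ _).
have S10 : i |: S != set0 by apply/set0Pn; exists i; rewrite !inE eqxx.
apply: dep_mono (dp _ S10 S1I); rewrite subsetD1; apply/andP; split; last first.
  apply/uuP=> -[j _ [_ un]].
  have := un i; have := un k; rewrite !inE eqxx kS orbT => /(_ isT ck) <- /(_ isT ci) e.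
  by rewrite e eqxx in ik.
apply/subsetP=> f /uuP[j jS [fj un]].
have un' j' : j' \in S -> f \in C j' -> j' = j by move=> j'S; apply: un; rewrite !inE j'S orbT.
case: (boolP (f \in C i :|: C k)) => fU.
  have fm : f \in merge M C c i k.
    apply: in_merge => //; apply/negP=> /andP[fi fk].
    have := un i; have := un k; rewrite !inE eqxx kS orbT => /(_ isT fk) <- /(_ isT fi) e.
    by rewrite e eqxx in ik.
  apply/uuP; exists k => //; split; first by rewrite C'k.
  move=> j' j'S; case: (eqVneq j' k) => [//|j'k]; rewrite C'j // => fj'.
  have ej := un' j' j'S fj'; case/setUP: fU => [fi|fk].
    have := un i; rewrite !inE eqxx => /(_ isT fi) ij.
    by have := (Sout j' j'S).2; rewrite ej ij eqxx.
  by rewrite ej -(un' k kS fk).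
have /norP[fi fk] : ~~ ((f \in C i) || (f \in C k)) by rewrite -in_setU.
have ji : j != i by apply: contraNneq fi => <-.
have jk : j != k by apply: contraNneq fk => <-.
have jS' : j \in S by move: jS; rewrite !inE (negPf ji).
apply/uuP; exists j => //; split; first by rewrite C'j.
move=> j' j'S; case: (eqVneq j' k) => [->|j'k]; last by rewrite C'j //; apply: un'.
rewrite C'k => /bigcupP[D' /andP[_ D'S] fD'].
by have := subsetP D'S f fD'; rewrite !inE (negPf fi) (negPf fk) andbF.
Qed.

(* The unique union over S is not inside B; an element of it outside B is touched by
   a single row of S, which is then removed. *)
Lemma touched_rows M I C B S : csys M I C -> indep M B -> S \subset I ->
  (#|S| <= #|[set e | (e \notin B) && [exists i in S, e \in C i]]|)%N.
Proof.
move=> cs iB; have [n] := ubnP #|S|; elim: n S => // n IHn S ltn SI.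
have [->|S0] := eqVneq S set0; first by rewrite cards0.
have : ~~ (unique_union C S \subset B).
  by apply/negP=> sub; have := dep_mono sub (csys_dep cs S0 SI); rewrite /dependent iB.
case/subsetPn=> e /uuP[i iS [ei un]] eB.
have lt : (#|S :\ i| < n)%N by move: ltn; rewrite (cardsD1 i S) iS.
have := IHn _ lt (subset_trans (subsetDl _ _) SI).
rewrite (cardsD1 i S) iS add1n => /leq_ltn_trans; apply; apply: proper_card.
apply/properP; split.
  apply/subsetP=> f; rewrite !inE => /andP[-> /exists_inP[j jS fj]] /=.
  by apply/exists_inP; exists j => //; move: jS; rewrite inE => /andP[].
exists e; first by rewrite inE eB; apply/exists_inP; exists i.
rewrite inE eB; apply/exists_inP=> -[j]; rewrite !inE => /andP[ji jS] ej.
by rewrite (un j jS ej) eqxx in ji.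
Qed.

(** Extend N to an independent B at least as large as the given basis; B avoids Y. The rows that
    miss Y touch, outside B, only elements outside Y, so by [touched_rows] there are at most |T| -
    |B| - |Y| of them, while |I| is at least |T| - |B|. *)
Lemma csys_hall M I C N (Y : {set T}) : csys M I C -> indep M N ->
  (forall e, e \in Y -> e \notin N) -> (forall e, e \in Y -> spanned M N e) ->
  (#|Y| <= #|\bigcup_(e in Y) rows I C e|)%N.
Proof.
move=> cs iN YN sY; have [[B0 iB0 leB] _ _] := cs.
have [B [iB NB _ ltB]] := indep_ext iN iB0.
have YB e : e \in Y -> e \notin B.
  move=> eY; apply/negP=> eB; have := sY e eY; rewrite /spanned (negPf (YN e eY)) /=.
  by apply/negP; rewrite negbK; apply: indepS iB; rewrite subUset sub1set eB.
set R := \bigcup_(e in Y) _; have RI : R \subset I.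
  by apply/bigcupsP=> e _; apply/subsetP=> i; rewrite inE => /andP[].
have := touched_rows cs iB (subsetDl I R).
set E := [set e | _] => le1.
have EU : E \subset ~: (B :|: Y).
  apply/subsetP=> e; rewrite !inE negb_or => /andP[-> /exists_inP[i]]; rewrite inE => /andP[iR iI] ei.
  by apply: contra iR => eY; apply/bigcupP; exists e => //; rewrite inE iI.
have := leq_trans le1 (subset_leq_card EU).
have cU : #|B :|: Y| = (#|B| + #|Y|)%N.
  rewrite -cardsUI (_ : B :&: Y = set0) ?cards0 ?addn0 //.
  by apply/setP=> e; rewrite !inE; apply/negP=> /andP[eB /YB]; rewrite eB.
have := cardsC (B :|: Y); rewrite cU.
have := cardsID R I; rewrite (setIidPr RI).
move: leB ltB; move: #|I :\: R| #|R| #|I| #|B0| #|B| #|Y| #|~: (B :|: Y)| #|T| => a r i b0 b y u t.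
move=> h1 h2 h3 h4 h5.
rewrite -(leq_add2l b) -(leq_add2r u) h4; apply: leq_trans h1 _.
by rewrite -h3 addnA leq_add // leq_add.
Qed.

End CycleSystems.

(** * Binary matroids and the four-point line *)

Lemma odd_sdiff (T : finType) (A B : {set T}) : odd #|sdiff A B| = odd #|A| (+) odd #|B|.
Proof.
have -> : sdiff A B = (A :\: B) :|: (B :\: A) by sets.
have dAB : (A :\: B) :&: (B :\: A) = set0 by sets.
rewrite -(cardsID B A) -(cardsID A B) (setIC B) -[#|_ :|: _|]addn0 -(cards0 T) -dAB cardsUI.
by rewrite !oddD addbACA addbb.
Qed.

Section Binary.
Variables (T : finType) (M : matroid T).
Implicit Types A B D N Q X Y Z : {set T}.
Implicit Types ZZ : {set {set T}}.

Definition binary (L : matroid T) ZZ := bspace ZZ /\ forall A, dependent L A = dep ZZ A.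

(* The four-point line: a restriction isomorphic to U_{2,4}. *)
Definition line4 (L : matroid T) Q :=
  #|Q| = 4 /\ forall X, X \subset Q -> dependent L X = (2 < #|X|)%N.

Lemma binary_circ L ZZ D : binary L ZZ -> circuit L D = circ ZZ D.
Proof. by case=> _ H; apply: minset_eq => A; rewrite H. Qed.

Lemma line4_intro Q : #|Q| = 4 -> (forall q, q \in Q -> circuit M (Q :\ q)) -> line4 M Q.
Proof.
move=> Q4 cQ; split=> // X XQ; have := cardsID X Q; rewrite (setIidPr XQ) Q4 => cX.
case: ltnP => [X2|X2].
  have /card_le1_eqP le1 : (#|Q :\: X| <= 1)%N by rewrite -(leq_add2l #|X|) cX addn1.
  have [q [qQ sub]] : exists q, q \in Q /\ Q :\ q \subset X; last first.
    by apply: dep_mono sub _; apply/circuit_dep/cQ.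
  case: (set_0Vmem (Q :\: X)) => [/eqP|[q qQX]].
    have /set0Pn[q qQ] : Q != set0 by rewrite -card_gt0 Q4.
    by rewrite setD_eq0 => QX; exists q; split=> //; apply: subset_trans QX; apply: subsetDl.
  exists q; split; first by case/setDP: qQX.
  apply/subsetP=> g; rewrite !inE => /andP[gq gQ]; apply: contraR gq => gX.
  by apply/eqP; apply: le1; rewrite // inE gX.
have /card_gt1P[q [q' [/setDP[qQ qX] /setDP[q'Q q'X] qq']]] : (1 < #|Q :\: X|)%N.
  by rewrite -(leq_add2l #|X|) cX addn2 !ltnS.
apply/negPn; apply: indepS (circuit_indep (cQ q qQ) (_ : q' \in _)); last by rewrite !inE eq_sym qq'.
apply/subsetP=> g gX; rewrite !inE (subsetP XQ g gX) andbT.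
by apply/andP; split; apply: contraTneq gX => ->.
Qed.

Lemma line4_nonbinary L ZZ Q : binary L ZZ -> line4 L Q -> False.
Proof.
move=> [bZ LZ] [Q4 dQ]; have bL : binary L ZZ by [].
have sub3 q : q \in Q -> Q :\ q \in ZZ.
  move=> qQ; have c3 : #|Q :\ q| = 3 by move: Q4; rewrite (cardsD1 q) qQ => -[].
  apply: circ_in; rewrite -(binary_circ _ bL); apply/circuitP; split.
    by rewrite dQ ?c3 // subsetDl.
  move=> f fQ; rewrite -[indep _ _]negbK -/(dependent _ _) dQ.
    by move: c3; rewrite (cardsD1 f) fQ add1n => -[->].
  by apply: subset_trans (subsetDl _ _) (subsetDl _ _).
have /card_gt1P[q [q' [qQ q'Q qq']]] : (1 < #|Q|)%N by rewrite Q4.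
have : dependent L [set q; q'].
  rewrite LZ; apply/depP; exists (sdiff (Q :\ q) (Q :\ q')); split.
  - by apply: bZ.2; apply: sub3.
  - by apply/set0Pn; exists q; rewrite in_sdiff !inE eqxx qQ qq'.
  by apply/subsetP=> g; rewrite in_sdiff !inE; case: (g == q); case: (g == q'); case: (g \in Q).
by rewrite dQ ?cards2 ?qq' // subUset !sub1set qQ.
Qed.

Hypothesis contractions : forall e, e \in incirc M -> indep M [set e] ->
  exists ZZ, bspace ZZ /\ forall A, dependent M (e |: A) = dep ZZ A.

Lemma contraction_circ e ZZ (ie : indep M [set e]) D :
  (forall A, dependent M (e |: A) = dep ZZ A) -> circuit (contract ie) D = circ ZZ D.
Proof. by move=> H; apply: minset_eq => A; rewrite contract_dep H. Qed.

(** * A circuit D of M that is not a cycle of the binary contraction of e *)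

Section Theta.
Variables (e : T) (ZZ : {set {set T}}) (D : {set T}).
Hypotheses (bZ : bspace ZZ) (HZ : forall A, dependent M (e |: A) = dep ZZ A).
Hypotheses (ie : indep M [set e]) (Dc : circuit M D) (eD : e \notin D) (DZ : D \notin ZZ).

Lemma theta_sub D1 : circ ZZ D1 -> D1 \subset D -> exists2 g, g \in D & D1 \subset D :\ g.
Proof.
move=> c1 s1; have : ~~ (D \subset D1).
  by apply: contra DZ => DD1; rewrite (_ : D = D1) ?circ_in //; apply/eqP; rewrite eqEsubset DD1.
by case/subsetPn=> g gD g1; exists g => //; rewrite subsetD1 s1.
Qed.

(** D1 is a proper part of D because D is not in [ZZ]; so D1 is independent in M. *)
Lemma theta_lift D1 : circ ZZ D1 -> D1 \subset D -> circuit M (e |: D1).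
Proof.
move=> c1 s1; have e1 : e \notin D1 by apply: contra eD; apply: (subsetP s1).
apply/circuitP; split; first by rewrite HZ; apply/depP; exists D1; split=> //; [apply: circ_in | apply: circ_neq0 c1].
move=> f; rewrite in_setU1 => /orP[/eqP->|f1].
  rewrite setU1K //; have [g gD sg] := theta_sub c1 s1.
  exact: indepS sg (circuit_indep Dc gD).
have -> : (e |: D1) :\ f = e |: D1 :\ f.
  have ef : e != f by apply: contraNneq e1 => ->.
  by apply/setP=> g; rewrite !inE; case: (eqVneq g e) => [->|//]; rewrite ef.
rewrite -[indep _ _]negbK -/(dependent _ _) HZ; apply/depP=> -[Z [Zi Z0 ZS]].
have := circ_min c1 Zi (subset_trans ZS (subsetDl _ _)) Z0.
by move=> eqZ; move: f1 ZS; rewrite -eqZ => fZ /subsetP/(_ f fZ); rewrite !inE eqxx.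
Qed.

(** If both missed g, then [e |: D1] and [e |: D2] would be two circuits inside e and the
    independent set D minus g. *)
Lemma theta_union D1 D2 g : circ ZZ D1 -> circ ZZ D2 -> D1 \subset D -> D2 \subset D -> D1 != D2 ->
  g \in D -> g \in D1 :|: D2.
Proof.
move=> c1 c2 s1 s2 ne gD; apply: contraR ne; rewrite inE negb_or => /andP[g1 g2].
have E12 := circuit_unique (e := e) (circuit_indep Dc gD) (theta_lift c1 s1) (theta_lift c2 s2).
have e1 : e \notin D1 by apply: contra eD; apply: (subsetP s1).
have e2 : e \notin D2 by apply: contra eD; apply: (subsetP s2).
by rewrite -(setU1K e1) -(setU1K e2) E12 // setUS // subsetD1 ?s1 ?s2.
Qed.

(** The contraction of f is binary too, and the sum of the two lifted circuits there shows that D1 +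
    D2 together with f is dependent in M, although it is contained in D minus g. *)
Lemma theta_inter D1 D2 f g : circ ZZ D1 -> circ ZZ D2 -> D1 \subset D -> D2 \subset D -> D1 != D2 ->
  f \in D1 -> f \in D2 -> g \in D1 -> g \in D2 -> f = g.
Proof.
move=> c1 c2 s1 s2 ne f1 f2 g1 g2; apply/eqP; apply: contraT => fg.
have fD := subsetP s1 f f1; have gD := subsetP s1 g g1.
have fM : f \in incirc M by apply/incircP; exists D.
have if_ : indep M [set f].
  by apply: indepS (circuit_indep Dc gD); rewrite sub1set !inE fg.
have [Zf [bf Hf]] := contractions fM if_.
have inf D' : circ ZZ D' -> D' \subset D -> f \in D' -> (e |: D') :\ f \in Zf.
  move=> c' s' f'; apply: circ_in; rewrite -(contraction_circ if_ _ Hf).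
  by apply: circuit_contract; [apply: theta_lift | rewrite !inE f' orbT].
have Si := bf.2 _ _ (inf D1 c1 s1 f1) (inf D2 c2 s2 f2).
have : dependent M (f |: sdiff D1 D2).
  rewrite Hf; apply/depP; exists (sdiff ((e |: D1) :\ f) ((e |: D2) :\ f)); split=> //.
    rewrite sdiff_eq0; apply: contra ne => /eqP eq12; apply/eqP/setP=> h.
    case: (eqVneq h f) => [->|hf]; first by rewrite f1 f2.
    case: (eqVneq h e) => [->|he].
      have out (D' : {set T}) : D' \subset D -> e \notin D' by move=> s'; apply: contra eD; apply: (subsetP s').
      by rewrite (negPf (out _ s1)) (negPf (out _ s2)).
    by have /setP/(_ h) := eq12; rewrite !inE hf (negPf he).
  by apply/subsetP=> h; rewrite !in_sdiff !inE; case: (h == f); case: (h == e); case: (h \in D1); case: (h \in D2).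
rewrite /dependent (indepS _ (circuit_indep Dc gD)) //.
apply/subsetP=> h; rewrite !inE => /orP[/eqP->|]; first by rewrite fg.
case: (eqVneq h g) => [->|hg /=]; first by rewrite g1 g2.
by case h1: (h \in D1); case h2: (h \in D2) => // _; [apply: (subsetP s1) | apply: (subsetP s2)].
Qed.

(* Any two circuits of M / e inside D cover D and share exactly one point, so D has
   three points. *)
Lemma theta_line : exists Q, line4 M Q.
Proof.
have : dep ZZ D by rewrite -HZ; apply: dep_mono (circuit_dep Dc); apply: subsetUr.
case/dep_circ=> D1 c1 s1.
have [h hD sh] := theta_sub c1 s1.
have h1 : h \notin D1 by move: sh; rewrite subsetD1 => /andP[].
have [D2 [c2' h2 s2]] := contract_thru ie Dc hD eD.
have c2 : circ ZZ D2 by rewrite -(contraction_circ ie _ HZ).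
have ne : D1 != D2 by apply: contraNneq h1 => ->.
have Si : sdiff D1 D2 \in ZZ by apply: bZ.2; apply: circ_in.
have hS : h \in sdiff D1 D2 by rewrite in_sdiff (negPf h1) h2.
have [w wI] : exists w, w \in D1 :&: D2.
  apply/set0Pn; apply: contra DZ => /eqP I0; rewrite (_ : D = sdiff D1 D2) //.
  apply/setP=> g; rewrite in_sdiff; have /setP/(_ g) := I0; rewrite !inE.
  case gD: (g \in D).
    by have := theta_union c1 c2 s1 s2 ne gD; rewrite inE; case: (g \in D1); case: (g \in D2).
  have n1 : g \notin D1 by apply: contraFN gD; apply: (subsetP s1).
  have n2 : g \notin D2 by apply: contraFN gD; apply: (subsetP s2).
  by rewrite (negPf n1) (negPf n2).
have [w1 w2] : w \in D1 /\ w \in D2 by apply/andP; rewrite -in_setI.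
have SD : sdiff D1 D2 \subset D by clear -s1 s2; sets.
have c3 : circ ZZ (sdiff D1 D2).
  have [D3 [c3 h3 s3]] := circ_thru bZ Si hS.
  have s3D := subset_trans s3 SD.
  have w3 : w \notin D3 by apply/negP=> /(subsetP s3); rewrite in_sdiff w1 w2.
  have ne13 : D1 != D3 by apply: contraNneq w3 => <-.
  have ne23 : D2 != D3 by apply: contraNneq w3 => <-.
  suff <- : D3 = sdiff D1 D2 by [].
  apply/eqP; rewrite eqEsubset s3; apply/subsetP=> g gS.
  have gD := subsetP SD g gS; move: gS; rewrite in_sdiff.
  have := theta_union c1 c3 s1 s3D ne13 gD; have := theta_union c2 c3 s2 s3D ne23 gD.
  by rewrite !inE; case: (g \in D1); case: (g \in D2).
have [u u1 u2] : exists2 u, u \in D1 & u \notin D2.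
  by apply/subsetPn; apply: contra ne => /(circ_min c2 (circ_in c1))-> //; apply: circ_neq0 c1.
have ne13 : D1 != sdiff D1 D2.
  by apply/eqP=> /setP/(_ w); rewrite in_sdiff w1 w2.
have ne23 : D2 != sdiff D1 D2.
  by apply/eqP=> /setP/(_ w); rewrite in_sdiff w1 w2.
have uniq3 g : g \in D1 -> g \in D2 -> g = w by move=> g1 g2; apply: (theta_inter c1 c2).
have uniq1 g : g \in D1 -> g \notin D2 -> g = u.
  by move=> g1 g2; apply: (theta_inter c1 c3); rewrite // in_sdiff ?g1 ?u1 ?(negPf g2) ?(negPf u2).
have uniq2 g : g \notin D1 -> g \in D2 -> g = h.
  by move=> g1 g2; apply: (theta_inter c2 c3); rewrite // in_sdiff ?g2 ?h2 ?(negPf g1) ?(negPf h1).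
have uw : u != w by apply: contraNneq u2 => ->.
have hw : h != w by apply: contraNneq h1 => ->.
have uh : u != h by apply: contraNneq h1 => <-.
have D1E : D1 = [set u; w].
  apply/setP=> g; rewrite !inE; apply/idP/orP=> [g1|[]/eqP-> //].
  by case g2: (g \in D2); [right; rewrite (uniq3 g) | left; rewrite (uniq1 g) ?g2].
have D2E : D2 = [set h; w].
  apply/setP=> g; rewrite !inE; apply/idP/orP=> [g2|[]/eqP-> //].
  by case g1: (g \in D1); [right; rewrite (uniq3 g) | left; rewrite (uniq2 g) ?g1].
have D3E : sdiff D1 D2 = [set u; h].
  rewrite D1E D2E; apply/setP=> g; rewrite !inE.
  case: (eqVneq g u) => [->|gu]; first by neqs.
  by case: (eqVneq g w) => [->|gw]; neqs; rewrite ?orbF.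
have DE : D = [set u; h; w].
  apply/setP=> g; rewrite !inE; apply/idP/idP=> [gD|/orP[/orP[]|]/eqP->] //.
  - by have := theta_union c1 c2 s1 s2 ne gD; rewrite D1E D2E !inE; case: (g == u); case: (g == h); case: (g == w).
  - exact: subsetP s1 u u1.
  - exact: subsetP s1 w w1.
have [eu eh ew] : [/\ e != u, e != h & e != w].
  by move: eD; rewrite DE !inE !negb_or => /andP[/andP[]].
exists (e |: D); apply: line4_intro.
  by rewrite cardsU1 eD DE -seq3E cardsE (card_uniqP _) //= !inE; neqs.
have Dsub g D' : circ ZZ D' -> D' \subset D -> D = g |: D' -> g \notin D' -> circuit M ((e |: D) :\ g).
  move=> c' s' Dg g'; rewrite (_ : _ :\ g = e |: D'); first exact: theta_lift.
  have ge : g != e by apply: contraNneq eD => <-; rewrite Dg !inE eqxx.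
  rewrite Dg setUCA setU1K // !inE negb_or ge //.
move=> q; rewrite in_setU1 {1}DE !in_setU !in_set1 => /orP[/eqP->|/orP[/orP[]|]/eqP->].
- by rewrite setU1K.
- by apply: (Dsub u D2) => //; rewrite DE D2E -setUA.
- by apply: (Dsub h D1) => //; rewrite DE D1E setUCA setUA.
- apply: (Dsub w (sdiff D1 D2)) => //; first by rewrite DE D3E setUC.
  by rewrite in_sdiff w1 w2.
Qed.

End Theta.

Lemma binary_of_contractions : ~ (exists Q, line4 M Q) -> exists ZZ, binary M ZZ.
Proof.
move=> noline.
have [] := classic (exists e f, [/\ e \in incirc M, f \in incirc M & indep M [set e; f] /\ e != f]); last first.
  move=> par.
  (* Here all nonloops in circuits are parallel, so a cycle is a set with an even number of them and
     any loops. *)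
  pose NL := [set e in incirc M | indep M [set e]].
  pose ZZ := [set Z : {set T} | (Z \subset incirc M) && ~~ odd #|Z :&: NL|].
  have NLP g : (g \in NL) = (g \in incirc M) && indep M [set g] by rewrite inE.
  have paral e f : e \in incirc M -> f \in incirc M -> e != f -> dependent M [set e; f].
    by move=> eM fM ef; apply/negP=> i2; apply: par; exists e, f.
  exists ZZ; split.
    split=> [|Y Z]; first by rewrite inE sub0set set0I cards0.
    rewrite !inE => /andP[Ys Yo] /andP[Zs Zo]; apply/andP; split; first by clear -Ys Zs; sets.
    suff -> : odd #|sdiff Y Z :&: NL| = odd #|Y :&: NL| (+) odd #|Z :&: NL|.
      by rewrite (negPf Yo) (negPf Zo).
    have -> : sdiff Y Z :&: NL = sdiff (Y :&: NL) (Z :&: NL) by clear; move: NL => N; sets.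
    exact: odd_sdiff.
  move=> A; apply/idP/depP=> [/dep_circuit[D Dc DA]|[Z [Zi Z0 ZA]]].
    have [a aD] := set0Pn _ (circuit_neq0 Dc).
    have inM g : g \in D -> g \in incirc M by move=> gD; apply/incircP; exists D.
    case: (boolP (indep M [set a])) => ia.
      have [b bD ba] : exists2 b, b \in D & b != a.
        have : ~~ (D \subset [set a]) by apply/negP=> /(circuit_sub Dc ia).
        by case/subsetPn=> b bD; rewrite inE => ba; exists b.
      have ib : indep M [set b].
        by apply: indepS (circuit_indep Dc aD); rewrite sub1set !inE ba.
      exists [set a; b]; split; last by rewrite subUset !sub1set !(subsetP DA).
        rewrite inE subUset !sub1set !inM //=.
        rewrite (setIidPl _) ?cards2 1?eq_sym ?ba //.
        by rewrite subUset !sub1set !NLP !inM // ia ib.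
      by apply/set0Pn; exists a; rewrite !inE eqxx.
    exists [set a]; split; last by rewrite sub1set (subsetP DA).
      rewrite inE sub1set inM //= (_ : _ :&: _ = set0) ?cards0 //.
      by apply/setP=> g; rewrite in_setI NLP !in_set1 in_set0; case: (eqVneq g a) => [->|//]; rewrite (negPf ia) andbF.
    by apply/set0Pn; exists a; rewrite inE.
  move: Zi; rewrite inE => /andP[ZM Zo].
  case: (boolP (Z \subset NL)) => [ZN|/subsetPn[g gZ gN]].
    rewrite (setIidPl ZN) in Zo.
    have /card_gt1P[a [b [aZ bZ ab]]] : (1 < #|Z|)%N.
      by move: Z0 Zo; rewrite -card_gt0; case: #|Z| => [|[]].
    apply: dep_mono (paral a b _ _ ab); try exact: (subsetP ZM).
    by rewrite subUset !sub1set !(subsetP ZA).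
  apply: (dep_mono (A := [set g])); first by rewrite sub1set (subsetP ZA).
  by move: gN; rewrite NLP (subsetP ZM).
case=> a [b [aM bM [iab ab]]].
have other e : indep M [set e] -> exists f, [/\ f \in incirc M, indep M [set e; f] & f != e].
  move=> ie; apply: NNPP => no.
  have sp g : g \in incirc M -> spanned M [set e] g.
    move=> gM; rewrite /spanned inE; case: (eqVneq g e) => //= ge.
    by apply/negP=> i2; apply: no; exists g; rewrite setUC.
  have := span_card ie iab; rewrite cards1 cards2 ab => /(_ _)/negP; apply.
    by move=> g; rewrite !inE => /orP[]/eqP->; apply: sp.
  by [].
have ex e : exists ZZ, e \in incirc M -> indep M [set e] ->
    bspace ZZ /\ forall A, dependent M (e |: A) = dep ZZ A.
  case: (classic (e \in incirc M /\ indep M [set e])) => [[eM ie]|no].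
    by have [ZZ H] := contractions eM ie; exists ZZ.
  by exists set0 => eM ie; case: no.
have [Zf HZf] := fin_all_exists ex.
(* A set counts as a cycle when it is one in every contraction; by [theta_line] the circuits of M
   qualify. *)
pose ZZ := [set Z : {set T} | (Z \subset incirc M) &&
  [forall e, (e \in incirc M) && indep M [set e] ==> (Z :\ e \in Zf e)]].
have inZ Z : reflect (Z \subset incirc M /\ forall e, e \in incirc M -> indep M [set e] -> Z :\ e \in Zf e) (Z \in ZZ).
  rewrite inE; apply: (iffP andP) => -[ZM H]; split=> //.
    by move=> e eM ie; move/forallP/(_ e): H; rewrite eM ie.
  by apply/forallP=> e; apply/implyP=> /andP[eM ie]; apply: H.
have DZ D : circuit M D -> D \in ZZ.
  move=> Dc; apply/inZ; split; first by apply/subsetP=> e eD; apply/incircP; exists D.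
  move=> e eM ie; have [be He] := HZf e eM ie.
  case: (boolP (e \in D)) => eD.
    by apply: circ_in; rewrite -(contraction_circ ie _ He); apply: circuit_contract.
  have -> : D :\ e = D by apply/setDidPl; rewrite disjoint_sym disjoints1.
  by apply: contraT => DN; case: noline; apply: (theta_line be He ie Dc eD DN).
exists ZZ; split.
  split=> [|Y Z /inZ[YM HY] /inZ[ZM HZ]].
    apply/inZ; split; first exact: sub0set.
    by move=> e eM ie; have [[b0 _] _] := HZf e eM ie; rewrite set0D.
  apply/inZ; split; first by clear -YM ZM; sets.
  move=> e eM ie; have [[_ bD] _] := HZf e eM ie.
  rewrite (_ : _ :\ e = sdiff (Y :\ e) (Z :\ e)); first by apply: bD; [apply: HY | apply: HZ].
  by apply/setP=> g; rewrite !in_sdiff !inE; case: (g == e).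
move=> A; apply/idP/depP=> [/dep_circuit[D Dc DA]|[Z [/inZ[ZM HZ] Z0 ZA]]].
  by exists D; split=> //; [apply: DZ | apply: circuit_neq0 Dc].
apply: dep_mono ZA _; have [e eZ] := set0Pn _ Z0; have eM := subsetP ZM e eZ.
case: (boolP (indep M [set e])) => ie; last by apply: dep_mono ie; rewrite sub1set.
have [be He] := HZf e eM ie.
case: (eqVneq (Z :\ e) set0) => [Ze|Ze]; last first.
  rewrite -(setD1K eZ) He; apply/depP; exists (Z :\ e); split=> //; exact: HZ.
have ZE : Z = [set e] by rewrite -(setD1K eZ) Ze setU0.
(* A single nonloop e cannot be in [ZZ]: some f is independent of e, and e would be a loop in the
   contraction of f. *)
have [f [fM ief fe]] := other e ie.
have if_ : indep M [set f] by apply: indepS ief; rewrite sub1set !inE eqxx orbT.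
have [bf Hf] := HZf f fM if_.
have : dependent M (f |: [set e]).
  rewrite Hf; apply/depP; exists [set e]; split=> //; last by rewrite -ZE.
  have := HZ f fM if_; rewrite ZE (_ : [set e] :\ f = [set e]) //.
  by apply/setDidPl; rewrite disjoints1 inE eq_sym.
by rewrite setUC /dependent ief.
Qed.

End Binary.

(** * Excluding the four-point line *)

Section Rows.
Variables (T J : finType) (M : matroid T) (I : {set J}) (C : J -> {set T}).
Hypothesis cs : csys M I C.
Implicit Types D K N Q X Y : {set T}.

Lemma uu_rows S e : e \in unique_union C S -> exists2 i, i \in S & rows S C e = [set i].
Proof.
move=> /uuP[i iS [ei un]]; exists i => //; apply/setP=> k; rewrite !inE.
by apply/andP/eqP=> [[kS ek]|->//]; apply: un.
Qed.

Lemma rows_incirc e i : rows I C e = [set i] -> [/\ i \in I, e \in C i & e \in incirc M].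
Proof.
move=> ri; have /setIdP[iI ei] : i \in rows I C e by rewrite ri inE.
split=> //.
by have [D [Dc eD _]] := csys_cycle cs iI ei; apply/incircP; exists D.
Qed.

(** Through a passes a circuit inside [C i], all of whose other elements are spanned. *)
Lemma row_span N Y a i : indep M N -> i \in I -> a \in C i ->
    (forall b, b \in C i -> b \in Y -> b != a -> spanned M N b) ->
    (forall b, b \in incirc M -> b \notin Y -> spanned M N b) ->
  spanned M N a.
Proof.
move=> iN iI ai sY sN; have [D [Dc aD DC]] := csys_cycle cs iI ai.
apply: (span_circuit iN Dc aD) => b bD ba; have bi := subsetP DC b bD.
case: (boolP (b \in Y)) => bY; first exact: sY.
by apply: sN => //; apply/incircP; exists D.
Qed.

Lemma hall_small N Y (R : {set J}) : indep M N -> (forall e, e \in Y -> e \notin N) ->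
  (forall e, e \in Y -> spanned M N e) -> (forall e, e \in Y -> rows I C e \subset R) ->
  (#|Y| <= #|R|)%N.
Proof.
move=> iN YN sY rY; apply: leq_trans (csys_hall cs iN YN sY) _.
by apply: subset_leq_card; apply/bigcupsP.
Qed.

Hypothesis contractions : forall e, e \in incirc M -> indep M [set e] ->
  exists ZZ, bspace ZZ /\ forall A, dependent M (e |: A) = dep ZZ A.
Hypothesis deletions : forall c i, rows I C c = [set i] -> exists ZZ, binary (delete M c) ZZ.

(* A circuit K of elements lying on a single cycle consists of three points of Q,
   and all other elements are parallel to the fourth, which does not span K. *)
Lemma no_line4 Q : ~ line4 M Q.
Proof.
move=> lQ; have [Q4 dQ] := lQ.
have iQ X : X \subset Q -> (#|X| <= 2)%N -> indep M X.
  by move=> XQ X2; apply: negbFE; rewrite -/(dependent _ _) dQ // ltnNge X2.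
have ipair a b : a \in Q -> b \in Q -> indep M [set a; b].
  move=> aQ bQ; apply: iQ; first by rewrite subUset !sub1set aQ.
  by rewrite cards2; case: (_ != _).
have Qspan a b g : a \in Q -> b \in Q -> a != b -> g \in Q -> spanned M [set a; b] g.
  move=> aQ bQ ab gQ; rewrite /spanned; case: (boolP (g \in _)) => //= gN.
  by rewrite dQ ?subUset ?sub1set ?gQ ?aQ // cardsU1 gN cards2 ab.
(* Contracting an f that a and b do not span would preserve the line Q, but contractions are
   binary. *)
have rank2 a b f : a \in Q -> b \in Q -> a != b -> f \in incirc M -> spanned M [set a; b] f.
  move=> aQ bQ ab fM; apply: contraT => nf.
  have if_ : indep M [set f].
    by move: nf; rewrite negb_or => /andP[_ /negbNE]; apply: indepS; apply: subsetUl.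
  have [ZZ [bZ HZ]] := contractions fM if_.
  have bC : binary (contract if_) ZZ by split.
  case: (line4_nonbinary bC (Q := Q)); split=> // X XQ; rewrite contract_dep.
  case: ltnP => X2; first by apply: dep_mono (subsetUr _ _) _; rewrite dQ.
  apply/negbTE; apply: contra nf => /dep_circuit[D Dc DS].
  have fD : f \in D.
    apply: contraT => fD; case: (circuit_sub Dc (iQ X XQ X2)).
    apply/subsetP=> g gD; have := subsetP DS g gD; rewrite in_setU1 => /orP[/eqP gf|//].
    by rewrite -gf gD in fD.
  apply: (span_circuit (ipair a b aQ bQ) Dc fD) => g gD gf; apply: Qspan => //.
  by apply: (subsetP XQ); have := subsetP DS g gD; rewrite in_setU1 (negPf gf).
have I0 : I != set0.
  apply: contraTneq isT => I0; have := cs; rewrite I0 => cs0.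
  by have := dQ Q (subxx _); rewrite Q4 /dependent (csys_empty Q cs0).
have [K Kc KU] := dep_circuit (csys_dep cs I0 (subxx I)).
have single c : c \in K -> exists i, rows I C c = [set i].
  by move=> /(subsetP KU)/uu_rows[i _ ri]; exists i.
(* Deleting an element off a four-point line preserves the line, but the deletion of c is binary. *)
have inline c Q' : c \in K -> line4 M Q' -> c \in Q'.
  move=> cK [Q'4 dQ']; apply: contraT => cQ'; have [i ri] := single c cK.
  have [ZZ bC] := deletions ri; case: (line4_nonbinary bC (Q := Q')); split=> // X XQ'.
  rewrite delete_dep (_ : X :\ c = X) ?dQ' //; apply/setDidPl.
  by rewrite disjoint_sym disjoints1; apply: contra cQ'; apply: (subsetP XQ').
have KQ : K \subset Q by apply/subsetP=> c cK; apply: inline.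
have KM c : c \in K -> c \in incirc M by move=> cK; apply/incircP; exists K.
have K3 : #|K| = 3.
  have : (2 < #|K|)%N by rewrite -dQ // circuit_dep.
  have [c cK] := set0Pn _ (circuit_neq0 Kc).
  have := circuit_indep Kc cK; rewrite -[indep _ _]negbK -/(dependent _ _) dQ; last first.
    by apply: subset_trans (subsetDl _ _) KQ.
  by rewrite (cardsD1 c K) cK -leqNgt add1n ltnS => le1 le2; congr _.+1; apply/eqP; rewrite eqn_leq le1.
(* Two elements of K on the same single row would violate the Hall condition, since the other two
   points of Q span both. *)
have distinct a b i : a \in K -> b \in K -> a != b -> rows I C a = [set i] -> rows I C b <> [set i].
  move=> aK bK ab ra rb; pose N := Q :\: [set a; b].
  have abQ : [set a; b] \subset Q by rewrite subUset !sub1set !(subsetP KQ).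
  have N2 : #|N| = 2 by rewrite cardsD (setIidPr abQ) cards2 ab Q4.
  have /eqP/cards2P[u [v [uv eqN]]] := N2.
  have [uQ vQ] : u \in Q /\ v \in Q.
    have NQ : N \subset Q by apply: subsetDl.
    by split; apply: (subsetP NQ); rewrite eqN !inE eqxx ?orbT.
  have iN : indep M N by apply: iQ; rewrite ?subsetDl // N2.
  have := @hall_small N [set a; b] [set i] iN; rewrite cards2 ab cards1 => /(_ _ _ _)/negP; case=> //.
  - by move=> e eab; rewrite !inE negb_and negbK -in_set2 eab.
  - by move=> e; rewrite eqN !inE => /orP[]/eqP->; apply: rank2 => //; apply: KM.
  - by move=> e; rewrite !inE => /orP[]/eqP->; rewrite ?ra ?rb.
have /eqP/cards1P[h Qh] : #|Q :\: K| = 1 by rewrite cardsD (setIidPr KQ) K3 Q4.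
have /setDP[hQ hK] : h \in Q :\: K by rewrite Qh inE.
have notK g : g \in Q -> g \notin K -> g = h.
  by move=> gQ gK; apply/set1P; rewrite -Qh inE gK.
have ih : indep M [set h] by have := ipair h h hQ hQ; rewrite setUid.
(* Otherwise let a be the point of K parallel to f, or any point of K if there is none. Replacing a
   by f in Q gives another four-point line, which must contain a by [inline]. *)
have outK f : f \in incirc M -> f \notin K -> spanned M [set h] f.
  move=> fM fK; rewrite /spanned inE; case: (eqVneq f h) => //= fh; apply: contraT => /negbNE ifh.
  have fQ : f \notin Q by apply: contra fh => fQ; rewrite (notK f).
  have if_ : indep M [set f] by apply: indepS ifh; apply: subsetUl.
  have [a [aK Ha]] : exists a, a \in K /\ forall b, b \in Q -> b != a -> indep M [set f; b].
    case: (classic (exists2 a, a \in K & dependent M [set f; a])) => [[a aK da]|no].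
      exists a; split=> // b bQ ba; apply: contraT => db.
      have aQ := subsetP KQ a aK; have := @span_card T M [set f] [set a; b] if_ (ipair a b aQ bQ).
      rewrite cards1 cards2 eq_sym ba => /(_ _)/negP; case=> // e.
      by rewrite !inE => /orP[]/eqP->; rewrite /spanned setUC ?da ?orbT // -/(dependent _ _) /dependent db orbT.
    have [a aK] := set0Pn _ (circuit_neq0 Kc); exists a; split=> // b bQ _.
    case: (boolP (b \in K)) => bK; last by rewrite (notK b).
    by apply: contraT => db; case: no; exists b.
  have aQ := subsetP KQ a aK; have af : a != f by apply: contraNneq fQ => <-.
  have : a \in f |: Q :\ a; last by rewrite !inE eqxx (negPf af).
  apply: inline => //; split.
    by rewrite cardsU1 !inE (negPf fQ) andbF; move: Q4; rewrite (cardsD1 a) aQ.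
  move=> X XS; case: ltnP => X2.
    apply/negP=> iX; have := span_card (ipair a h aQ hQ) iX.
    have ah : a != h by apply: contraNneq hK => <-.
    rewrite cards2 ah leqNgt X2 => /(_ _)/negP; case=> // e /(subsetP XS).
    rewrite !inE => /orP[/eqP->|/andP[_ eQ]]; first exact: rank2.
    exact: Qspan.
  apply/negbTE; rewrite negbK; case fX: (f \in X); last first.
    apply: iQ => //; apply/subsetP=> g gX; have := subsetP XS g gX; rewrite !inE.
    by case: (eqVneq g f) => [gf|_ /andP[]//]; rewrite -gf gX in fX.
  have : (#|X :\ f| <= 1)%N by move: X2; rewrite (cardsD1 f) fX.
  rewrite leq_eqVlt ltnS leqn0 cards_eq0 => /orP[/cards1P[b eqb]|/eqP e0].
    rewrite -(setD1K fX) eqb; have /setD1P[bf bX] : b \in X :\ f by rewrite eqb inE.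
    by have := subsetP XS b bX; rewrite !inE (negPf bf) /= => /andP[ba bQ]; apply: Ha.
  by rewrite -(setD1K fX) e0 setU0.
have inK a : a \in K -> spanned M [set h] a.
  move=> aK; have [i ri] := single a aK; have [iI ai _] := rows_incirc ri.
  apply: (row_span (Y := K) ih iI ai) => // b bi bK ba.
  have [j rj] := single b bK; case: (distinct a b i aK bK _ ri); first by rewrite eq_sym.
  have /setP/(_ i) := rj; rewrite !inE iI bi => /esym/eqP ij; by rewrite rj ij.
have /card_gt1P[a [b [aK bK ab]]] : (1 < #|K|)%N by rewrite K3.
have := span_card ih (ipair a b (subsetP KQ a aK) (subsetP KQ b bK)).
rewrite cards1 cards2 ab => /(_ _)/negP; case=> // e.
by rewrite !inE => /orP[]/eqP->; apply: inK.
Qed.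

End Rows.

(** * Regularity *)

Section CoreContradiction.
Variables (T J : finType) (F : fieldType) (M : matroid T) (I : {set J}) (C : J -> {set T}).
Variables (ZZ : {set {set T}}) (Q B : {set T}).
Hypotheses (cs : csys M I C) (bin : binary M ZZ) (cr : seven_core F ZZ Q B).
Let bZ := bin.1.
Let ZD := bZ.2.
Implicit Types D K N X Y Z : {set T}.

Lemma indepE X : indep M X = ~~ dep ZZ X.
Proof. by rewrite -bin.2 negbK. Qed.

Lemma B_indep : indep M B.
Proof. by rewrite indepE; case: cr => -[]. Qed.

Lemma B_small : (2 < #|B|)%N.
Proof. by case: cr => -[_ _ _ [] ->]. Qed.

Lemma Q_girth Z : Z \in ZZ -> Z != set0 -> Z \subset Q -> (#|B| <= #|Z|)%N.
Proof. by case: cr => _ + _ _ _; apply. Qed.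

Lemma Q_rank X : indep M X -> X \subset Q -> (#|X| <= #|B|)%N.
Proof.
move=> iX XQ; apply: (span_card B_indep iX) => e /(subsetP XQ) eQ.
have [[_ _ iB _] _ /subsetP/(_ e eQ) ecl _ _] := cr; rewrite /spanned.
case: (boolP (e \in B)) => //= eB; rewrite bin.2; have /andP[SB Si] := coordP ecl.
have eS : e \notin coords ZZ B e by apply: contra eB; apply: (subsetP SB).
apply/depP; exists (sdiff [set e] (coords ZZ B e)); split=> //.
  by apply/set0Pn; exists e; rewrite in_sdiff set11 (negPf eS).
by clear -SB; sets.
Qed.

(** Q contains no cycle smaller than B. If a maximal independent N inside X were smaller than B, two
    elements e and f of X would be left over; by this bound [e |: N] and [f |: N] are themselves
    cycles, and their sum {e, f} is too small. *)
Lemma sub_rank X : X \subset Q -> (#|B| < #|X|)%N -> exists N, [/\ indep M N, N \subset X,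
  #|N| = #|B| & forall e, e \in Q -> spanned M N e].
Proof.
move=> XQ ltX; have [N [iN NX sN]] := max_indep M X.
have NQ := subset_trans NX XQ; have leN := Q_rank iN NQ.
have eqN : #|N| = #|B|.
  apply/eqP; rewrite eqn_leq leN /= leqNgt; apply/negP=> ltN.
  have : (1 < #|X :\: N|)%N.
    have := cardsID N X; rewrite (setIidPr NX) => cX.
    by rewrite -(leq_add2l #|N|) cX addn2; apply: leq_trans ltX; rewrite ltnS.
  case/card_gt1P=> e [f [/setDP[eX eN] /setDP[fX fN] ef]].
  have key g : g \in X -> g \notin N -> g |: N \in ZZ.
    move=> gX gN; have := sN g gX; rewrite /spanned (negPf gN) /= bin.2 => /depP[Z [Zi Z0 ZS]].
    have gNQ : g |: N \subset Q by rewrite subUset sub1set NQ (subsetP XQ).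
    suff -> : g |: N = Z by [].
    apply/esym/eqP; rewrite eqEcard ZS; apply: leq_trans (Q_girth Zi Z0 (subset_trans ZS gNQ)).
    by rewrite cardsU1 gN.
  have Si := ZD (key e eX eN) (key f fX fN).
  have SE : sdiff (e |: N) (f |: N) = [set e; f].
    apply/setP=> g; rewrite in_sdiff !inE.
    case: (eqVneq g e) => [->|ge]; first by rewrite (negPf ef) (negPf eN).
    by case: (eqVneq g f) => [->|gf]; [rewrite (negPf fN) | rewrite addbb].
  have := Q_girth Si; rewrite SE cards2 ef leqNgt B_small => /(_ _ _)/negP; case=> //.
    by apply/set0Pn; exists e; rewrite !inE eqxx.
  by rewrite subUset !sub1set !(subsetP XQ).
exists N; split=> // e eQ; rewrite /spanned; apply: contraT; rewrite negb_or negbK => /andP[eN ieN].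
have : (#|e |: N| <= #|B|)%N by apply: Q_rank => //; rewrite subUset sub1set eQ.
by rewrite cardsU1 eN eqN add1n ltnn.
Qed.

(** More than [#|B|] points of Q remain outside Y, so they still span Q and the Hall condition
    applies to Y. *)
Lemma hall_Q Y (R : {set J}) : Y \subset Q -> (#|Y| + #|B| < 7)%N ->
  (forall e, e \in Y -> rows I C e \subset R) -> (#|Y| <= #|R|)%N.
Proof.
move=> YQ lt7 rY; have Q7 : #|Q| = 7 by case: cr => -[].
have [||N [iN NS _ sN]] := @sub_rank (Q :\: Y); first exact: subsetDl.
  by rewrite cardsD (setIidPr YQ) Q7 ltn_subRL.
apply: (hall_small cs iN (R := R)) => // e eY; last by apply: sN; apply: (subsetP YQ).
by apply/negP=> /(subsetP NS); rewrite inE eY.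
Qed.

Definition solitary Y := forall c, c \in Y -> c \in Q /\ forall e, e != c -> [set c; e] \notin ZZ.

(** An element off Q that lies in a circuit is a loop or parallel to a point of Q, and this point is
    not in Y because the points of Y have no parallel elements. *)
Lemma outside Y N : solitary Y -> indep M N -> (forall e, e \in Q :\: Y -> spanned M N e) ->
  forall f, f \in incirc M -> f \notin Y -> spanned M N f.
Proof.
move=> solY iN sN f fM fY.
case: (boolP (f \in Q)) => fQ; first by apply: sN; rewrite inE fY.
case: (boolP ([set f] \in ZZ)) => f0.
  apply/orP; right; rewrite bin.2; apply/depP; exists [set f]; split=> //; last exact: subsetUl.
  by apply/set0Pn; exists f; rewrite inE.
have [_ _ _ par _] := cr; case/incircP: fM => D Dc fD.
have Di : D \in ZZ by apply: circ_in; rewrite -(binary_circ _ bin).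
have [a aQ afi] := par f D fQ Di fD f0.
have fa : f != a by apply: contraNneq fQ => ->.
have aY : a \notin Y by apply/negP=> aY; have [_ /(_ f fa)] := solY a aY; rewrite afi.
have small g : [set g] \notin ZZ -> indep M [set g].
  move=> g0; rewrite indepE; apply: contra g0 => /depP[Z [Zi Z0]].
  by rewrite subset1 (negPf Z0) orbF => /eqP <-.
have a0 : [set a] \notin ZZ.
  have ne : [set a] != set0 by apply/set0Pn; exists a; rewrite inE.
  apply/negP=> ai; have := Q_girth ai ne; rewrite cards1 sub1set => /(_ aQ).
  by rewrite leqNgt (ltn_trans _ B_small).
have afc : circuit M [set a; f].
  apply/circuitP; split.
    rewrite bin.2; apply/depP; exists [set a; f]; split=> //.
    by apply/set0Pn; exists a; rewrite !inE eqxx.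
  move=> g; rewrite !inE => /orP[]/eqP->.
    by apply: indepS (small f f0); apply/subsetP=> h; rewrite !inE; case: (h == a).
  by apply: indepS (small a a0); apply/subsetP=> h; rewrite !inE orbC; case: (h == f).
apply: (span_circuit iN afc); first by rewrite !inE eqxx orbT.
move=> g; rewrite !inE => /orP[/eqP-> _|/eqP->]; last by rewrite eqxx.
by apply: sN; rewrite inE aY.
Qed.

(** N spans Q, whose rank is [#|B|], but has only the points of Q outside Y at its disposal. *)
Lemma solitary_bound Y N : Y \subset Q -> indep M N -> N \subset Q :\: Y ->
  (forall e, e \in Q :\: Y -> spanned M N e) -> (forall e, e \in Y -> spanned M N e) ->
  (#|Y| + #|B| <= 7)%N.
Proof.
move=> YQ iN NS sN sY; have [[Q7 BQ _ _] _ _ _ _] := cr.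
have : (#|B| <= #|N|)%N.
  apply: (span_card iN B_indep) => e /(subsetP BQ) eQ.
  by case: (boolP (e \in Y)) => eY; [apply: sY | apply: sN; rewrite inE eY].
move=> leB; have := leq_trans leB (subset_leq_card NS).
by rewrite cardsD (setIidPr YQ) Q7 leq_subRL // -Q7 subset_leq_card.
Qed.

Hypothesis deletable : forall c (R : {set J}), rows I C c = R -> R != set0 -> (#|R| <= 2)%N ->
  frep F (dep (del c ZZ)).

(* K is a circuit of elements lying on a single cycle, and K1 one of elements lying
   on a single cycle other than C i1.  By Hall's condition each cycle meets K :|: K1
   so little that Q minus K (or minus K :|: K1) spans Q, but it is too small. *)
Lemma core_contradiction : False.
Proof.
have [[Q7 BQ iB B34] _ _ _ sole] := cr.
have circQ Z : circuit M Z -> Z \in ZZ by rewrite (binary_circ _ bin) => /circ_in.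
have I0 : I != set0.
  apply: contraTneq isT => I0; have := cs; rewrite I0 => cs0.
  have [e eQ eB] : exists2 e, e \in Q & e \notin B.
    apply/subsetPn/negP=> QB; have := subset_leq_card QB.
    by rewrite Q7; case: B34 => ->.
  have := Q_rank (csys_empty (e |: B) cs0); rewrite subUset sub1set eQ BQ cardsU1 eB ltnn.
  by move/(_ isT).
have [K Kc KU] := dep_circuit (csys_dep cs I0 (subxx I)).
have rowK c : c \in K -> exists i, rows I C c = [set i].
  by move=> /(subsetP KU)/uu_rows[i _ ri]; exists i.
have solK : solitary K.
  move=> c cK; have [i ri] := rowK c cK; apply: sole; apply: (deletable ri); rewrite ?cards1 //.
  by apply/set0Pn; exists i; rewrite inE.
have KQ : K \subset Q by apply/subsetP=> c /solK[].
have K0 := circuit_neq0 Kc; have Ki := circQ K Kc.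
have hall2 a b i : a \in Q -> b \in Q -> a != b -> rows I C a \subset [set i] -> rows I C b \subset [set i] -> False.
  move=> aQ bQ ab ra rb; have := @hall_Q [set a; b] [set i].
  rewrite subUset !sub1set aQ bQ cards2 ab cards1 => /(_ isT _ _)/negP; case=> //.
    by case: B34 => ->.
  by move=> e; rewrite !inE => /orP[]/eqP->.
have [a1 a1K] := set0Pn _ K0; have [i1 r1] := rowK a1 a1K.
have sameK a b i : a \in K -> b \in K -> i \in I -> a \in C i -> b \in C i -> a = b.
  move=> aK bK iI ai bi; apply/eqP/negPn/negP=> ab.
  have rr c : c \in K -> c \in C i -> rows I C c \subset [set i].
    move=> cK ci; have [j rj] := rowK c cK; have : i \in rows I C c by rewrite inE iI.
    by rewrite rj => /set1P->.
  by apply: (hall2 a b i) => //; rewrite ?rr // (subsetP KQ).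
(* In the Fano plane K may have just three points, and 3 + 3 does not exceed 7, so a second circuit
   K1 is needed. It avoids a1 because the only row of a1, i1, is left out. *)
case: B34 => B34.
  have [i1I a1i1 _] := rows_incirc cs r1.
  have Ii : I :\ i1 != set0.
    have /card_gt1P[a [b [aK bK ab]]] : (1 < #|K|)%N.
      by apply: leq_trans (Q_girth Ki K0 KQ); rewrite B34.
    have [c cK ca] : exists2 c, c \in K & c != a1.
      by case: (eqVneq a a1) => [<-|na]; [exists b; rewrite // eq_sym | exists a].
    have [j rj] := rowK c cK; have [jI cj _] := rows_incirc cs rj.
    apply/set0Pn; exists j; rewrite !inE jI andbT; apply: contraNneq ca => ji.
    by rewrite (sameK c a1 j) // ji.
  have [K1 K1c K1U] := dep_circuit (csys_dep cs Ii (subsetDl _ _)).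
  have rowK1 k : k \in K1 -> exists j, [/\ j \in I, j != i1, k \in C j & rows I C k \subset [set i1; j]].
    move=> /(subsetP K1U)/uu_rows[j]; rewrite !inE => /andP[ji jI] rj.
    have kj : k \in C j by have /setP/(_ j) := rj; rewrite !inE eqxx => /andP[].
    exists j; split=> //; apply/subsetP=> l; rewrite !inE => /andP[lI kl].
    case: (eqVneq l i1) => //= li; have /setP/(_ l) := rj.
    by rewrite !inE li lI kl.
  have solK1 : solitary K1.
    move=> k kK; have [j [jI ji kj rj]] := rowK1 k kK; apply: sole; apply: (deletable erefl).
      by apply/set0Pn; exists j; rewrite inE jI.
    by apply: leq_trans (subset_leq_card rj) _; rewrite cards2; case: (_ != _).
  have K1Q : K1 \subset Q by apply/subsetP=> c /solK1[].
  have K10 := circuit_neq0 K1c; have K1i := circQ K1 K1c.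
  have a1K1 : a1 \notin K1.
    apply/negP=> /rowK1[j [jI ji a1j _]]; have /setP/(_ j) := r1.
    by rewrite !inE jI a1j (negPf ji).
  have hall3 a b c i j : a \in Q -> b \in Q -> c \in Q -> a != b -> a != c -> b != c ->
      rows I C a \subset [set i; j] -> rows I C b \subset [set i; j] -> rows I C c \subset [set i; j] -> False.
    move=> aQ bQ cQ ab ac bc ra rb rc; have := @hall_Q [set a; b; c] [set i; j].
    have -> : #|[set a; b; c]| = 3.
      by rewrite -seq3E cardsE (card_uniqP _) //= !inE negb_or ab ac bc.
    rewrite !subUset !sub1set aQ bQ cQ B34 => /(_ isT isT _); move=> H.
    have : (3 <= #|[set i; j]|)%N by apply: H => e; rewrite !inE => /orP[/orP[]|]/eqP->.
    by rewrite cards2; case: (_ != _).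
  have [N [iN NS sN]] := max_indep M (Q :\: (K :|: K1)).
  have solY : solitary (K :|: K1) by move=> c /setUP[]; [apply: solK | apply: solK1].
  have YQ : K :|: K1 \subset Q by rewrite subUset KQ.
  have out := outside solY iN sN.
  have a1Q := subsetP KQ a1 a1K.
  have r1' j : rows I C a1 \subset [set i1; j] by rewrite r1 subsetUl.
  have rk c i j : c \in K -> i \in I -> c \in C i -> rows I C c \subset [set j; i].
    move=> cK iI ci; have [l rl] := rowK c cK; have : i \in rows I C c by rewrite inE iI.
    by rewrite rl => /set1P->; rewrite subsetUr.
  have rk1 c i : c \in K1 -> i \in I -> i != i1 -> c \in C i -> rows I C c \subset [set i1; i].
    move=> cK iI ii ci; have [l [lI li cl rl]] := rowK1 c cK.
    have := subsetP rl i; rewrite !inE iI ci (negPf ii) => /(_ isT)/eqP->; exact: rl.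
  have neq c d (X : {set T}) : c \in X -> d \notin X -> c != d by move=> cX; apply: contraNneq => <-.
  (* Another element b of K or K1 on the row j of k would give, with a1 and k, three points whose
     rows all lie in {i1, j}, against the Hall condition. *)
  have sK1 k : k \in K1 -> spanned M N k.
    move=> kK; have [j [jI ji kj rj]] := rowK1 k kK.
    apply: (row_span cs (Y := K :|: K1) iN jI kj) => // b bj bY bk.
    have bQ := subsetP YQ b bY; have kQ := subsetP K1Q k kK.
    have ak : a1 != k by rewrite eq_sym (neq k a1 K1).
    case: (boolP (b \in K1)) => bK1.
      have ab : a1 != b by rewrite eq_sym (neq b a1 K1).
      by case: (hall3 a1 b k i1 j a1Q bQ kQ ab ak bk (r1' j) _ rj); apply: rk1.
    have bK : b \in K by case/setUP: bY => // bK1'; rewrite bK1' in bK1.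
    have ab : a1 != b.
      rewrite eq_sym; apply: contraNneq ji => ba; have /setP/(_ j) := r1.
      by rewrite !inE jI -ba bj => /esym.
    by case: (hall3 a1 b k i1 j a1Q bQ kQ ab ak bk (r1' j) _ rj); apply: rk.
  have sK a : a \in K -> a != a1 -> spanned M N a.
    move=> aK aa1; case: (boolP (a \in K1)) => aK1; first exact: sK1.
    have [i ri] := rowK a aK; have [iI ai _] := rows_incirc cs ri.
    have ii1 : i != i1.
      by apply: contraNneq aa1 => ii; apply/eqP; apply: (sameK a a1 i) => //; rewrite ii.
    apply: (row_span cs (Y := K :|: K1) iN iI ai) => // b bi bY ba.
    case: (boolP (b \in K)) => bK; first by rewrite (sameK b a i) ?eqxx in ba.
    have bK1 : b \in K1 by case/setUP: bY => // bK'; rewrite bK' in bK.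
    have ab : a1 != b by rewrite eq_sym (neq b a1 K1).
    have a1a : a1 != a by rewrite eq_sym.
    have bQ := subsetP YQ b bY; have aQ := subsetP KQ a aK.
    by case: (hall3 a1 b a i1 i a1Q bQ aQ ab a1a ba (r1' i)); [apply: rk1 | apply: rk].
  have sA1 : spanned M N a1.
    apply: (row_span cs (Y := K :|: K1) iN i1I a1i1) => // b bi /setUP[bK|bK1] ba.
      exact: sK.
    exact: sK1.
  have sY e : e \in K :|: K1 -> spanned M N e.
    by case/setUP=> [eK|]; [case: (eqVneq e a1) => [->|] //; apply: sK | apply: sK1].
  have := solitary_bound YQ iN NS sN sY; rewrite B34.
  have S0 : sdiff K K1 != set0.
    by apply/set0Pn; exists a1; rewrite in_sdiff a1K (negPf a1K1).
  have SQ : sdiff K K1 \subset Q by clear -KQ K1Q; sets.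
  (* K, K1 and K + K1 have at least three points each and together count every point of the union
     twice. So the union has at least five points, while [solitary_bound] allows four. *)
  have := Q_girth (ZD Ki K1i) S0 SQ; have := Q_girth Ki K0 KQ; have := Q_girth K1i K10 K1Q.
  rewrite B34.
  have -> : sdiff K K1 = (K :\: K1) :|: (K1 :\: K) by sets.
  have -> : #|K :\: K1 :|: K1 :\: K| = (#|K :\: K1| + #|K1 :\: K|)%N.
    rewrite -cardsUI (_ : _ :&: _ = set0) ?cards0 ?addn0 //.
    by apply/setP=> g; rewrite !inE; case: (g \in K); case: (g \in K1).
  have := cardsUI K K1; rewrite -(cardsID K1 K) -(cardsID K K1) (setIC K1 K).
  by move: #|K :|: K1| #|K :&: K1| #|K :\: K1| #|K1 :\: K| => u v p r; clear; lia.
(* In the dual Fano plane K alone suffices: it has at least four points, while [solitary_bound]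
   allows three. *)
have [N [iN NS sN]] := max_indep M (Q :\: K).
have sK a : a \in K -> spanned M N a.
  move=> aK; have [i ri] := rowK a aK; have [iI ai _] := rows_incirc cs ri.
  apply: (row_span cs (Y := K) iN iI ai) => [b bi bK ba|].
    by rewrite (sameK b a i) ?eqxx in ba.
  exact: outside.
have := solitary_bound KQ iN NS sN sK; have := Q_girth Ki K0 KQ; rewrite B34.
by move: #|K| => k; clear; lia.
Qed.

End CoreContradiction.

Lemma del_dep (T : finType) (ZZ : {set {set T}}) c (A : {set T}) :
  dep (del c ZZ) A = dep ZZ (A :\ c).
Proof.
apply/depP/depP=> -[Z].
  by rewrite inE => -[/andP[Zi cZ] Z0 ZA]; exists Z; rewrite subsetD1 ZA.
by rewrite subsetD1 => -[Zi Z0 /andP[ZA cZ]]; exists Z; rewrite inE Zi.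
Qed.

(** The induction also carries that the minors are binary. This shows that M is binary, which in
    turn makes the deletions of elements on two rows available for the representability over F. *)
Lemma csys_regular (T J : finType) (M : matroid T) (I : {set J}) (C : J -> {set T}) :
  csys M I C -> exists ZZ, binary M ZZ /\ forall F : fieldType, frep F (dep ZZ).
Proof.
have [n] := ubnP #|incirc M|; elim: n M I C => // n IHn M I C ltn cs.
have IHc e (ie : indep M [set e]) : e \in incirc M ->
    exists ZZ, binary (contract ie) ZZ /\ forall F : fieldType, frep F (dep ZZ).
  move=> eM; apply: (IHn (contract ie)); last exact: (csys_contract ie cs).
  by apply: leq_trans (incirc_contract ie eM) _; rewrite -ltnS.
have IHd e i (I' : {set J}) C' : i \in I -> e \in C i -> csys (delete M e) I' C' ->
    exists ZZ, binary (delete M e) ZZ /\ forall F : fieldType, frep F (dep ZZ).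
  move=> iI ei cs'; have [D [Dc eD _]] := csys_cycle cs iI ei; apply: (IHn _ I' C' _ cs').
  by apply: leq_trans (incirc_delete _) _; [apply/incircP; exists D | rewrite -ltnS].
have del1 c i : rows I C c = [set i] ->
    exists ZZ, binary (delete M c) ZZ /\ forall F : fieldType, frep F (dep ZZ).
  move=> rc; have [iI ci _] := rows_incirc cs rc.
  exact: IHd iI ci (csys_delete1 cs rc).
have contractions e : e \in incirc M -> indep M [set e] ->
    exists ZZ, bspace ZZ /\ forall A, dependent M (e |: A) = dep ZZ A.
  by move=> eM ie; have [ZZ [[bZ HZ] _]] := IHc e ie eM; exists ZZ.
have [ZZ bin] : exists ZZ, binary M ZZ.
  apply: (binary_of_contractions contractions) => -[Q].
  apply: (no_line4 cs contractions) => c i /del1[ZZ [bin _]]; by exists ZZ.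
have [bZ HZ] := bin; exists ZZ; split=> // F; apply: NNPP => nrep.
have [|Q [B cr]] := exists_core bZ nrep.
  move=> e Z e0 Zi eZ; have [D [Dc eD _]] := circ_thru bZ Zi eZ.
  have eM : e \in incirc M by apply/incircP; exists D; rewrite // (binary_circ _ bin).
  have ie : indep M [set e].
    rewrite (indepE bin); apply: contra e0 => /depP[Y [Yi Y0]].
    by rewrite subset1 (negPf Y0) orbF => /eqP <-.
  have [Ze [[be He] fe]] := IHc e ie eM; apply: frep_ext (fe F) => A.
  by rewrite con_dep // -HZ -He.
apply: (core_contradiction cs bin cr) => c R rc R0 R2.
have to_del Zc : binary (delete M c) Zc -> frep F (dep Zc) -> frep F (dep (del c ZZ)).
  by case=> _ Hc; apply: frep_ext => A; rewrite del_dep -Hc delete_dep HZ.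
have := R2; rewrite leq_eqVlt ltnS => /orP[/cards2P[i [k [ik eR]]]|R1].
  rewrite eR in rc; have /setIdP[iI ci] : i \in rows I C c by rewrite rc !inE eqxx.
  by have [Zc [bc fc]] := IHd c i _ _ iI ci (csys_delete2 bZ HZ cs ik rc); apply: to_del bc (fc F).
have /eqP/cards1P[i eR] : #|R| = 1 by apply/eqP; rewrite eqn_leq R1 card_gt0.
by rewrite eR in rc; have [Zc [bc fc]] := del1 c i rc; apply: to_del bc (fc F).
Qed.

(** Stack chains of all circuits as rows of a matrix W. The rows of its cokernel matrix K are the
    vectors sought: their linear relations form the row space of W, which lies in R and contains a
    chain for each circuit. *)
Lemma frep_representable (T : finType) (F : fieldType) (M : matroid T) :
  frep F (dependent M) -> representable F M.
Proof.
case=> R rR.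
(* W gets a row for every set D; when D is not a circuit any relation will do, for instance 0. *)
have exc (D : {set T}) : exists c : {ffun T -> F}, R c /\ (circuit M D -> supp c = D).
  case: (boolP (circuit M D)) => [Dc|_]; last by exists 0; split=> //; apply: code0 rR.
  by have [c Rc cD] := code_circ rR Dc; exists c.
have [ch Hch] := fin_all_exists exc.
pose m := #|{set T}|; pose n := #|T|.
pose W : 'M[F]_(m, n) := \matrix_(i, j) ch (enum_val i) (enum_val j).
pose K := cokermx W.
pose vec (c : {ffun T -> F}) : 'rV[F]_n := \row_j c (enum_val j).
have vecK c : vec c *m K = 0 <-> exists a : 'rV[F]_m, vec c = a *m W.
  split=> [/eqP cK|[a ->]]; last by rewrite -mulmxA mulmx_coker mulmx0.
  have /submxP[a ->] : (vec c <= W)%MS by rewrite submxE.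
  by exists a.
have spanR c : vec c *m K = 0 -> R c.
  case/vecK=> a ca; have -> : c = \sum_i sc (a 0 i) (ch (enum_val i)).
    apply/ffunP=> x; have := congr1 (fun u : 'rV[F]_n => u 0 (enum_rank x)) ca.
    rewrite !mxE enum_rankK => ->; rewrite sum_ffunE; apply: eq_bigr => i _.
    by rewrite mxE scE enum_rankK.
  elim/big_ind: _ => [|c1 c2|i _]; [exact: code0 rR | by move=> *; apply: (codeD rR) |].
  by apply: (codeZ rR); case: (Hch (enum_val i)).
have chK D : vec (ch D) *m K = 0.
  apply/vecK; exists (delta_mx 0 (enum_rank D)); apply/rowP=> j.
  by rewrite -rowE !mxE enum_rankK.
pose v x : 'cV[F]_n := (row (enum_rank x) K)^T.
have sumv (c : {ffun T -> F}) : (\sum_x c x *: v x)^T = vec c *m K.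
  rewrite mulmx_sum_row linear_sum (reindex (@enum_val T T)) /=; last first.
    by exists enum_rank => x _; rewrite ?enum_valK ?enum_rankK.
  by apply: eq_bigr => j _; rewrite linearZ /= trmxK !mxE enum_valK.
exists n, v => A.
pose X := map_tuple v (enum_tuple A).
have -> : free [seq v x | x <- enum A] = free X by [].
have Xi (i : 'I_#|A|) : X`_i = v (enum_val i).
  by rewrite (nth_map (enum_default i)) ?size_enum_ord // -cardE.
have sumX (c : {ffun T -> F}) : supp c \subset A ->
    \sum_(i < #|A|) c (enum_val i) *: X`_i = \sum_x c x *: v x.
  move=> cA; under eq_bigr do rewrite Xi.
  rewrite -(big_enum_val (fun x => c x *: v x)) [RHS](bigID (mem A)) /= [X in _ + X]big1 ?addr0 //.
  by move=> x xA; rewrite suppN ?scale0r //; apply: contra xA; apply: (subsetP cA).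
apply/idP/freeP=> [iA k k0 i|fX].
  pose c := [ffun x => \sum_(j < #|A| | enum_val j == x) k j].
  have ck j : c (enum_val j) = k j.
    by rewrite ffunE (big_pred1 j) // => l; rewrite /= (inj_eq enum_val_inj).
  have cA : supp c \subset A.
    apply: supp_sub => x xA; rewrite ffunE big1 // => j /eqP jx.
    by rewrite -jx enum_valP in xA.
  have Rc : R c.
    apply: spanR; rewrite -sumv -sumX //; under eq_bigr do rewrite ck.
    by rewrite k0 trmx0.
  rewrite -ck; apply: suppN; apply/negP=> ic.
  have : dependent M (supp c) by apply: (code_dep rR) => //; apply/set0Pn; exists (enum_val i).
  by move/(dep_mono cA); rewrite /dependent iA.
apply: contraT => /dep_circuit[D Dc DA].
have [_ /(_ Dc) sD] := Hch D; have [x xD] := set0Pn _ (circuit_neq0 Dc).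
have := fX (fun i => ch D (enum_val i)); rewrite sumX ?sD //.
have -> : \sum_x ch D x *: v x = 0 by apply: trmx_inj; rewrite sumv chK trmx0.
move/(_ erefl (enum_rank_in (subsetP DA x xD) x)); rewrite enum_rankK_in ?(subsetP DA) //.
by move/eqP; rewrite -[_ == 0]negbK -in_supp sD xD.
Qed.

Theorem theorem5p8 (T : finType) (M : matroid T)
    (C : 'I_(corank M) -> {set T}) (hC : cycle_system C) :
  regular M.
Proof.
case: hC => cyc dp.
have cs : csys M [set: 'I_(corank M)] C.
  split; last by move=> S S0 _; apply: dp.
    have [B iB mB] : exists2 B, indep M B & rank M = #|B|.
      have h0 : (0 < #|[pred A | indep M A]|)%N by apply/card_gt0P; exists set0; apply: indep0.
      by have [B iB eB] := eq_bigmax_cond (fun A : {set T} => #|A|) h0; exists B.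
    by exists B => //; rewrite cardsT card_ord /corank mB -leq_subLR.
  move=> i e _ eC; have [P Pc eP] := cyc i; move: eC; rewrite eP => /bigcupP[D DP eD].
  by exists D; split=> //; [apply: Pc | apply: bigcup_sup].
have [ZZ [[bZ HZ] fr]] := csys_regular cs.
move=> F; apply: frep_representable; apply: frep_ext (fr F) => A; by rewrite HZ.
Qed.
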